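(* Let $\mathcal A$ and $\mathcal B$ be two strictly unital $A_\infty$-categories. The generalized Yoneda $A_\infty$-functor $$z:\mathrm{Func}_\infty(\mathcal A,\mathcal B)\to\mathcal C_\infty(\mathcal A,\mathcal B)$$ induces a quasi-isomorphism in the morphism spaces, i.e. for all strictly unital $A_\infty$-functors $f_1,f_2:\mathcal A\to\mathcal B$ the morphism of complexes $z_1:\mathrm{Hom}_{\mathrm{Func}_\infty}(f_1,f_2)\to\mathrm{Hom}_{\mathcal C_\infty(\mathcal A,\mathcal B)}(z(f_1),z(f_2))$ is a quasi-isomorphism.
   Context: $\mathbb K$ is a field; everything is $\mathbb Z$-graded over $\mathbb K$ with Koszul signs; $(SM)^i=M^{i+1}$, $s:M\to SM$ canonical of degree $-1$, $\omega=s^{-1}$. An $A_\infty$-category $\mathcal A$ on a set $\mathbb A$ of objects: graded spaces $\mathcal A(A,A')$ and maps $m_n:\mathcal A(A_{n-1},A_n)\otimes\cdots\otimes\mathcal A(A_0,A_1)\to\mathcal A(A_0,A_n)$ ($n\ge1$) of degree $2-n$ with $\sum_{j+k+l=n}(-1)^{jk+l}m_{j+1+l}(\mathbf 1^{\otimes j}\otimes m_k\otimes\mathbf 1^{\otimes l})=0$; $b_n=-s\,m_n\,\omega^{\otimes n}$. Strictly unital: degree $0$ elements $\mathrm{id}_A$ that are units for $m_2$ and such that $m_n$, $n\ne2$, vanishes if one argument is an identity. Let $T^c(S\mathcal A)=\bigoplus_{i\ge0}(S\mathcal A)^{\odot i}$ ($\odot$ = tensor product over $\mathbb A$, the $i=0$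 term being $\mathbb K$ on each $(A,A)$), with deconcatenation $\Delta$, iterated $\Delta^{(n)}$ (with $\Delta^{(0)}$ the counit), and the differential $b$ given by the $b_n$ (zero on $i=0$). An $A_\infty$-functor $f:\mathcal A\to\mathcal B$: a map $\dot f$ on objects and $f_n:\mathcal A(A_{n-1},A_n)\otimes\cdots\otimes\mathcal A(A_0,A_1)\to\mathcal B(\dot fA_0,\dot fA_n)$ of degree $1-n$ such that $F_n=sf_n\omega^{\otimes n}$ ($n\ge1$) are the components of a dg coalgebra map; strictly unital: $f_1(\mathrm{id}_A)=\mathrm{id}_{\dot fA}$ and $f_n$ ($n\ge2$) vanishes if an argument is an identity. Write $F:T^c(S\mathcal A)\to S\mathcal B$ for the degree $0$ map with components $F_n$, $n\ge1$, and $0$ for $n=0$. $\mathrm{Func}_\infty(\mathcal A,\mathcal B)$: objects are the strictly unital $A_\infty$-functors. The suspended morphism space $S\mathrm{Hom}(f_1,f_2)$ is the space of graded maps $H:T^c(S\mathcal A)(A,A')\to S\mathcal B(\dot f_1A,\dot f_2A')$, $A,A'\in\mathbb A$, that vanish on tensors having an identity among their factors. Its compositions (in the form $b_i=-sm_i\omega^{\otimes i}$), for $H_t\in S\mathrm{Hom}(f_{t-1},f_t)$, $1\le t\le i$, are $$b_i(H_i\otimes\cdots\otimes H_1)=\sum_{l_0,\dots,l_i\ge0}b^{\mathcal B}_{i+\sum l_t}\big(F_i^{\otimes l_0}\otimes H_i\otimes F_{i-1}^{\otimes l_1}\otimes H_{i-1}\otimes\cdots\otimes H_1\otimes F_0^{\otimes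 l_i}\big)\Delta^{(i+\sum l_t)}$$ (where here $F_t:T^c(S\mathcal A)\to S\mathcal B$ is the map attached to $f_t$), with, for $i=1$, the additional term $-(-1)^{|H_1|}H_1\circ b$. An $\mathcal A$-$\mathcal B$-bipolydule: graded spaces $M(B,A)$ with maps $b_{p,q}$ ($p,q\ge0$) of degree $+1$: $S\mathcal A(A_{p-1},A_p)\otimes\cdots\otimes S\mathcal A(A_0,A_1)\otimes SM(B_q,A_0)\otimes S\mathcal B(B_{q-1},B_q)\otimes\cdots\otimes S\mathcal B(B_0,B_1)\to SM(B_0,A_p)$ such that the induced bicomodule coderivation on $BM=T^c(S\mathcal A)\odot SM\odot T^c(S\mathcal B)$ squares to zero; with $m_{p,q}$ defined by $\omega b_{p,q}=-m_{p,q}\omega^{\otimes p+1+q}$ it is strictly unital if $m_{1,0}(\mathrm{id}\otimes-)=m_{0,1}(-\otimes\mathrm{id})=\mathbf 1$ and $m_{p,q}$ with $(p,q)\notin\{(1,0),(0,1)\}$ vanishes if an $\mathcal A$- or $\mathcal B$-argument is an identity. $\mathcal C_\infty(\mathcal A,\mathcal B)$ is the dg category of strictly unital bipolydules, with morphisms $M\to M'$ the graded bicomodule maps $G:BM\to BM'$ whose components vanish if an $\mathcal A$- or $\mathcal B$-argument is an identity, with differential $b\circ G-(-1)^{|G|}G\circ b$. The functor $z$ is the composite of $\mathrm{Func}_\infty(\mathcal A,\mathcal B)\to\mathrm{Func}_\infty(\mathcal A,\mathcal C_\infty\mathcal B)$, composition with the Yoneda $A_\infty$-functor $\mathcal B\to\mathcal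 C_\infty\mathcal B$, $B\mapsto\mathcal B(?,B)$ (with $\mathcal C_\infty\mathcal B$ the dg category of strictly unital right $A_\infty$-modules), with the canonical isomorphism $\mathrm{Func}_\infty(\mathcal A,\mathcal C_\infty\mathcal B)\cong\mathcal C_\infty(\mathcal A,\mathcal B)$. Explicitly: $z(f)$ is the bipolydule $(B,A)\mapsto\mathcal B(B,\dot fA)$ with $b_{p,q}(\phi\otimes\kappa\otimes\psi)=\sum_{l\ge0}b^{\mathcal B}_{l+1+q}\big(F^{\otimes l}\Delta^{(l)}(\phi)\otimes\kappa\otimes\psi\big)$ for $\phi\in(S\mathcal A)^{\odot p}$, $\psi\in(S\mathcal B)^{\odot q}$; and $z_1$ sends the morphism corresponding to $H\in S\mathrm{Hom}(f_1,f_2)$ to the bicomodule map with components $$\phi\otimes\kappa\otimes\psi\mapsto(-1)^{|H|}\sum_{l,m\ge0}b^{\mathcal B}_{l+m+2+q}\big((F_2^{\otimes l}\otimes H\otimes F_1^{\otimes m})\Delta^{(l+1+m)}(\phi)\otimes\kappa\otimes\psi\big),$$ where $F_1,F_2$ are the maps $T^c(S\mathcal A)\to S\mathcal B$ attached to $f_1,f_2$. *)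

(* Defs.v *)
From HB Require Import structures.
From mathcomp Require Import all_boot all_order all_algebra.
From mathcomp Require Import boolp.

Set Implicit Arguments.
Unset Strict Implicit.
Unset Printing Implicit Defensive.

Import GRing.Theory.
Local Open Scope ring_scope.

(* Families (f_i)_i with f_i in V i, as a K-module; iterating dmap gives spaces
   of maps in several arguments.  boolp is needed only here. *)
Definition dmap (I : Type) (K : fieldType) (V : I -> lmodType K) : Type :=
  forall i, V i.

Section DmapModule.
Variables (I : Type) (K : fieldType) (V : I -> lmodType K).
Implicit Types f g h : dmap V.

Let dadd f g : dmap V := fun i => f i + g i.
Let dopp f : dmap V := fun i => - f i.
Let dzero : dmap V := fun=> 0.
Let dscale (a : K) f : dmap V := fun i => a *: f i.

Fact daddA : associative dadd.
Proof. by move=> f g h; apply: functional_extensionality_dep => i; apply: addrA. Qed.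
Fact daddC : commutative dadd.
Proof. by move=> f g; apply: functional_extensionality_dep => i; apply: addrC. Qed.
Fact dadd0 : left_id dzero dadd.
Proof. by move=> f; apply: functional_extensionality_dep => i; apply: add0r. Qed.
Fact daddN : left_inverse dzero dopp dadd.
Proof. by move=> f; apply: functional_extensionality_dep => i; apply: addNr. Qed.

HB.instance Definition _ := gen_eqMixin (dmap V).
HB.instance Definition _ := gen_choiceMixin (dmap V).
HB.instance Definition _ :=
  GRing.isZmodule.Build (dmap V) daddA daddC dadd0 daddN.

Fact dscaleA (a b : K) f : dscale a (dscale b f) = dscale (a * b) f.
Proof. by apply: functional_extensionality_dep => i; apply: scalerA. Qed.
Fact dscale1 : left_id 1 dscale.
Proof. by move=> f; apply: functional_extensionality_dep => i; apply: scale1r. Qed.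
Fact dscaleDr : right_distributive dscale +%R.
Proof. by move=> a f g; apply: functional_extensionality_dep => i; apply: scalerDr. Qed.
Fact dscaleDl f : {morph dscale^~ f : a b / a + b}.
Proof. by move=> a b; apply: functional_extensionality_dep => i; apply: scalerDl. Qed.

HB.instance Definition _ := GRing.Zmodule_isLmodule.Build K (dmap V)
  dscaleA dscale1 dscaleDr dscaleDl.
End DmapModule.

(* A Z-grading V = (+)_i V^i, given by the projections onto the V^i; gr_supp v
   is any finite list of degrees outside of which v has no component. *)
Record grading (K : fieldType) (V : lmodType K) := Grading {
  gr_part : int -> {linear V -> V};
  gr_supp : V -> seq int;
  gr_partK : forall i j v,
    gr_part i (gr_part j v) = if i == j then gr_part j v else 0;
  gr_supp_uniq : forall v, uniq (gr_supp v);
  gr_sum : forall v, \sum_(i <- gr_supp v) gr_part i v = v }.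

Definition homog (K : fieldType) (V : lmodType K) (g : grading V) (i : int)
  (v : V) : Prop := gr_part g i v = v.

(* The Koszul sign v |-> (-1)^(n |v|) v of a degree n map moving past v,
   extended linearly to inhomogeneous v. *)
Definition ksign (K : fieldType) (V : lmodType K) (g : grading V) (n : int)
  (v : V) : V := \sum_(i <- gr_supp g v) ((-1) ^ (n * i) : K) *: gr_part g i v.

(* (SV)^i = V^(i+1).  The suspension SV is V itself with the shifted grading,
   so that s and omega are the identity of V, of degree -1 and +1. *)
Section Shift.
Variables (K : fieldType) (V : lmodType K) (g : grading V).

Fact shift_partK i j v : gr_part g (i + 1) (gr_part g (j + 1) v) =
  if i == j then gr_part g (j + 1) v else 0.
Proof. by rewrite gr_partK (inj_eq (addIr 1)). Qed.

Fact shift_supp_uniq v : uniq [seq i - 1 | i <- gr_supp g v].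
Proof. by rewrite map_inj_uniq ?gr_supp_uniq //; apply: addIr. Qed.

Fact shift_sum v :
  \sum_(i <- [seq i - 1 | i <- gr_supp g v]) gr_part g (i + 1) v = v.
Proof.
by rewrite big_map -[RHS](gr_sum g); apply: eq_bigr => i _; rewrite subrK.
Qed.

Definition shift : grading V :=
  Grading (gr_part := fun i => gr_part g (i + 1))
    shift_partK shift_supp_uniq shift_sum.
End Shift.

(* Composable strings t_n, ..., t_1 with t_i in T A_(i-1) A_i: the pure tensors
   of T(A_(n-1), A_n) (x) ... (x) T(A_0, A_1), leftmost factor first.  The
   empty string at A stands for the unit of K in the i = 0 term of T^c. *)
Inductive str (Ob : Type) (T : Ob -> Ob -> Type) : Ob -> Ob -> Type :=
| snil A : str T A A
| scons A0 A1 A2 : T A1 A2 -> str T A0 A1 -> str T A0 A2.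
Arguments snil {Ob T} A.
Arguments scons {Ob T A0 A1 A2}.

Section Strings.
Variables (Ob : Type) (T : Ob -> Ob -> Type).

Fixpoint ssize A0 A1 (u : str T A0 A1) : nat :=
  if u is scons _ _ _ _ u' then (ssize u').+1 else 0%N.

Fixpoint scat A1 A2 (u : str T A1 A2) : forall A0, str T A0 A1 -> str T A0 A2 :=
  match u with
  | snil _ => fun _ v => v
  | scons _ _ _ x u' => fun _ v => scons x (scat u' v)
  end.

Definition sins A0 A1 A2 A3 (u : str T A2 A3) (x : T A1 A2) (v : str T A0 A1) :
  str T A0 A3 := scat u (scons x v).

Record cut A0 A2 := Cut {
  cmid : Ob; chead : str T cmid A2; ctail : str T A0 cmid }.

(* The terms of the deconcatenation Delta u. *)
Fixpoint cuts A0 A2 (u : str T A0 A2) : seq (cut A0 A2) :=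
  match u with
  | snil A => [:: Cut (snil A) (snil A)]
  | scons _ _ _ x u' => Cut (snil _) (scons x u')
      :: [seq Cut (scons x (chead c)) (ctail c) | c <- cuts u']
  end.

Record cut3 A0 A3 := Cut3 {
  c3A : Ob; c3B : Ob;
  c3l : str T c3B A3; c3m : str T c3A c3B; c3r : str T A0 c3A }.

(* The terms x (x) y (x) z of Delta^(3) u. *)
Definition cuts3 A0 A3 (u : str T A0 A3) : seq (cut3 A0 A3) :=
  [seq Cut3 (chead c) (chead d) (ctail d) | c <- cuts u, d <- cuts (ctail c)].

(* The terms of Delta^(l) u, as strings of length l whose entries are strings;
   Delta^(0) is the counit. *)
Fixpoint Delta (l : nat) A0 A1 (u : str T A0 A1) : seq (str (str T) A0 A1) :=
  if l is l'.+1 then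
    [seq scons (chead c) w | c <- cuts u, w <- Delta l' (ctail c)]
  else if u is snil A then [:: snil A] else [::].
End Strings.

Fixpoint smap (Ob Ob' : Type) (o : Ob -> Ob') (T : Ob -> Ob -> Type)
    (T' : Ob' -> Ob' -> Type) (F : forall A0 A1, T A0 A1 -> T' (o A0) (o A1))
    A0 A1 (u : str T A0 A1) : str T' (o A0) (o A1) :=
  match u with
  | snil A => snil (o A)
  | scons _ _ _ x u' => scons (F _ _ x) (smap F u')
  end.

Record quiver (K : fieldType) := Quiver {
  ob : Type;
  hom : ob -> ob -> lmodType K;
  gr : forall A0 A1, grading (hom A0 A1) }.

Notation hstr X := (str (fun A0 A1 => (@hom _ X A0 A1 : Type))).
Notation sgr X A0 A1 := (shift (@gr _ X A0 A1)).

Section QuiverStrings.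
Variables (K : fieldType) (X : quiver K).

Fixpoint str_homog (g : forall A0 A1, grading (hom (q := X) A0 A1)) A0 A1
    (u : hstr X A0 A1) (n : int) : Prop :=
  match u with
  | snil _ => n = 0
  | scons _ _ _ x u' =>
      exists i, homog (g _ _) i x /\ str_homog g u' (n - i)
  end.

Definition sksign (g : forall A0 A1, grading (hom (q := X) A0 A1)) (n : int)
    A0 A1 (u : hstr X A0 A1) : hstr X A0 A1 :=
  smap (o := id) (fun A0 A1 => ksign (g A0 A1) n) u.

(* The Koszul sign of omega^(x)n applied to u, a string of elements of SX,
   followed on the right by k further factors to which omega is applied as
   well: the i-th factor from the left is passed by the omegas to its right. *)
Fixpoint omega (k : nat) A0 A1 (u : hstr X A0 A1) : hstr X A0 A1 :=
  match u with
  | snil A => snil A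
  | scons _ _ _ x u' =>
      scons (ksign (sgr X _ _) (ssize u' + k)%N%:Z x) (omega k u')
  end.

(* Linear maps on (+)_n X^(x)n are the multilinear maps on strings. *)
Definition multilinear (V : ob X -> ob X -> lmodType K)
    (k : forall A0 A1, hstr X A0 A1 -> V A0 A1) : Prop :=
  forall A0 A1 A2 A3 (u : hstr X A2 A3) (v : hstr X A0 A1) (a : K)
    (x y : hom A1 A2),
    k _ _ (sins u (a *: x + y) v)
    = a *: k _ _ (sins u x v) + k _ _ (sins u y v).
End QuiverStrings.

Section Ainf.
Variable K : fieldType.

(* All the m_n as one map on strings; m_0 = 0. *)
Record ainf_cat := AinfCat {
  aq :> quiver K;
  am : forall A0 A1, hstr aq A0 A1 -> hom (q := aq) A0 A1;
  am_nil : forall A, am (snil A) = 0;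
  am_lin : multilinear am;
  am_deg : forall A0 A1 (u : hstr aq A0 A1) n,
    str_homog (@gr _ aq) u n -> homog (gr A0 A1) (n + 2 - (ssize u)%:Z) (am u);
  (* the terms with k = 0 vanish, by am_nil *)
  am_rel : forall A0 A1 (u : hstr aq A0 A1),
    \sum_(c <- cuts3 u)
      (let: j := ssize (c3l c) in
      let: k := ssize (c3m c) in
      let: l := ssize (c3r c) in
      ((-1) ^+ (j * k + l)%N : K) *:
      am (sins (sksign (@gr _ aq) (2 - k%:Z) (c3l c)) (am (c3m c)) (c3r c)))
    = 0 }.

Record su_cat := SuCat {
  sc :> ainf_cat;
  idm : forall A, hom (q := sc) A A;
  idm_deg : forall A, homog (gr A A) 0 (idm A);
  idm_l : forall A0 A1 (x : hom (q := sc) A0 A1),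
    am (scons (idm A1) (scons x (snil A0))) = x;
  idm_r : forall A0 A1 (x : hom (q := sc) A0 A1),
    am (scons x (scons (idm A0) (snil A0))) = x;
  idm_van : forall A0 A A1 (u : hstr sc A A1) (v : hstr sc A0 A),
    (ssize u + ssize v).+1 != 2%N -> am (sins u (idm A) v) = 0 }.

(* b_n = - s m_n omega^(x)n *)
Definition bm (A : ainf_cat) A0 A1 (u : hstr A A0 A1) : hom (q := A) A0 A1 :=
  - am (omega 0 u).

(* The terms of b(u), b the coderivation of T^c(SA) with components b_n. *)
Definition bhat (A : ainf_cat) A0 A1 (u : hstr A A0 A1) : seq (hstr A A0 A1) :=
  [seq sins (sksign (fun A0 A1 => sgr A A0 A1) 1 (c3l c)) (bm (c3m c)) (c3r c)
     | c <- cuts3 u].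

(* A map on objects and all the f_n as one map on strings; the values on empty
   strings are ignored. *)
Record fdata (A B : ainf_cat) := FData {
  fo : ob A -> ob B;
  fm : forall A0 A1, hstr A A0 A1 -> hom (q := B) (fo A0) (fo A1) }.

(* F_n = s f_n omega^(x)n for n >= 1, and F_0 = 0 *)
Definition Fm (A B : ainf_cat) (f : fdata A B) A0 A1 (u : hstr A A0 A1) :
    hom (q := B) (fo f A0) (fo f A1) :=
  if ssize u == 0%N then 0 else fm f (omega 0 u).

(* The terms of sum_(l >= 0) F^(x)l Delta^(l) u; those with l > |u| vanish,
   since F_0 = 0. *)
Definition Fhat (A B : ainf_cat) (f : fdata A B) A0 A1 (u : hstr A A0 A1) :
    seq (hstr B (fo f A0) (fo f A1)) :=
  [seq smap (@Fm _ _ f) w | l <- iota 0 (ssize u).+1, w <- Delta l u].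

(* Strictly unital A-infinity functors.  A dg coalgebra map into T^c(SB) is
   determined by its components, and the compatibility with the differentials
   is likewise stated after projection to SB. *)
Record su_fun (A B : su_cat) := SuFun {
  sf :> fdata A B;
  sf_lin : multilinear (V := fun A0 A1 => hom (fo sf A0) (fo sf A1)) (fm sf);
  sf_deg : forall A0 A1 (u : hstr A A0 A1) n, ssize u != 0%N ->
    str_homog (@gr _ A) u n ->
    homog (gr _ _) (n + 1 - (ssize u)%:Z) (fm sf u);
  sf_dg : forall A0 A1 (u : hstr A A0 A1),
    \sum_(w <- Fhat sf u) bm w = \sum_(v <- bhat u) Fm sf v;
  sf_id : forall A0, fm sf (scons (idm A0) (snil A0)) = idm (fo sf A0);
  sf_van : forall A0 A1 A2 (u : hstr A A1 A2) (v : hstr A A0 A1),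
    (1 < (ssize u + ssize v).+1)%N -> fm sf (sins u (idm A1) v) = 0 }.

(* Graded objects with operators d^n : C^n -> C^(n+1), all the C^n being given
   as subspaces of one K-module. *)
Record precomplex := Precomplex {
  pc_car :> lmodType K;
  pc_in : int -> pc_car -> Prop;
  pc_d : int -> pc_car -> pc_car }.

Definition is_complex (C : precomplex) : Prop := forall n,
  [/\ pc_in n (0 : C),
      (forall (a : K) (x y : C), pc_in n x -> pc_in n y ->
         pc_in n (a *: x + y)),
      (forall (a : K) (x y : C), pc_in n x -> pc_in n y ->
         pc_d n (a *: x + y) = a *: pc_d n x + pc_d n y),
      (forall x : C, pc_in n x -> pc_in (n + 1) (pc_d n x))
    & (forall x : C, pc_in n x -> pc_d (n + 1) (pc_d n x) = 0)].

Definition is_chain_map (C D : precomplex) (f : int -> C -> D) : Prop :=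
  forall n,
  [/\ (forall x, pc_in n x -> pc_in n (f n x)),
      (forall (a : K) x y, pc_in n x -> pc_in n y ->
         f n (a *: x + y) = a *: f n x + f n y)
    & (forall x, pc_in n x -> f (n + 1) (pc_d n x) = pc_d n (f n x))].

Definition cocycle (C : precomplex) (n : int) (x : C) : Prop :=
  pc_in n x /\ pc_d n x = 0.

(* x and y have the same class in H^n(C) *)
Definition cohomologous (C : precomplex) (n : int) (x y : C) : Prop :=
  exists w : C, pc_in (n - 1) w /\ x - y = pc_d (n - 1) w.

Definition quasi_isomorphism (C D : precomplex) (f : int -> C -> D) : Prop :=
  [/\ is_complex C, is_complex D, is_chain_map f
    & forall n,
      (* H^n(f) is injective *)
      (forall x y : C, cocycle n x -> cocycle n y ->
         cohomologous n (f n x) (f n y) -> cohomologous n x y) /\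
      (* H^n(f) is surjective *)
      (forall y : D, cocycle n y ->
         exists x : C, cocycle n x /\ cohomologous n (f n x) y)].

Section Func.
Variables (A B : su_cat) (f1 f2 : su_fun A B).

(* All families of functions on strings, multilinear or not. *)
Definition func_space : lmodType K :=
  dmap (fun A0 => dmap (fun A1 =>
    dmap (fun _ : hstr A A0 A1 => hom (fo f1 A0) (fo f2 A1)))).

(* The degree e component of SHom(f1, f2). *)
Definition in_SHom (e : int) (H : func_space) : Prop :=
  [/\ multilinear (V := fun A0 A1 => hom (fo f1 A0) (fo f2 A1)) H,
      (forall A0 A1 (u : hstr A A0 A1) n,
         str_homog (fun A0 A1 => sgr A A0 A1) u n ->
         homog (sgr B _ _) (n + e) (H A0 A1 u))
    & (forall A0 A1 A2 (u : hstr A A1 A2) (v : hstr A A0 A1),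
         H _ _ (sins u (idm A1) v) = 0)].

(* The terms of sum_(l, m) (F_2^(x)l (x) H (x) F_1^(x)m) Delta^(l+1+m) u, for H
   of degree e. *)
Definition FHF (e : int) (H : func_space) A0 A1 (u : hstr A A0 A1) :
    seq (hstr B (fo f1 A0) (fo f2 A1)) :=
  flatten [seq [seq sins w2 (H _ _ (c3m c)) w1
                  | w2 <- Fhat f2 (sksign (fun A0 A1 => sgr A A0 A1) e (c3l c)),
                    w1 <- Fhat f1 (c3r c)]
             | c <- cuts3 u].

(* b_1 on the degree e component of SHom(f1, f2) *)
Definition func_b1 (e : int) (H : func_space) : func_space :=
  fun A0 A1 u =>
    \sum_(w <- FHF e H u) bm w
    - ((-1) ^ e : K) *: \sum_(v <- bhat u) H _ _ v.

(* Hom^n = SHom^(n-1).  On Hom the differential is m_1 = - omega b_1 s; along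
   the identification h |-> (-1)^|h| s h of Hom^n with SHom^(n-1) it becomes
   b_1, and it is for this identification that z_1 below, with its sign
   (-1)^|H|, commutes (rather than anticommutes) with the differentials. *)
Definition Hom_func : precomplex :=
  Precomplex (fun n H => in_SHom (n - 1) H) (fun n H => func_b1 (n - 1) H).
End Func.

(* Bipolydules: the families of graded spaces M(B, A) and of maps b_(p,q), all
   (p, q) together; the axioms are in su_bipolydule. *)
Record bdata (A B : ainf_cat) := BData {
  bM : ob B -> ob A -> lmodType K;
  bgr : forall B0 A0, grading (bM B0 A0);
  bb : forall A0 A1 B0 B1,
    hstr A A0 A1 -> bM B1 A0 -> hstr B B0 B1 -> bM B0 A1 }.

Section Bip.
Variables (A B : su_cat).
Local Notation sA := (fun A0 A1 => sgr A A0 A1).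
Local Notation sB := (fun B0 B1 => sgr B B0 B1).
Local Notation sM M := (fun B0 A0 => shift (bgr M B0 A0)).

(* All families of functions from the pure tensors of BM to M'. *)
Definition bip_space (M M' : bdata A B) : lmodType K :=
  dmap (fun A0 => dmap (fun A1 => dmap (fun B0 => dmap (fun B1 =>
    dmap (fun _ : hstr A A0 A1 => dmap (fun _ : bM M B1 A0 =>
      dmap (fun _ : hstr B B0 B1 => bM M' B0 A1))))))).

Variables (M M' : bdata A B).

Definition bip_linear (G : bip_space M M') : Prop :=
  [/\ forall A0 A1 A2 A3 B0 B1 (u : hstr A A2 A3) (v : hstr A A0 A1)
        (k : bM M B1 A0) (psi : hstr B B0 B1) (a : K) (x y : hom A1 A2),
        G _ _ _ _ (sins u (a *: x + y) v) k psi
        = a *: G _ _ _ _ (sins u x v) k psi + G _ _ _ _ (sins u y v) k psi,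
      forall A0 A1 B0 B1 (phi : hstr A A0 A1) (psi : hstr B B0 B1) (a : K)
        (x y : bM M B1 A0),
        G _ _ _ _ phi (a *: x + y) psi
        = a *: G _ _ _ _ phi x psi + G _ _ _ _ phi y psi
    & forall A0 A1 B0 B1 B2 B3 (phi : hstr A A0 A1) (k : bM M B3 A0)
        (u : hstr B B2 B3) (v : hstr B B0 B1) (a : K) (x y : hom B1 B2),
        G _ _ _ _ phi k (sins u (a *: x + y) v)
        = a *: G _ _ _ _ phi k (sins u x v) + G _ _ _ _ phi k (sins u y v)].

Definition bip_deg (n : int) (G : bip_space M M') : Prop :=
  forall A0 A1 B0 B1 (phi : hstr A A0 A1) (k : bM M B1 A0) (psi : hstr B B0 B1)
    (p r q : int),
    str_homog sA phi p -> homog (sM M B1 A0) r k -> str_homog sB psi q ->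
    homog (sM M' B0 A1) (p + r + q + n) (G _ _ _ _ phi k psi).

(* The components of the composite of b : BM -> BM with the bicomodule map
   BM -> BM' with components G *)
Definition bip_pre (G : bip_space M M') : bip_space M M' :=
  fun A0 A1 B0 B1 phi k psi =>
    \sum_(phi' <- bhat phi) G _ _ _ _ phi' k psi
    + \sum_(c <- cuts phi) \sum_(d <- cuts psi)
        G _ _ _ _ (sksign sA 1 (chead c))
          (bb (ctail c) k (chead d)) (ctail d)
    + \sum_(psi' <- bhat psi)
        G _ _ _ _ (sksign sA 1 phi) (ksign (sM M _ _) 1 k) psi'.

(* The components of the composite of the degree n bicomodule map BM -> BM'
   with components G with b : BM' -> BM' *)
Definition bip_post (n : int) (G : bip_space M M') : bip_space M M' :=
  fun A0 A1 B0 B1 phi k psi =>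
    \sum_(c <- cuts phi) \sum_(d <- cuts psi)
      bb (sksign sA n (chead c))
        (G _ _ _ _ (ctail c) k (chead d)) (ctail d).

Definition in_bip_Hom (n : int) (G : bip_space M M') : Prop :=
  [/\ bip_linear G, bip_deg n G,
      (forall A0 A1 A2 B0 B1 (u : hstr A A1 A2) (v : hstr A A0 A1)
         (k : bM M B1 A0) (psi : hstr B B0 B1),
         G _ _ _ _ (sins u (idm A1) v) k psi = 0)
    & (forall A0 A1 B0 B1 B2 (phi : hstr A A0 A1) (k : bM M B2 A0)
         (u : hstr B B1 B2) (v : hstr B B0 B1),
         G _ _ _ _ phi k (sins u (idm B1) v) = 0)].

Definition Hom_bip : precomplex :=
  Precomplex in_bip_Hom
    (fun n G => bip_post n G - ((-1) ^ n : K) *: bip_pre G).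
End Bip.

Section SuBip.
Variables (A B : su_cat) (M : bdata A B).

(* The m_(p,q), given by omega b_(p,q) = - m_(p,q) omega^(x)(p+1+q); the sign
   of omega^(x)(p+1+q), as an operator on SA (x) .. (x) SB, is its own
   inverse. *)
Definition bip_m A0 A1 B0 B1 (phi : hstr A A0 A1) (k : bM M B1 A0)
    (psi : hstr B B0 B1) : bM M B0 A1 :=
  - bb (omega (ssize psi).+1 phi)
       (ksign (shift (bgr M B1 A0)) (ssize psi)%:Z k) (omega 0 psi).

(* The coderivation b squares to zero if and only if its square, which is
   again a coderivation, has zero components. *)
Definition su_bipolydule : Prop :=
  [/\ bip_linear (@bb A B M : bip_space M M),
      bip_deg 1 (@bb A B M : bip_space M M)
    & bip_pre (@bb A B M : bip_space M M) = 0] /\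
  [/\ forall A0 B0 (x : bM M B0 A0),
        bip_m (scons (idm A0) (snil A0)) x (snil B0) = x,
      forall A0 B0 (x : bM M B0 A0),
        bip_m (snil A0) x (scons (idm B0) (snil B0)) = x,
      forall A0 A1 A2 B0 B1 (u : hstr A A1 A2) (v : hstr A A0 A1)
        (x : bM M B1 A0) (psi : hstr B B0 B1),
        (ssize u + ssize v + ssize psi != 0)%N ->
        bip_m (sins u (idm A1) v) x psi = 0
    & forall A0 A1 B0 B1 B2 (phi : hstr A A0 A1) (x : bM M B2 A0)
        (u : hstr B B1 B2) (v : hstr B B0 B1),
        (ssize phi + ssize u + ssize v != 0)%N ->
        bip_m phi x (sins u (idm B1) v) = 0].
End SuBip.

Section Yoneda.
Variables (A B : su_cat).

Definition zfun (f : su_fun A B) : bdata A B :=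
  BData (bM := fun B0 A0 => hom B0 (fo f A0))
    (fun B0 A0 => gr B0 (fo f A0))
    (fun A0 A1 B0 B1 phi k psi => \sum_(w <- Fhat f phi) bm (sins w k psi)).

(* z_1 on Hom^n, where |H| = n - 1 *)
Definition z1 (f1 f2 : su_fun A B) (n : int) (H : Hom_func f1 f2) :
    Hom_bip (zfun f1) (zfun f2) :=
  fun A0 A1 B0 B1 phi k psi =>
    ((-1) ^ (n - 1) : K) *:
    \sum_(w <- FHF (n - 1) H phi) bm (sins w k psi).
End Yoneda.
End Ainf.

(* Main.v *)
From mathcomp Require Import all_boot all_order all_algebra.
From mathcomp Require Import boolp zify ring.
Require Import Defs.

Set Implicit Arguments.
Unset Strict Implicit.
Unset Printing Implicit Defensive.

Import GRing.Theory.
Local Open Scope ring_scope.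

(** For the suspended operations b all signs are Koszul signs of letters, so
    everything below is about words, their deconcatenations and the operators
    [eps n], x |-> (-1)^(n|x|) x.

    The map z_1 has a retraction r, [eval_id]: insert an identity as module
    argument and let F_1 act on a tail of the word,
      (r G)(phi) = - sum G(eps phi', id, F_1^ phi'').
    In (r z_1 H)(phi) the operation b of B receives a word ending in the inserted
    identity followed by letters from F_1; strict units kill it unless that word is
    one letter H(phi) followed by id, so that r z_1 = 1.

    In the other direction the insertion of an identity in front of the module
    argument,
      (h G)(phi, k, psi) = sum G(eps phi', id, F_1^ phi'' k psi),
    is the extra degeneracy [degen] of the bar construction. In h d - d h every
    term cancels against its mirror image except two kinds: the product of the
    inserted identity with k, which gives back G, and the terms in which the
    outer b ends before k, which form z_1 r G. Hence
      h d - d h = (-1)^(n-1) (1 - z_1 r)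
    on maps of degree n ([homotopy]), and z_1 is a homotopy equivalence.

    That z f is a bipolydule and that z_1 commutes with the differentials are
    the A-infinity relations of B at the words w k psi, where w runs over the
    words of F^ phi, respectively of (F_2^ H F_1^) phi. They need the commutation
    of F^ with the bar differentials ([bhat_Fl]) and the fact that the commutator
    of a coderivation with the bar differentials is the coderivation with
    components b_1 H ([FHFl_bhat]); both hold because a coderivation into a cofree
    coalgebra is determined by its components ([cofree]). The square of the
    differential on bicomodule maps vanishes because the composition is associative
    ([bip_compA]) and the bar differentials are derivations for it
    ([bip_bar_comp]). All remaining properties of the differential on
    Func(A, B) are transported along b_1 H = r (d (z_1 H)) ([func_b1E]). *)

(** * Words and their deconcatenations *)

Section StringSums.
Variables (Ob : Type) (T : Ob -> Ob -> Type) (V : zmodType).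

Lemma scat_snil A0 A1 (u : str T A0 A1) : scat u (snil A0) = u.
Proof. by elim: u => //= ? ? ? x u ->. Qed.

Lemma scatA A2 A3 (u : str T A2 A3) A1 (v : str T A1 A2) A0 (w : str T A0 A1) :
  scat (scat u v) w = scat u (scat v w).
Proof. by elim: u A1 v A0 w => //= ? ? ? x u IH A1 v A0 w; rewrite IH. Qed.

Lemma ssize_scat A1 A2 (u : str T A1 A2) A0 (v : str T A0 A1) :
  ssize (scat u v) = (ssize u + ssize v)%N.
Proof. by elim: u A0 v => //= ? ? ? x u IH A0 v; rewrite IH. Qed.

Lemma ssize_sins A0 A1 A2 A3 (u : str T A2 A3) (x : T A1 A2) (v : str T A0 A1) :
  ssize (sins u x v) = (ssize u + ssize v).+1.
Proof. by rewrite ssize_scat /= addnS. Qed.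

Lemma sins_scons A0 A1 A2 A3 A4 (y : T A3 A4) (u : str T A2 A3) (x : T A1 A2)
  (v : str T A0 A1) : sins (scons y u) x v = scons y (sins u x v).
Proof. by []. Qed.

Lemma sins_sinsl A0 A1 A2 A3 A4 A5 (u : str T A4 A5) (y : T A3 A4)
    (v : str T A2 A3) (x : T A1 A2) (w : str T A0 A1) :
  sins (sins u y v) x w = sins u y (sins v x w).
Proof. by rewrite /sins scatA. Qed.

Lemma sum_cuts_nil A (P : cut T A A -> V) :
  \sum_(c <- cuts (snil A)) P c = P (Cut (snil A) (snil A)).
Proof. exact: big_seq1. Qed.

Lemma sum_cuts_cons A0 A1 A2 (x : T A1 A2) (u : str T A0 A1)
    (P : cut T A0 A2 -> V) :
  \sum_(c <- cuts (scons x u)) P c = P (Cut (snil A2) (scons x u))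
  + \sum_(c <- cuts u) P (Cut (scons x (chead c)) (ctail c)).
Proof. by rewrite big_cons big_map. Qed.

(** Glueing a cut gives back the word; needed because in [coassoc] the outer cut
    on the right is rebuilt from the inner one. *)
Lemma scat_cut A0 A1 (u : str T A0 A1) (P : str T A0 A1 -> cut T A0 A1 -> V) :
  \sum_(c <- cuts u) P (scat (chead c) (ctail c)) c = \sum_(c <- cuts u) P u c.
Proof.
elim: u P => [A|A0' A1' A2' x u IH] P; first by rewrite !sum_cuts_nil.
rewrite !sum_cuts_cons; congr (_ + _).
exact: (IH (fun u c => P (scons x u) (Cut (scons x (chead c)) (ctail c)))).
Qed.

Lemma sum_cuts3 A0 A1 (u : str T A0 A1) (P : cut3 T A0 A1 -> V) :
  \sum_(c <- cuts3 u) P c = \sum_(c <- cuts u) \sum_(d <- cuts (ctail c))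
     P (Cut3 (chead c) (chead d) (ctail d)).
Proof. by rewrite /cuts3 big_allpairs_dep. Qed.

Lemma coassoc A0 A1 (u : str T A0 A1)
    (P : forall c : cut T A0 A1, cut T A0 (cmid c) -> V) :
  \sum_(c <- cuts u) \sum_(d <- cuts (ctail c)) P c d =
  \sum_(c <- cuts u) \sum_(d <- cuts (chead c))
    P (Cut (chead d) (scat (ctail d) (ctail c))) (Cut (ctail d) (ctail c)).
Proof.
elim: u P => [A|B0 B1 B2 x u IH] P; first by rewrite !sum_cuts_nil.
rewrite !sum_cuts_cons sum_cuts_nil /=.
under [in RHS]eq_bigr do rewrite sum_cuts_cons.
rewrite big_split /= -addrA; congr (_ + (_ + _)); last first.
  exact: (IH (fun c d => P (Cut (scons x (chead c)) (ctail c)) d)).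
rewrite -(scat_cut u (fun w c => P (Cut (snil B2) (scons x w))
  (Cut (scons x (chead c)) (ctail c)))).
by [].
Qed.

Lemma cuts_sins A0 A1 A2 A3 (u : str T A2 A3) (x : T A1 A2) (v : str T A0 A1)
    (P : cut T A0 A3 -> V) :
  \sum_(c <- cuts (sins u x v)) P c =
  \sum_(c <- cuts u) P (Cut (chead c) (sins (ctail c) x v))
  + \sum_(c <- cuts v) P (Cut (sins u x (chead c)) (ctail c)).
Proof.
elim: u x v P => [A|B0 B1 B2 y u IH] x v P.
  by rewrite sum_cuts_cons sum_cuts_nil.
by rewrite sins_scons !sum_cuts_cons IH addrA.
Qed.

Lemma sum_cuts_head0 A0 A1 (u : str T A0 A1) (P : cut T A0 A1 -> V) :
  (forall B0 B1 (x : T B1 A1) (c : str T B0 B1) d, P (Cut (scons x c) d) = 0) ->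
  \sum_(c <- cuts u) P c = P (Cut (snil A1) u).
Proof.
case: u P => [A|B0 B1 B2 x u] P P0; first by rewrite sum_cuts_nil.
by rewrite sum_cuts_cons big1 ?addr0.
Qed.

Lemma sum_cuts_tail0 A0 A1 (u : str T A0 A1) (P : cut T A0 A1 -> V) :
  (forall B0 B1 c (x : T B0 B1) (d : str T A0 B0), P (Cut c (scons x d)) = 0) ->
  \sum_(c <- cuts u) P c = P (Cut u (snil A0)).
Proof.
elim: u P => [A|B0 B1 B2 x u IH] P P0; first by rewrite sum_cuts_nil.
rewrite sum_cuts_cons P0 add0r.
by apply: (IH (fun c => P (Cut (scons x (chead c)) (ctail c)))) => *; exact: P0.
Qed.

(** The letter x joined to the first block; an empty word has no first block. *)
Definition lengthen A1 A2 (x : T A1 A2) A0 (p : str (str T) A0 A1) :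
    seq (str (str T) A0 A2) :=
  match p in str _ B0 B1 return T B1 A2 -> seq (str (str T) B0 A2) with
  | snil _ => fun _ => [::]
  | scons _ _ _ b p' => fun x => [:: scons (scons x b) p']
  end x.

(** The terms of all the Delta^(l) together, keeping only those without an empty
    block: of these there are finitely many, and they are enumerated by recursion
    on the word. *)
Fixpoint blocks A0 A1 (u : str T A0 A1) : seq (str (str T) A0 A1) :=
  match u with
  | snil A => [:: snil A]
  | scons _ _ _ x u' =>
      flatten [seq scons (scons x (snil _)) p :: lengthen x p | p <- blocks u']
  end.

Definition nnil A0 A1 (u : str T A0 A1) := if u is snil _ then false else true.

Lemma nnilE A0 A1 (u : str T A0 A1) : nnil u = (0 < ssize u)%N.
Proof. by case: u. Qed.

Lemma nnil_sins A0 A1 A2 A3 (u : str T A2 A3) (x : T A1 A2) (v : str T A0 A1) :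
  nnil (sins u x v).
Proof. by rewrite nnilE ssize_sins. Qed.

Lemma sum_blocks_scons A0 A1 A2 (x : T A1 A2) (u : str T A0 A1)
    (P : str (str T) A0 A2 -> V) :
  \sum_(p <- blocks (scons x u)) P p =
  \sum_(c <- cuts u) \sum_(p <- blocks (ctail c))
     P (scons (scons x (chead c)) p).
Proof.
elim: u A2 x P => [A|B0 B1 B2 y u IH] A2 x P.
  by rewrite sum_cuts_nil !big_seq1.
have -> : \sum_(p <- blocks (scons x (scons y u))) P p =
    \sum_(p <- blocks (scons y u))
       (P (scons (scons x (snil B2)) p) + \sum_(q <- lengthen x p) P q).
  rewrite [LHS]big_flatten [LHS]big_map.
  by apply: eq_bigr => p _; rewrite big_cons.
rewrite big_split [X in _ + X = _]IH sum_cuts_cons; congr (_ + _).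
by apply: eq_bigr => c _; apply: eq_bigr => p _; rewrite big_seq1.
Qed.

End StringSums.
Arguments cuts : simpl never.
Arguments blocks : simpl never.

(** * Gradings and Koszul signs *)

Section Lin.
Variable K : fieldType.

Lemma sgD m n : (-1) ^ (m + n) = (-1) ^ m * (-1) ^ n :> K.
Proof. by rewrite expfzDr // oppr_eq0 oner_eq0. Qed.

Lemma sgN n : (-1) ^ (- n) = (-1) ^ n :> K.
Proof. by rewrite -exprz_inv invrN1. Qed.

Lemma sg_sqr n : (-1) ^ n * (-1) ^ n = 1 :> K.
Proof. by rewrite -{1}[n]opprK sgN -sgD addNr. Qed.

Definition lin (U V : lmodType K) (g : U -> V) :=
  forall a x y, g (a *: x + y) = a *: g x + g y.

Section LinTheory.
Variables (U V : lmodType K) (g : U -> V).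
Hypothesis gL : lin g.

Lemma lin0 : g 0 = 0.
Proof. by have := gL (-1) 0 0; rewrite scaler0 addr0 scaleN1r addNr. Qed.

Lemma linD x y : g (x + y) = g x + g y.
Proof. by rewrite -{1}[x]scale1r gL scale1r. Qed.

Lemma linZ a x : g (a *: x) = a *: g x.
Proof. by rewrite -{1}[a *: x]addr0 gL lin0 addr0. Qed.

Lemma linN x : g (- x) = - g x.
Proof. by rewrite -scaleN1r linZ scaleN1r. Qed.

Lemma lin_sum I (s : seq I) (P : I -> U) :
  g (\sum_(i <- s) P i) = \sum_(i <- s) g (P i).
Proof. exact: (big_morph g linD lin0). Qed.
End LinTheory.

Section Gradings.
Variables (V : lmodType K) (g : grading V).

Lemma gr_part0 i v : i \notin gr_supp g v -> gr_part g i v = 0.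
Proof.
move=> iv; rewrite -{1}(gr_sum g v) linear_sum big_seq big1 // => j jv.
rewrite gr_partK; case: eqP => // ij; by rewrite ij jv in iv.
Qed.

(** The list of degrees chosen for v does not matter, which is why the sign
    operator is linear. *)
Lemma ksign_supp n v s : uniq s -> {subset gr_supp g v <= s} ->
  ksign g n v = \sum_(i <- s) ((-1) ^ (n * i) : K) *: gr_part g i v.
Proof.
move=> us sub; rewrite [RHS](bigID (mem (gr_supp g v))) /=.
rewrite [X in _ + X]big1 ?addr0 => [|i /gr_part0 ->]; last by rewrite scaler0.
rewrite -big_filter; apply: perm_big.
apply: uniq_perm; rewrite ?gr_supp_uniq ?filter_uniq // => i.
by rewrite mem_filter; case: (boolP (i \in gr_supp g v)) => [/sub ->|].
Qed.

Lemma ksign_lin n : lin (ksign g n).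
Proof.
move=> a x y; set s := undup (gr_supp g x ++ gr_supp g y ++ gr_supp g (a *: x + y)).
rewrite !(@ksign_supp _ _ s) ?undup_uniq //;
  try by move=> i iv; rewrite mem_undup !mem_cat iv ?orbT.
rewrite scaler_sumr -big_split; apply: eq_bigr => i _ /=.
by rewrite linearP scalerDr !scalerA mulrC.
Qed.

Lemma homog_part i v : homog g i (gr_part g i v).
Proof. by rewrite /homog gr_partK eqxx. Qed.

Lemma ksign_homog n i v : homog g i v -> ksign g n v = (-1) ^ (n * i) *: v.
Proof.
move=> hv; rewrite (@ksign_supp _ _ (undup (i :: gr_supp g v))) ?undup_uniq //;
  last by move=> j jv; rewrite mem_undup inE jv orbT.
rewrite (bigD1_seq i) ?undup_uniq ?mem_undup ?mem_head //= hv big1 ?addr0 // => j ji.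
by rewrite -hv gr_partK (negPf ji) scaler0.
Qed.

Lemma homog0 i : homog g i 0.
Proof. by rewrite /homog linear0. Qed.

Lemma homogD i v w : homog g i v -> homog g i w -> homog g i (v + w).
Proof. by rewrite /homog linearD => -> ->. Qed.

Lemma homogZ i a v : homog g i v -> homog g i (a *: v).
Proof. by rewrite /homog linearZ => ->. Qed.

Lemma homogN i v : homog g i v -> homog g i (- v).
Proof. by rewrite /homog linearN => ->. Qed.

Lemma homog_ksign i n v : homog g i v -> homog g i (ksign g n v).
Proof. by move=> h; rewrite (ksign_homog n h); apply: homogZ. Qed.

Lemma lin_homog (U : lmodType K) (p q : V -> U) : lin p -> lin q ->
  (forall i v, homog g i v -> p v = q v) -> p =1 q.
Proof.
move=> lp lq h v; rewrite -(gr_sum g v) !lin_sum //; apply: eq_bigr => i _.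
exact: h (homog_part i v).
Qed.

Lemma ksignD m n v : ksign g m (ksign g n v) = ksign g (m + n) v.
Proof.
move: v; apply: lin_homog => [a x y|a x y|i v hv]; rewrite ?ksign_lin //.
rewrite (ksign_homog n hv) (linZ (ksign_lin m)) !(ksign_homog _ hv) scalerA.
by rewrite mulrDl sgD mulrC.
Qed.

Lemma ksign_even n v : ksign g (n + n) v = v.
Proof.
move: v; apply: lin_homog => [a x y|a x y|i v hv]; rewrite ?ksign_lin //.
by rewrite (ksign_homog _ hv) mulrDl sgD sg_sqr scale1r.
Qed.

Lemma ksign0 v : ksign g 0 v = v.
Proof. exact: ksign_even 0 v. Qed.

Lemma ksignK n v : ksign g n (ksign g n v) = v.
Proof. by rewrite ksignD ksign_even. Qed.

Lemma homog_shift i v : homog (shift g) i v = homog g (i + 1) v.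
Proof. by []. Qed.

End Gradings.

Lemma ksign_shift (V : lmodType K) (g : grading V) n v :
  ksign (shift g) n v = (-1) ^ n *: ksign g n v.
Proof.
move: v; apply: (@lin_homog _ g) => [a x y|a x y|i v hv].
- by rewrite ksign_lin.
- by rewrite ksign_lin scalerDr !scalerA mulrC.
rewrite (@ksign_homog _ (shift g) n (i - 1)) ?homog_shift ?subrK //.
by rewrite (ksign_homog n hv) scalerA mulrBr mulr1 sgD sgN mulrC.
Qed.

End Lin.

(** * Multilinear functions of a word *)

Section Smap.
Variables (Ob Ob' : Type) (o : Ob -> Ob') (T : Ob -> Ob -> Type)
  (T' : Ob' -> Ob' -> Type) (F : forall A0 A1, T A0 A1 -> T' (o A0) (o A1)).

Lemma smap_scat A1 A2 (u : str T A1 A2) A0 (v : str T A0 A1) :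
  smap F (scat u v) = scat (smap F u) (smap F v).
Proof. by elim: u A0 v => //= ? ? ? x u IH A0 v; rewrite IH. Qed.

Lemma smap_sins A0 A1 A2 A3 (u : str T A2 A3) (x : T A1 A2) (v : str T A0 A1) :
  smap F (sins u x v) = sins (smap F u) (F x) (smap F v).
Proof. exact: smap_scat. Qed.

Lemma ssize_smap A0 A1 (u : str T A0 A1) : ssize (smap F u) = ssize u.
Proof. by elim: u => //= ? ? ? x u ->. Qed.

Lemma sum_cuts_smap (V : zmodType) A0 A1 (u : str T A0 A1)
    (P : cut T' (o A0) (o A1) -> V) :
  \sum_(c <- cuts (smap F u)) P c =
  \sum_(c <- cuts u) P (Cut (smap F (chead c)) (smap F (ctail c))).
Proof.
elim: u P => [A|B0 B1 B2 x u IH] P; first by rewrite !sum_cuts_nil.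
rewrite /= !sum_cuts_cons; congr (_ + _).
exact: (IH (fun c => P (Cut (scons _ (chead c)) (ctail c)))).
Qed.
End Smap.

(** For inductions on the length of a piece of a cut. *)
Lemma eq_cuts Ob (T : Ob -> Ob -> Type) (V : zmodType) A0 A1 (u : str T A0 A1)
    (P Q : cut T A0 A1 -> V) :
  (forall c, (ssize (chead c) + ssize (ctail c))%N = ssize u -> P c = Q c) ->
  \sum_(c <- cuts u) P c = \sum_(c <- cuts u) Q c.
Proof.
elim: u P Q => [A|B0 B1 B2 x u IH] P Q PQ.
  by rewrite !sum_cuts_nil; apply: PQ.
rewrite !sum_cuts_cons; congr (_ + _); first exact: PQ.
apply: (IH (fun c => P (Cut (scons x (chead c)) (ctail c)))
  (fun c => Q (Cut (scons x (chead c)) (ctail c)))) => c Ec.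
by apply: PQ; rewrite /= addSn Ec.
Qed.

Section Multilinear.
Variables (K : fieldType) (X : quiver K).
Implicit Types V U : lmodType K.

Definition mlin A0 A1 V (k : hstr X A0 A1 -> V) :=
  forall A2 A3 (u : hstr X A3 A1) (v : hstr X A0 A2) (a : K) (x y : hom A2 A3),
    k (sins u (a *: x + y) v) = a *: k (sins u x v) + k (sins u y v).

Lemma mlin_sum V A0 A1 I (s : seq I) (k : I -> hstr X A0 A1 -> V) :
  (forall i, mlin (k i)) -> mlin (fun u => \sum_(i <- s) k i u).
Proof.
move=> h A2 A3 u v a x y; rewrite scaler_sumr -big_split.
by apply: eq_bigr => i _; apply: h.
Qed.

Lemma mlin_lin V U A0 A1 (g : V -> U) (k : hstr X A0 A1 -> V) :
  lin g -> mlin k -> mlin (fun u => g (k u)).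
Proof. by move=> gL kL A2 A3 u v a x y; rewrite kL gL. Qed.

Lemma lin_mlin V A0 A1 A2 A3 (u : hstr X A3 A1) (v : hstr X A0 A2)
  (k : hstr X A0 A1 -> V) : mlin k -> lin (fun x => k (sins u x v)).
Proof. by move=> kL a x y; apply: kL. Qed.

Lemma lin_mlin_scons V A0 A1 A2 (v : hstr X A0 A2)
  (k : hstr X A0 A1 -> V) : mlin k -> lin (fun x => k (scons x v)).
Proof. exact: lin_mlin (snil A1) v k. Qed.

Lemma mlin_add V A0 A1 (k l : hstr X A0 A1 -> V) :
  mlin k -> mlin l -> mlin (fun u => k u + l u).
Proof. by move=> kL lL A2 A3 u v a x y; rewrite kL lL scalerDr addrACA. Qed.

Lemma mlin_scale V A0 A1 (k : hstr X A0 A1 -> V) b :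
  mlin k -> mlin (fun u => b *: k u).
Proof. by move=> kL A2 A3 u v a x y; rewrite kL scalerDr !scalerA mulrC. Qed.

Lemma mlin_opp V A0 A1 (k : hstr X A0 A1 -> V) :
  mlin k -> mlin (fun u => - k u).
Proof. by move=> kL A2 A3 u v a x y; rewrite kL opprD scalerN. Qed.

Lemma mlin_sinsl V A0 A1 A2 A3 (x : hom A2 A3) (v : hstr X A0 A2)
    (k : hstr X A0 A1 -> V) :
  mlin k -> mlin (fun u => k (sins u x v)).
Proof. by move=> kL B2 B3 u w a y z; rewrite !sins_sinsl kL. Qed.

Lemma mlin_sinsr V A0 A1 A2 A3 (x : hom A2 A3) (u : hstr X A3 A1)
    (k : hstr X A0 A1 -> V) :
  mlin k -> mlin (fun v => k (sins u x v)).
Proof. by move=> kL B2 B3 v w a y z; rewrite -!sins_sinsl kL. Qed.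

Lemma mlin_scons V A0 A1 A2 (x : hom A2 A1) (k : hstr X A0 A1 -> V) :
  mlin k -> mlin (fun v => k (scons x v)).
Proof. exact: mlin_sinsr x (snil A1) k. Qed.

Lemma mlin_cuts V A0 A1 (k : cut (fun A0 A1 => (@hom _ X A0 A1 : Type)) A0 A1 -> V) :
  (forall B (v : hstr X A0 B), mlin (fun u => k (Cut u v))) ->
  (forall B (u : hstr X B A1), mlin (fun v => k (Cut u v))) ->
  mlin (fun u => \sum_(c <- cuts u) k c).
Proof.
move=> k1 k2 A2 A3 u v a x y; rewrite !cuts_sins scalerDr addrACA !scaler_sumr.
rewrite -!big_split /=; congr (_ + _); apply: eq_bigr => c _; first exact: k2.
exact: k1.
Qed.

Variable g : forall A0 A1, grading (hom (q := X) A0 A1).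

Lemma sksign_sins n A0 A1 A2 A3 (u : hstr X A2 A3) (x : hom A1 A2)
    (v : hstr X A0 A1) :
  sksign g n (sins u x v) = sins (sksign g n u) (ksign (g _ _) n x) (sksign g n v).
Proof. exact: smap_sins. Qed.

Lemma sksign_scons n A0 A1 A2 (x : hom A1 A2) (v : hstr X A0 A1) :
  sksign g n (scons x v) = scons (ksign (g _ _) n x) (sksign g n v).
Proof. by []. Qed.

Lemma ssize_sksign n A0 A1 (u : hstr X A0 A1) : ssize (sksign g n u) = ssize u.
Proof. exact: ssize_smap. Qed.

Lemma sksignD m n A0 A1 (u : hstr X A0 A1) :
  sksign g m (sksign g n u) = sksign g (m + n) u.
Proof. by elim: u => //= ? ? ? x u IH; rewrite !sksign_scons ksignD IH. Qed.

Lemma sksignC m n A0 A1 (u : hstr X A0 A1) :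
  sksign g m (sksign g n u) = sksign g n (sksign g m u).
Proof. by rewrite !sksignD addrC. Qed.

Lemma sksign_even n A0 A1 (u : hstr X A0 A1) : sksign g (n + n) u = u.
Proof. by elim: u => //= ? ? ? x u IH; rewrite sksign_scons ksign_even IH. Qed.

Lemma sksignK n A0 A1 (u : hstr X A0 A1) : sksign g n (sksign g n u) = u.
Proof. by rewrite sksignD sksign_even. Qed.

Lemma sum_cuts_sksign n (V : zmodType) A0 A1 (u : hstr X A0 A1)
    (P : cut (fun A0 A1 => (@hom _ X A0 A1 : Type)) A0 A1 -> V) :
  \sum_(c <- cuts (sksign g n u)) P c =
  \sum_(c <- cuts u) P (Cut (sksign g n (chead c)) (sksign g n (ctail c))).
Proof.
exact: (@sum_cuts_smap _ _ id _ _ (fun A0 A1 => ksign (g A0 A1) n) V A0 A1 u P).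
Qed.

Lemma mlin_sksign n V A0 A1 (k : hstr X A0 A1 -> V) :
  mlin k -> mlin (fun u => k (sksign g n u)).
Proof. by move=> kL B2 B3 v w a y z; rewrite !sksign_sins ksign_lin kL. Qed.

Lemma str_homog_sksign n A0 A1 (u : hstr X A0 A1) i :
  str_homog g u i -> str_homog g (sksign g n u) i.
Proof.
elim: u i => //= ? ? ? x u IH i [j [hx hu]]; exists j; split; last exact: IH.
exact: homog_ksign.
Qed.

Lemma str_homog_scat A1 A2 (u : hstr X A1 A2) i A0 (v : hstr X A0 A1) j :
  str_homog g u i -> str_homog g v j -> str_homog g (scat u v) (i + j).
Proof.
elim: u A0 v i => /= [A A0 v i ->|B0 B1 B2 x u IH A0 v i [l [hx hu]] hv].
  by rewrite add0r.
exists l; split=> //; have -> : i + j - l = (i - l) + j by ring.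
exact: IH.
Qed.

Lemma str_homog_sins A0 A1 A2 A3 (u : hstr X A2 A3) i (x : hom A1 A2) l
    (v : hstr X A0 A1) j :
  str_homog g u i -> homog (g _ _) l x -> str_homog g v j ->
  str_homog g (sins u x v) (i + l + j).
Proof.
move=> hu hx hv; rewrite -addrA; apply: str_homog_scat => //=.
by exists l; split=> //; rewrite addrAC subrr add0r.
Qed.

Lemma homog_cuts_size V (gV : grading V) m n A0 A1 (u : hstr X A0 A1)
    (P : cut (fun A0 A1 => (@hom _ X A0 A1 : Type)) A0 A1 -> V) :
  str_homog g u n ->
  (forall B (c : hstr X B A1) (d : hstr X A0 B) i j, i + j = n ->
     (ssize c + ssize d)%N = ssize u ->
     str_homog g c i -> str_homog g d j -> homog gV m (P (Cut c d))) ->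
  homog gV m (\sum_(c <- cuts u) P c).
Proof.
elim: u n P => [A|B0 B1 B2 x u IH] n P hu h.
  rewrite sum_cuts_nil; apply: (h _ _ _ 0 0) => //=; by rewrite hu.
rewrite sum_cuts_cons; apply: homogD.
  by apply: (h _ _ _ 0 n) => //; rewrite add0r.
case: hu => i [hx hu].
apply: (IH _ (fun c => P (Cut (scons x (chead c)) (ctail c))) hu).
move=> B c d a b ab cd hc hd; apply: (h _ _ _ (i + a) b) => //.
- by rewrite -addrA ab addrC subrK.
- by rewrite /= addSn cd.
by exists i; split=> //; rewrite addrAC subrr add0r.
Qed.

Lemma homog_cuts V (gV : grading V) m n A0 A1 (u : hstr X A0 A1)
    (P : cut (fun A0 A1 => (@hom _ X A0 A1 : Type)) A0 A1 -> V) :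
  str_homog g u n ->
  (forall B (c : hstr X B A1) (d : hstr X A0 B) i j, i + j = n ->
     str_homog g c i -> str_homog g d j -> homog gV m (P (Cut c d))) ->
  homog gV m (\sum_(c <- cuts u) P c).
Proof.
by move=> hu h; apply: (homog_cuts_size hu) => B c d i j ij _; apply: h ij.
Qed.

(** Decompose the letters one by one into their homogeneous components. *)
Lemma mlin_homog0 V A0 A1 (k : hstr X A0 A1 -> V) : mlin k ->
  (forall u n, str_homog g u n -> k u = 0) -> forall u, k u = 0.
Proof.
move=> kL k0 u; elim: u k kL k0 => [A k kL k0|B0 B1 B2 x u IH k kL k0].
  exact: (k0 _ 0).
rewrite -(gr_sum (g _ _) x) (lin_sum (lin_mlin_scons u kL)) big1 // => i _.
apply: (IH (fun u => k (scons (gr_part (g B1 B2) i x) u))).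
  exact: mlin_scons.
move=> v n hv; apply: (k0 _ (i + n)); exists i; split; first exact: homog_part.
by rewrite addrAC subrr add0r.
Qed.

Lemma mlin_sksign_homog V A0 A1 (k : hstr X A0 A1 -> V) m n u : mlin k ->
  str_homog g u n -> k (sksign g m u) = (-1) ^ (m * n) *: k u.
Proof.
elim: u n k => [A n k kL /= ->|B0 B1 B2 x u IH n k kL [i [hx hu]]].
  by rewrite mulr0 expr0z scale1r.
rewrite sksign_scons (ksign_homog m hx) (linZ (lin_mlin_scons _ kL)).
rewrite (IH _ (fun u => k (scons x u)) (mlin_scons x kL) hu) scalerA -sgD.
by congr (_ ^ _ *: _); ring.
Qed.

(** With this lemma and [bip_deg_parity] sign computations involve only the sign
    operators; exact degrees matter only for the homogeneity of constructed maps. *)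
Lemma mlin_parity V (gV : grading V) e A0 A1 (k : hstr X A0 A1 -> V) m u : mlin k ->
  (forall u n, str_homog g u n -> homog gV (n + e) (k u)) ->
  k (sksign g m u) = (-1) ^ (m * e) *: ksign gV m (k u).
Proof.
move=> kL kd; apply/eqP; rewrite -subr_eq0; apply/eqP.
apply: (mlin_homog0 (k := fun u => k (sksign g m u) - (-1) ^ (m * e) *: ksign gV m (k u))).
  apply: mlin_add; first exact: mlin_sksign.
  by apply: mlin_opp; apply: mlin_scale; apply: mlin_lin kL; apply: ksign_lin.
move=> v n hv; rewrite (mlin_sksign_homog _ kL hv) (ksign_homog _ (kd _ _ hv)).
rewrite scalerA -sgD.
have -> : m * e + m * (n + e) = m * n + (m * e + m * e) by ring.
by rewrite [in X in _ - X]sgD [in X in _ - X]sgD sg_sqr mulr1 subrr.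
Qed.
End Multilinear.

(** * Coderivations along coalgebra maps *)

(** The Koszul sign operators on words and letters of SX. *)
Notation sG := (fun A0 A1 => sgr _ A0 A1).
Notation eps := (sksign sG).
Notation eps1 A0 A1 := (ksign (sgr _ A0 A1)).

Section CoalgMaps.
Variables (K : fieldType) (X Y : quiver K).

(** A coalgebra map T^c(SX) -> T^c(SY), given by a list of words for each word. The
    rule [co_cuts] holds for all functions P, multilinear or not, so that it can be
    used before any linearity is known. *)
Record comap (o : ob X -> ob Y) := Comap {
  cop :> forall A0 A1, hstr X A0 A1 -> seq (hstr Y (o A0) (o A1));
  co_nil : forall A, cop (snil A) = [:: snil (o A)];
  co_cuts : forall (V : zmodType) A0 A1 (u : hstr X A0 A1) (P : cut _ _ _ -> V),
    \sum_(w <- cop u) \sum_(c <- cuts w) P c =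
    \sum_(c <- cuts u) \sum_(v <- cop (chead c)) \sum_(w <- cop (ctail c))
       P (Cut v w);
  co_eps : forall n (V : zmodType) A0 A1 (u : hstr X A0 A1) (P : _ -> V),
    \sum_(w <- cop (eps n u)) P w = \sum_(w <- cop u) P (eps n w);
  co_mlin : forall (V : lmodType K) A0 A1 (P : hstr Y (o A0) (o A1) -> V),
    mlin P -> mlin (fun u => \sum_(w <- cop u) P w) }.

Section Coder.
Variables (o1 o2 : ob X -> ob Y) (F1 : comap o1) (F2 : comap o2) (e : int).

(** The (F2, F1)-coderivation of degree e with components p. *)
Definition coder (p : forall A0 A1, hstr X A0 A1 -> hom (o1 A0) (o2 A1))
    A0 A1 (u : hstr X A0 A1) : seq (hstr Y (o1 A0) (o2 A1)) :=
  flatten [seq [seq sins w2 (p _ _ (c3m c)) w1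
                  | w2 <- F2 _ _ (eps e (c3l c)), w1 <- F1 _ _ (c3r c)]
             | c <- cuts3 u].

Variable (p : forall A0 A1, hstr X A0 A1 -> hom (o1 A0) (o2 A1)).

Lemma sum_coder (V : zmodType) A0 A1 (u : hstr X A0 A1) (P : _ -> V) :
  \sum_(w <- coder p u) P w =
  \sum_(c <- cuts u) \sum_(w2 <- F2 _ _ (eps e (chead c)))
    \sum_(d <- cuts (ctail c)) \sum_(w1 <- F1 _ _ (ctail d))
      P (sins w2 (p (chead d)) w1).
Proof.
rewrite big_flatten big_map sum_cuts3; apply: eq_bigr => c _.
rewrite [RHS]exchange_big; apply: eq_bigr => d _.
by rewrite big_allpairs_dep.
Qed.

(** The coderivation rule; coassociativity moves the cut to either side of the
    letter produced by p. *)
Lemma coder_cuts (V : zmodType) A0 A1 (u : hstr X A0 A1) (P : cut _ _ _ -> V) :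
  \sum_(w <- coder p u) \sum_(c <- cuts w) P c =
  \sum_(c <- cuts u) (\sum_(v <- coder p (chead c)) \sum_(w <- F1 _ _ (ctail c))
     P (Cut v w) + \sum_(v <- F2 _ _ (eps e (chead c)))
     \sum_(w <- coder p (ctail c)) P (Cut v w)).
Proof.
rewrite sum_coder big_split /=.
under eq_bigr do under eq_bigr do under eq_bigr do under eq_bigr do
  rewrite cuts_sins.
under eq_bigr do under eq_bigr do under eq_bigr do rewrite big_split.
under eq_bigr do under eq_bigr do rewrite big_split.
under eq_bigr do rewrite big_split.
rewrite big_split /= addrC; congr (_ + _).
- under [RHS]eq_bigr do rewrite sum_coder.
  rewrite -[RHS](coassoc u (fun c d => \sum_(w2 <- F2 _ _ (eps e (chead c)))
    \sum_(d1 <- cuts (chead d)) \sum_(w1 <- F1 _ _ (ctail d1))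
    \sum_(w <- F1 _ _ (ctail d)) P (Cut (sins w2 (p (chead d1)) w1) w))).
  apply: eq_bigr => c _; rewrite [RHS]exchange_big; apply: eq_bigr => w2 _.
  under eq_bigr do rewrite co_cuts.
  exact: (coassoc (ctail c) (fun c d => \sum_(v <- F1 _ _ (chead d))
    \sum_(w <- F1 _ _ (ctail d)) P (Cut (sins w2 (p (chead c)) v) w))).
- under [RHS]eq_bigr do under eq_bigr do rewrite sum_coder.
  under [RHS]eq_bigr do rewrite exchange_big.
  rewrite (coassoc u (fun c d => \sum_(v <- F2 _ _ (eps e (chead c)))
    \sum_(w2 <- F2 _ _ (eps e (chead d)))
    \sum_(d1 <- cuts (ctail d)) \sum_(w1 <- F1 _ _ (ctail d1))
     P (Cut v (sins w2 (p (chead d1)) w1)))).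
  apply: eq_bigr => c _.
  rewrite -(sum_cuts_sksign sG e (chead c) (fun x => \sum_(v <- F2 _ _ (chead x))
    \sum_(w2 <- F2 _ _ (ctail x)) \sum_(d1 <- cuts (ctail c))
    \sum_(w1 <- F1 _ _ (ctail d1)) P (Cut v (sins w2 (p (chead d1)) w1)))).
  rewrite -(co_cuts F2 _ (fun x => \sum_(d1 <- cuts (ctail c))
    \sum_(w1 <- F1 _ _ (ctail d1)) P (Cut (chead x) (sins (ctail x) (p (chead d1)) w1)))).
  apply: eq_bigr => w2 _; rewrite exchange_big; apply: eq_bigr => d _.
  by rewrite exchange_big.
Qed.

Lemma mlin_coder (V : lmodType K) A0 A1 (P : hstr Y (o1 A0) (o2 A1) -> V) :
  (forall A0 A1, mlin (@p A0 A1)) -> mlin P -> mlin (fun u => \sum_(w <- coder p u) P w).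
Proof.
move=> pL PL A2 A3 u v a x y; rewrite !sum_coder; move: a x y.
apply: (mlin_cuts (k := fun c => \sum_(w2 <- F2 _ _ (eps e (chead c)))
    \sum_(d <- cuts (ctail c)) \sum_(w1 <- F1 _ _ (ctail d))
      P (sins w2 (p (chead d)) w1))) => B w /=.
  apply: (mlin_sksign _ _ (k := fun u => \sum_(w2 <- F2 _ _ u)
    \sum_(d <- cuts w) \sum_(w1 <- F1 _ _ (ctail d)) P (sins w2 (p (chead d)) w1))).
  apply: co_mlin; apply: mlin_sum => d; apply: mlin_sum => w1; exact: mlin_sinsl.
apply: mlin_sum => w2; apply: mlin_cuts => C z /=; last first.
  by apply: co_mlin; exact: mlin_sinsr.
apply: mlin_sum => w1.
exact: (mlin_lin (g := fun x => P (sins w2 x w1)) (lin_mlin _ _ PL) (pL _ _)).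
Qed.

Lemma coder_eps d n (V : lmodType K) A0 A1 (P : hstr Y (o1 A0) (o2 A1) -> V) u :
  (forall A0 A1 u, p (eps n u) = (-1) ^ (n * d) *: eps1 _ _ n (@p A0 A1 u)) ->
  mlin P ->
  \sum_(w <- coder p (eps n u)) P w = (-1) ^ (n * d) *: \sum_(w <- coder p u) P (eps n w).
Proof.
move=> pn PL; rewrite !sum_coder sum_cuts_sksign scaler_sumr /=.
apply: eq_bigr => c _; rewrite sksignC co_eps scaler_sumr.
apply: eq_bigr => w2 _; rewrite sum_cuts_sksign scaler_sumr.
apply: eq_bigr => x _; rewrite /= co_eps scaler_sumr.
apply: eq_bigr => w1 _; rewrite sksign_sins pn.
exact: (linZ (lin_mlin _ _ PL)).
Qed.

End Coder.

(** The functional P restricted to nonempty words. *)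
Definition ifnn (V : lmodType K) A0 A1 (P : hstr Y A0 A1 -> V) w :=
  if nnil w then P w else 0.

(** The projection of T^c(SY) onto SY. *)
Definition pr1 A0 A1 (u : hstr Y A0 A1) : hom A0 A1 :=
  match u in str _ B0 B1 return hom B0 B1 with
  | snil _ => 0
  | scons _ A1 A2 x u' =>
      match u' in str _ B0 B1 return hom B1 A2 -> hom B0 A2 with
      | snil _ => id
      | scons _ _ _ _ _ => fun=> 0
      end x
  end.

Lemma pr1_sinsl A0 A1 A2 A3 A4 (x : hom A3 A4) (y : hom A1 A2) (u : hstr Y A2 A3)
  (v : hstr Y A0 A1) : pr1 (sins (scons x u) y v) = 0.
Proof. by case: u x y => [A|B0 B1 B2 z u] x y. Qed.

Lemma pr1_sinsr A0 A1 A2 A3 A4 (x : hom A2 A3) (y : hom A1 A2) (u : hstr Y A3 A4)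
  (v : hstr Y A0 A1) : pr1 (sins u x (scons y v)) = 0.
Proof. by case: u x => [A|B0 B1 B2 z u] x //; case: u z x. Qed.

Lemma mlin_pr1 A0 A1 : mlin (@pr1 A0 A1).
Proof.
move=> A2 A3 [A|B0 B1 B2 z u] v a x y; last first.
  by rewrite !pr1_sinsl scaler0 addr0.
case: v x y => [A'|C0 C1 C2 t v] x y //=.
by rewrite scaler0 addr0.
Qed.

(** Only the cut after the first letter contributes: cofreeness in its
    smallest form. *)
Lemma sum_cuts_pr1 (V : lmodType K) A0 A1 (P : hstr Y A0 A1 -> V) w : mlin P ->
  \sum_(c <- cuts w) P (scons (pr1 (chead c)) (ctail c)) = ifnn P w.
Proof.
case: w P => [A|B0 B1 B2 x w] P PL.
  by rewrite sum_cuts_nil /= (lin0 (lin_mlin_scons _ PL)).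
rewrite sum_cuts_cons /= (lin0 (lin_mlin_scons _ PL)) add0r.
rewrite sum_cuts_head0 // => *; rewrite /= (lin0 (lin_mlin_scons _ PL)) //.
Qed.

Section Cofree.
Variables (o1 o2 : ob X -> ob Y) (F1 : comap o1) (F2 : comap o2) (e : int).
Variable E : forall (V : lmodType K) A0 A1, hstr X A0 A1 ->
  (hstr Y (o1 A0) (o2 A1) -> V) -> V.
Hypothesis E_nn : forall V A0 A1 u P, @E V A0 A1 u P = E u (ifnn P).
Hypothesis E_lin : forall (V W : lmodType K) A0 A1 u P (g : V -> W), lin g ->
  @E W A0 A1 u (fun w => g (P w)) = g (E u P).
Hypothesis E_pr1 : forall A0 A1 u, @E _ A0 A1 u (@pr1 _ _) = 0.
Hypothesis E_cuts : forall (V : lmodType K) A0 A1 u (P : cut _ _ _ -> V),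
  (forall B v, mlin (fun u => P (@Cut _ _ _ _ B u v))) ->
  (forall B u, mlin (fun v => P (@Cut _ _ _ _ B u v))) ->
  @E V A0 A1 u (fun w => \sum_(c <- cuts w) P c) =
  \sum_(c <- cuts u) (E (chead c) (fun v => \sum_(w <- F1 _ _ (ctail c)) P (Cut v w))
    + \sum_(v <- F2 _ _ (eps e (chead c))) E (ctail c) (fun w => P (Cut v w))).

(** A coderivation into a cofree coalgebra is determined by its corestriction:
    writing a nonempty word as first letter times rest splits off one letter,
    and the coderivation rule recurs on shorter words. *)
Lemma cofree V A0 A1 u P : mlin P -> @E V A0 A1 u P = 0.
Proof.
move: (ltnSn (ssize u)); move: {2}(ssize u).+1 => n.
elim: n A0 A1 u P => // n IH A0 A1 u P; rewrite ltnS => un PL; rewrite E_nn.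
have -> : ifnn P = fun w => \sum_(c <- cuts w) P (scons (pr1 (chead c)) (ctail c)).
  by apply: functional_extensionality_dep => w; rewrite sum_cuts_pr1.
rewrite (E_cuts _ (P := fun c => P (scons (pr1 (chead c)) (ctail c)))) /=; first last.
- by move=> B v; exact: (mlin_scons _ PL).
- move=> B v; exact: (mlin_lin (lin_mlin_scons v PL) (@mlin_pr1 _ _)).
have E0 B (c : hstr X A0 B) : E c (fun=> 0 : V) = 0.
  by rewrite (E_lin c (fun=> 0 : V) (g := fun=> 0)) // => a x y; rewrite scaler0 addr0.
have E1 B C (c : hstr X B C) (d : hstr X A0 B) (Q : _ -> V) :
    (ssize c + ssize d <= n)%N -> mlin Q ->
    \sum_(v <- F2 _ _ (eps e c)) E d (fun w => Q (scons (pr1 v) w)) = 0.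
  case: c d Q => [B'|B0 B1 B2 x c] d Q cd QL.
    rewrite co_nil big_seq1 /= -(E0 _ d); congr (E d _).
    by apply: functional_extensionality_dep => w; rewrite (lin0 (lin_mlin_scons _ QL)).
  rewrite big1 // => v _; apply: IH; last exact: (mlin_scons _ QL).
  by apply: leq_trans cd; rewrite ltnS leq_addl.
transitivity (\sum_(c <- cuts u) (0 : V)); last by rewrite big1.
apply: eq_cuts => -[B c d] /= cd.
rewrite E1 ?cd // addr0.
rewrite (E_lin c (@pr1 _ _) (g := fun x => \sum_(w <- F1 _ _ d) P (scons x w))).
  by rewrite E_pr1 big1 // => w _; exact: (lin0 (lin_mlin_scons _ PL)).
move=> a x y; rewrite scaler_sumr -big_split; apply: eq_bigr => w _.
exact: lin_mlin_scons PL _ _ _.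
Qed.
End Cofree.
End CoalgMaps.

(** * The bar differential *)

Section Suspension.
Variables (K : fieldType) (X : quiver K).
Local Notation sX := (fun A0 A1 => sgr X A0 A1).

Lemma omega_scat k A1 A2 (u : hstr X A1 A2) A0 (v : hstr X A0 A1) :
  omega k (scat u v) = scat (omega (ssize v + k) u) (omega k v).
Proof.
by elim: u A0 v => //= ? ? ? x u IH A0 v; rewrite IH ssize_scat addnA.
Qed.

Lemma omega_sins k A0 A1 A2 A3 (u : hstr X A2 A3) (x : hom A1 A2)
    (v : hstr X A0 A1) :
  omega k (sins u x v) =
  sins (omega ((ssize v).+1 + k) u) (ksign (sgr X _ _) (ssize v + k)%N x) (omega k v).
Proof. exact: omega_scat. Qed.

Lemma ssize_omega k A0 A1 (u : hstr X A0 A1) : ssize (omega k u) = ssize u.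
Proof. by elim: u => //= ? ? ? x u ->. Qed.

Lemma sksign_omega n A0 A1 (u : hstr X A0 A1) k :
  sksign sX n (omega k u) = omega k (sksign sX n u).
Proof.
elim: u => //= ? ? ? x u IH.
by rewrite !sksign_scons /= IH ssize_sksign !ksignD addrC.
Qed.

Lemma omegaE k A0 A1 (u : hstr X A0 A1) : omega k u = sksign sX k (omega 0 u).
Proof.
elim: u => //= ? ? ? x u IH.
by rewrite sksign_scons -IH ksignD addn0 PoszD addrC.
Qed.

Lemma mlin_omega (V : lmodType K) k A0 A1 (P : hstr X A0 A1 -> V) :
  mlin P -> mlin (fun u => P (omega k u)).
Proof. by move=> PL A2 A3 u v a x y; rewrite !omega_sins ksign_lin PL. Qed.

Lemma str_homog_omega k A0 A1 (u : hstr X A0 A1) n :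
  str_homog sX u n -> str_homog sX (omega k u) n.
Proof.
elim: u n => //= ? ? ? x u IH n [i [hx hu]]; exists i.
by split; [exact: homog_ksign | exact: IH].
Qed.

Lemma str_homog_shift A0 A1 (u : hstr X A0 A1) n :
  str_homog sX u n -> str_homog (@gr _ X) u (n + (ssize u)%:Z).
Proof.
elim: u n => [A n -> //|? ? ? x u IH n [i [hx hu]]] /=; exists (i + 1).
split=> //; have -> : n + (ssize u).+1%:Z - (i + 1) = n - i + (ssize u)%:Z by lia.
exact: IH.
Qed.

(** The sign operators for the original and for the suspended grading differ by one
    sign for each letter. *)
Lemma mlin_sksign_shift (V : lmodType K) A0 A1 (P : hstr X A0 A1 -> V) n u :
  mlin P -> P (sksign (@gr _ X) n u) = (-1) ^ (n * (ssize u)%:Z) *: P (sksign sX n u).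
Proof.
elim: u P => [A|? ? ? x u IH] P PL; first by rewrite mulr0 expr0z scale1r.
rewrite !sksign_scons ksign_shift (linZ (lin_mlin_scons _ PL)).
rewrite (IH (fun u => P (scons _ u)) (mlin_scons _ PL)) scalerA /=.
have -> : (ssize u).+1%:Z = (ssize u)%:Z + 1 by lia.
rewrite mulrDr mulr1 sgD -[in RHS]mulrA; congr (_ *: _).
by rewrite sg_sqr mulr1.
Qed.

Lemma sum_cuts_omega (V : zmodType) k A0 A1 (u : hstr X A0 A1) (P : _ -> V) :
  \sum_(c <- cuts (omega k u)) P c = \sum_(c <- cuts u)
    P (Cut (omega (ssize (ctail c) + k) (chead c)) (omega k (ctail c))).
Proof.
elim: u P => [A|B0 B1 B2 x u IH] P; first by rewrite !sum_cuts_nil.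
rewrite /= !sum_cuts_cons; congr (_ + _).
rewrite (IH (fun c => P (Cut (scons _ (chead c)) (ctail c)))) /=.
by apply: eq_cuts => c cu; rewrite addnA cu.
Qed.

Definition idco : @comap K X X id.
Proof.
exists (fun A0 A1 u => [:: u]) => //.
- move=> V A0 A1 u P; rewrite big_seq1; apply: eq_bigr => -[B c d] _.
  by rewrite big_seq1 big_seq1.
- by move=> n V A0 A1 u P; rewrite !big_seq1.
- by move=> V A0 A1 P PL A2 A3 u v a x y; rewrite !big_seq1.
Defined.
End Suspension.

Section Ainfinity.
Variables (K : fieldType) (A : ainf_cat K).

Lemma mlin_bm A0 A1 : mlin (@bm K A A0 A1).
Proof. by apply: mlin_opp; apply: mlin_omega => B0 B1 u v a x y; apply: am_lin. Qed.

Lemma am_homog A0 A1 (u : hstr A A0 A1) n : str_homog sG u n ->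
  homog (sgr A A0 A1) (n + 1) (am u).
Proof.
move=> /str_homog_shift /am_deg; rewrite homog_shift.
by have -> : n + (ssize u)%:Z + 2 - (ssize u)%:Z = n + 1 + 1 by ring.
Qed.

Lemma bm_homog A0 A1 (u : hstr A A0 A1) n : str_homog sG u n ->
  homog (sgr A A0 A1) (n + 1) (bm u).
Proof. by move=> hu; apply: homogN; apply: am_homog; apply: str_homog_omega. Qed.

Lemma am_eps A0 A1 n (u : hstr A A0 A1) :
  am (eps n u) = (-1) ^ n *: eps1 _ _ n (am u).
Proof.
rewrite (mlin_parity (gV := sgr A A0 A1) (e := 1)) ?mulr1 //.
- by move=> B0 B1 v w a x y; apply: am_lin.
- exact: am_homog.
Qed.

Lemma bm_eps A0 A1 n (u : hstr A A0 A1) :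
  bm (eps n u) = (-1) ^ n *: eps1 _ _ n (bm u).
Proof.
rewrite (mlin_parity (gV := sgr A A0 A1) (e := 1)) ?mulr1 //.
- exact: mlin_bm.
- exact: bm_homog.
Qed.

Definition bcod := coder (idco A) (idco A) 1 (@bm K A).

Lemma bhatE A0 A1 (u : hstr A A0 A1) : bhat u = bcod u.
Proof.
rewrite /bhat /bcod /coder; elim: (cuts3 u) => //= c s ->.
by rewrite /sksign.
Qed.

Lemma sum_bhat (V : zmodType) A0 A1 (u : hstr A A0 A1) (P : _ -> V) :
  \sum_(v <- bhat u) P v = \sum_(c <- cuts u) \sum_(d <- cuts (ctail c))
    P (sins (eps 1 (chead c)) (bm (chead d)) (ctail d)).
Proof. by rewrite big_map sum_cuts3. Qed.

Lemma bhat_cuts (V : zmodType) A0 A1 (u : hstr A A0 A1) (P : cut _ _ _ -> V) :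
  \sum_(v <- bhat u) \sum_(c <- cuts v) P c =
  \sum_(c <- cuts u) (\sum_(v <- bhat (chead c)) P (Cut v (ctail c))
    + \sum_(v <- bhat (ctail c)) P (Cut (eps 1 (chead c)) v)).
Proof.
rewrite bhatE (coder_cuts (idco A) (idco A)); apply: eq_bigr => c _.
rewrite !bhatE; congr (_ + _); last by rewrite big_seq1.
by apply: eq_bigr => v _; rewrite big_seq1.
Qed.

Lemma mlin_bhat (V : lmodType K) A0 A1 (P : hstr A A0 A1 -> V) :
  mlin P -> mlin (fun u => \sum_(v <- bhat u) P v).
Proof.
move=> PL; have h := mlin_coder (idco A) (idco A) 1 (@mlin_bm) PL.
by move=> A2 A3 u v a x y; rewrite !bhatE; apply: h.
Qed.

Lemma bhat_eps n (V : lmodType K) A0 A1 (P : hstr A A0 A1 -> V) u : mlin P ->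
  \sum_(v <- bhat (eps n u)) P v = (-1) ^ n *: \sum_(v <- bhat u) P (eps n v).
Proof.
move=> PL; rewrite !bhatE (@coder_eps _ _ _ _ _ _ _ _ _ 1) ?mulr1 //.
by move=> B0 B1 v; rewrite bm_eps.
Qed.

Lemma bhat_ifnn (V : lmodType K) A0 A1 (P : hstr A A0 A1 -> V) u :
  \sum_(v <- bhat u) ifnn P v = \sum_(v <- bhat u) P v.
Proof.
by rewrite !sum_bhat; apply: eq_bigr => c _; apply: eq_bigr => d _; rewrite /ifnn nnil_sins.
Qed.

Lemma bhat_pr1 A0 A1 (u : hstr A A0 A1) : \sum_(v <- bhat u) pr1 v = bm u.
Proof.
rewrite sum_bhat sum_cuts_head0 => [|B0 B1 x c d]; last first.
  by rewrite big1 // => e _; apply: pr1_sinsl.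
by rewrite sum_cuts_tail0 // => B0 B1 c x d; apply: (pr1_sinsr _ _ (snil _)).
Qed.

(** The A-infinity relations for the m_n, evaluated at omega u. *)
Lemma bhat_bm A0 A1 (u : hstr A A0 A1) : \sum_(v <- bhat u) bm v = 0.
Proof.
rewrite sum_bhat -[RHS](am_rel (omega 0 u)) sum_cuts3 sum_cuts_omega.
apply: eq_bigr => -[B c c'] _ /=; rewrite sum_cuts_omega.
apply: eq_cuts => -[D d d'] /= dd; rewrite !ssize_omega !addn0 -dd.
set j := ssize c; set k := ssize d; set l := ssize d'.
have amL B0 B1 : mlin (@am K A B0 B1) by move=> *; apply: am_lin.
rewrite (mlin_sksign_shift (P := fun u => am (sins u _ _))); last exact: mlin_sinsl.
rewrite /bm omega_sins ssize_omega -/j -/k -/l !addn0.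
rewrite (linN (@ksign_lin _ _ _ _)) (linN (lin_mlin _ _ (amL _ _))) opprK.
rewrite [omega l d]omegaE am_eps (linZ (lin_mlin _ _ (amL _ _))) !scalerA.
rewrite [omega l.+1 _]omegaE [omega (k + l) _]omegaE -sksign_omega !sksignD.
have -> : 2 - k%:Z + (k + l)%N%:Z = l.+1%:Z + 1 by lia.
rewrite -[LHS]scale1r; congr (_ *: _).
(* The signs of the two conventions differ by an even exponent. *)
rewrite exprnP -!sgD.
have -> : (j * k + l)%N%:Z + (2 - k%:Z) * j%:Z + l%:Z = (l%:Z + j%:Z) + (l%:Z + j%:Z).
  by rewrite PoszD PoszM; ring.
by rewrite sgD sg_sqr.
Qed.

End Ainfinity.

Section BhatSquare.
Variables (K : fieldType) (A : ainf_cat K).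

(** The square of the bar differential is again a coderivation, with zero
    components by the A-infinity relations. *)
Lemma bhat_sqr (V : lmodType K) A0 A1 (u : hstr A A0 A1) (P : _ -> V) : mlin P ->
  \sum_(v <- bhat u) \sum_(w <- bhat v) P w = 0.
Proof.
apply: (cofree (F1 := idco A) (F2 := idco A) (e := 1 + 1)
  (E := fun V A0 A1 u P => \sum_(v <- bhat u) \sum_(w <- bhat v) P w)).
- by move=> W B0 B1 v Q; apply: eq_bigr => w _; rewrite bhat_ifnn.
- by move=> V1 V2 B0 B1 v Q g gL; rewrite (lin_sum gL); apply: eq_bigr => w _;
    rewrite (lin_sum gL).
- by move=> B0 B1 v; under eq_bigr do rewrite bhat_pr1; exact: bhat_bm.
move=> W B0 B1 v Q Q1 Q2.
under eq_bigr do rewrite bhat_cuts.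
rewrite bhat_cuts; apply: eq_bigr => c _.
rewrite big_split [X in _ + X]big_split /= big_seq1.
under [X in _ = _ + X]eq_bigr do under eq_bigr do rewrite -sksignD.
rewrite addrA -[X in X + _ = _]addrA [X in _ + X + _ = _](_ : _ = 0).
  rewrite addr0; congr (_ + _).
  by do 2!(apply: eq_bigr => ? _); rewrite big_seq1.
rewrite exchange_big -big_split big1 // => z _ /=.
by rewrite (bhat_eps 1 _ (Q1 _ _)) scaleN1r subrr.
Qed.
End BhatSquare.

(** * A-infinity functors as coalgebra maps *)

Section Functor.
Variables (K : fieldType) (A B : ainf_cat K) (f : fdata A B).

(** The terms of F^ without empty blocks. *)
Definition Fl A0 A1 (u : hstr A A0 A1) : seq (hstr B (fo f A0) (fo f A1)) :=
  [seq smap (@Fm _ _ _ f) p | p <- blocks u].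

Lemma Fl_nil A0 : Fl (snil A0) = [:: snil (fo f A0)].
Proof. by []. Qed.

Lemma sum_Fl_scons (V : zmodType) A0 A1 A2 (x : hom A1 A2) (u : hstr A A0 A1)
    (P : _ -> V) :
  \sum_(w <- Fl (scons x u)) P w = \sum_(c <- cuts u) \sum_(w <- Fl (ctail c))
    P (scons (Fm f (scons x (chead c))) w).
Proof.
rewrite big_map sum_blocks_scons; apply: eq_bigr => c _.
by rewrite [RHS]big_map.
Qed.

Lemma Fm_nil A0 : Fm f (snil A0) = 0.
Proof. by []. Qed.

(** Empty blocks contribute nothing, since F_0 = 0. *)
Lemma sum_Fhat (V : lmodType K) A0 A1 (u : hstr A A0 A1) (P : _ -> V) : mlin P ->
  \sum_(w <- Fhat f u) P w = \sum_(w <- Fl u) P w.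
Proof.
move=> PL; transitivity (\sum_(l <- iota 0 (ssize u).+1) \sum_(p <- Delta l u)
    P (smap (@Fm _ _ _ f) p)); first exact: big_allpairs_dep.
move: (ltnSn (ssize u)); move: {2 3}(ssize u).+1 => n.
elim: n A0 A1 u P PL => // n IH A0 A1 u P PL un.
rewrite [iota _ _]/= big_cons -add1n iotaDl big_map.
have -> : \sum_(i <- iota 0 n) \sum_(p <- Delta (1 + i) u) P (smap (@Fm _ _ _ f) p) =
  \sum_(c <- cuts u) \sum_(i <- iota 0 n) \sum_(p <- Delta i (ctail c))
    P (scons (Fm f (chead c)) (smap (@Fm _ _ _ f) p)).
  rewrite exchange_big; apply: eq_bigr => i _.
  by rewrite big_allpairs_dep.
have F0 A2 A3 (v : hstr A A3 A2) (Q : _ -> V) : mlin Q -> \sum_(i <- iota 0 n)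
    \sum_(p <- Delta i v) Q (scons (Fm f (snil A2)) (smap (@Fm _ _ _ f) p)) = 0.
  move=> QL; rewrite big1 // => i _; rewrite big1 // => p _.
  by rewrite Fm_nil; apply: (lin0 (lin_mlin_scons _ QL)).
case: u un P PL => [C|C0 C1 C2 x u] un P PL.
  by rewrite sum_cuts_nil (F0 _ _ (snil C) P PL) !big_seq1 addr0.
rewrite big_nil add0r sum_cuts_cons (F0 _ _ (scons x u) P PL) add0r sum_Fl_scons.
apply: eq_cuts => c cu /=; apply: (IH _ _ _ (fun w => P (scons _ w))).
  exact: mlin_scons.
by apply: (@leq_ltn_trans (ssize u)); rewrite // -cu leq_addl.
Qed.

Lemma Fl_cuts (V : zmodType) A0 A1 (u : hstr A A0 A1) (P : cut _ _ _ -> V) :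
  \sum_(w <- Fl u) \sum_(c <- cuts w) P c =
  \sum_(c <- cuts u) \sum_(v <- Fl (chead c)) \sum_(w <- Fl (ctail c)) P (Cut v w).
Proof.
move: (ltnSn (ssize u)); move: {2}(ssize u).+1 => n.
elim: n A0 A1 u P => // n IH A0 A1 [C|C0 C1 C2 x u] P un.
  by rewrite sum_cuts_nil /= !big_seq1.
rewrite sum_Fl_scons sum_cuts_cons Fl_nil big_seq1 sum_Fl_scons.
under eq_bigr do under eq_bigr do rewrite sum_cuts_cons.
under eq_bigr do rewrite big_split /=.
rewrite big_split /=; congr (_ + _).
under [RHS]eq_bigr do rewrite sum_Fl_scons.
rewrite -(coassoc u (fun c d => \sum_(v <- Fl (chead d)) \sum_(w <- Fl (ctail d))
   P (Cut (scons (Fm f (scons x (chead c))) v) w))).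
apply: eq_cuts => c cu.
apply: (IH _ _ _ (fun d => P (Cut (scons (Fm f (scons x (chead c))) (chead d)) (ctail d)))).
by apply: (@leq_ltn_trans (ssize u)); rewrite // -cu leq_addl.
Qed.

Lemma Fl_pr1 A0 A1 (u : hstr A A0 A1) : \sum_(w <- Fl u) pr1 w = Fm f u.
Proof.
case: u => [C|C0 C1 C2 x u]; first by rewrite Fl_nil big_seq1.
rewrite sum_Fl_scons sum_cuts_tail0 /= ?big_seq1 // => B0 B1 c y d.
by rewrite sum_Fl_scons big1 // => e _; rewrite big1.
Qed.

Lemma Fl_ifnn (V : lmodType K) A0 A1 A2 A3 (u : hstr A A2 A3) (x : hom A1 A2)
    (v : hstr A A0 A1) (P : _ -> V) :
  \sum_(w <- Fl (sins u x v)) ifnn P w = \sum_(w <- Fl (sins u x v)) P w.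
Proof. by case: u x P => [C|C0 C1 C2 y u] x P; rewrite !sum_Fl_scons. Qed.

(** The recursion for Fl including the cut with empty head, on which Fm vanishes;
    in this form it can be combined with [cuts_sins]. *)
Lemma sum_Fl_sins (V : lmodType K) A0 A1 A2 A3 (u : hstr A A2 A3) (x : hom A1 A2)
    (v : hstr A A0 A1) (P : _ -> V) : mlin P ->
  \sum_(w <- Fl (sins u x v)) P w = \sum_(c <- cuts (sins u x v))
    \sum_(w <- Fl (ctail c)) P (scons (Fm f (chead c)) w).
Proof.
move=> PL.
have E B0 B1 B2 (y : hom B1 B2) (w : hstr A B0 B1) (Q : _ -> V) : mlin Q ->
    \sum_(z <- Fl (scons y w)) Q z = \sum_(c <- cuts (scons y w))
    \sum_(z <- Fl (ctail c)) Q (scons (Fm f (chead c)) z).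
  move=> QL; rewrite sum_Fl_scons sum_cuts_cons [X in _ = X + _]big1 ?add0r // => z _.
  by rewrite Fm_nil; apply: (lin0 (lin_mlin_scons _ QL)).
by case: u x P PL => [C|B0 B1 B2 y u] x P PL; apply: E.
Qed.

Lemma mlin_Fl (V : lmodType K) : (forall A0 A1, mlin (@Fm _ _ _ f A0 A1)) ->
  forall A0 A1 (P : hstr B (fo f A0) (fo f A1) -> V), mlin P ->
  mlin (fun u => \sum_(w <- Fl u) P w).
Proof.
move=> FL A0 A1 P PL A2 A3 u v a x y.
move: (ltnSn (ssize u)); move: {2}(ssize u).+1 => n.
elim: n A0 A1 A2 A3 u v x y P PL => // n IH A0 A1 A2 A3 u v x y P PL un.
have E B1 B2 (c : hstr A B2 B1) (d : hstr A A3 B2) (Q : _ -> V) : mlin Q ->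
    (ssize c + ssize d)%N = ssize u ->
    \sum_(w <- Fl (sins d (a *: x + y) v)) Q (scons (Fm f c) w) =
    a *: \sum_(w <- Fl (sins d x v)) Q (scons (Fm f c) w) +
    \sum_(w <- Fl (sins d y v)) Q (scons (Fm f c) w).
  case: c d Q => [B'|C0 C1 C2 z c] d Q QL cd.
    by rewrite !big1 ?scaler0 ?addr0 // => w _; apply: (lin0 (lin_mlin_scons w QL)).
  apply: IH; first exact: mlin_scons.
  by apply: leq_trans (un : (ssize u <= n)%N); rewrite -cd /= addSn ltnS leq_addl.
rewrite !sum_Fl_sins // !cuts_sins scalerDr addrACA !scaler_sumr -!big_split /=.
congr (_ + _); first by apply: eq_cuts => c cu; apply: E.
apply: eq_bigr => c _; rewrite scaler_sumr -big_split; apply: eq_bigr => w _ /=.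
exact: (mlin_lin (lin_mlin_scons w PL) (FL _ _)).
Qed.

Lemma Fl_eps n : (forall A0 A1 (u : hstr A A0 A1), Fm f (eps n u) = eps1 _ _ n (Fm f u)) ->
  forall (V : zmodType) A0 A1 (u : hstr A A0 A1) (P : _ -> V),
  \sum_(w <- Fl (eps n u)) P w = \sum_(w <- Fl u) P (eps n w).
Proof.
move=> Fn V A0 A1 u P; move: (ltnSn (ssize u)); move: {2}(ssize u).+1 => m.
elim: m A0 A1 u P => // m IH A0 A1 [C|C0 C1 C2 x u] P um.
  by rewrite !big_seq1.
rewrite sksign_scons !sum_Fl_scons sum_cuts_sksign; apply: eq_cuts => c cu /=.
rewrite IH; last by apply: (@leq_ltn_trans (ssize u)); rewrite // -cu leq_addl.
by apply: eq_bigr => w _; rewrite -sksign_scons Fn.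
Qed.

End Functor.

Section StrictFunctor.
Variables (K : fieldType) (A B : su_cat K) (f : su_fun A B).

Lemma mlin_Fm A0 A1 : mlin (@Fm _ _ _ f A0 A1).
Proof.
move=> A2 A3 u v a x y; rewrite /Fm !ssize_sins /=.
by apply: (mlin_omega 0 (P := fun u => fm f u)) => B0 B1 *; apply: sf_lin.
Qed.

Lemma Fm_homog A0 A1 (u : hstr A A0 A1) n :
  str_homog sG u n -> homog (sgr B _ _) n (Fm f u).
Proof.
rewrite /Fm; case: eqP => [_ _|/eqP u0 hu]; first exact: homog0.
have := str_homog_shift (str_homog_omega 0 hu); rewrite ssize_omega.
move/sf_deg => /(_ _ f); rewrite ssize_omega => /(_ u0).
by rewrite homog_shift; have -> : n + (ssize u)%:Z + 1 - (ssize u)%:Z = n + 1 by ring.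
Qed.

Lemma Fm_eps n A0 A1 (u : hstr A A0 A1) : Fm f (eps n u) = eps1 _ _ n (Fm f u).
Proof.
rewrite (mlin_parity (gV := sgr B _ _) (e := 0)) ?mulr0 ?expr0z ?scale1r //.
- exact: mlin_Fm.
- by move=> v m hv; rewrite addr0; apply: Fm_homog.
Qed.

Definition Fco : comap (fo f) :=
  Comap (fun A0 => Fl_nil f A0) (@Fl_cuts _ _ _ f) (fun n => @Fl_eps _ _ _ f n (Fm_eps n))
    (fun V => mlin_Fl (V := V) mlin_Fm).

(** The coalgebra map with components F_n commutes with the bar differentials:
    the two composites are coderivations along it with the same components. *)
Lemma bhat_Fl (V : lmodType K) A0 A1 (u : hstr A A0 A1) (P : _ -> V) : mlin P ->
  \sum_(v <- bhat u) \sum_(w <- Fl f v) P w =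
  \sum_(w <- Fl f u) \sum_(v <- bhat w) P v.
Proof.
move=> PL; apply/eqP; rewrite -subr_eq0; apply/eqP; move: P PL.
apply: (cofree (F1 := Fco) (F2 := Fco) (e := 1) (E := fun V A0 A1 u P =>
  \sum_(v <- bhat u) \sum_(w <- Fl f v) P w -
  \sum_(w <- Fl f u) \sum_(v <- bhat w) P v)).
- move=> W B0 B1 v P; congr (_ - _); last first.
    by apply: eq_bigr => w _; rewrite bhat_ifnn.
  rewrite !sum_bhat; apply: eq_bigr => c _; apply: eq_bigr => d _.
  by rewrite Fl_ifnn.
- move=> V1 V2 B0 B1 v Q g gL; rewrite (linD gL) (linN gL) !(lin_sum gL).
  by congr (_ - _); apply: eq_bigr => w _; rewrite (lin_sum gL).
- move=> B0 B1 v; under eq_bigr do rewrite Fl_pr1.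
  under [X in _ - X]eq_bigr do rewrite bhat_pr1.
  by rewrite -sf_dg sum_Fhat ?subrr //; apply: mlin_bm.
move=> W B0 B1 v Q Q1 Q2.
under eq_bigr do rewrite Fl_cuts; rewrite bhat_cuts.
under [X in _ - X]eq_bigr do rewrite bhat_cuts.
rewrite Fl_cuts -sumrB; apply: eq_bigr => c _ /=.
under [X in _ - X]eq_bigr do rewrite big_split.
rewrite [X in _ - X]big_split /= opprD addrACA; congr (_ + _).
  congr (_ - _); apply: eq_bigr => w _; exact: exchange_big.
rewrite sumrB exchange_big; congr (_ - _); symmetry; exact: (co_eps Fco).
Qed.

End StrictFunctor.

(** * The complex of maps between two functors *)

Section Coderivation.
Variables (K : fieldType) (A B : su_cat K) (f1 f2 : su_fun A B).
Implicit Type H : func_space f1 f2.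

(** The terms of FHF without empty blocks. *)
Definition FHFl e H A0 A1 (u : hstr A A0 A1) : seq (hstr B (fo f1 A0) (fo f2 A1)) :=
  coder (Fco f1) (Fco f2) e (fun A0 A1 => H A0 A1) u.

Lemma sum_FHF e H (V : lmodType K) A0 A1 (u : hstr A A0 A1) (P : _ -> V) : mlin P ->
  \sum_(w <- FHF e H u) P w = \sum_(w <- FHFl e H u) P w.
Proof.
move=> PL; rewrite !big_flatten !big_map; apply: eq_bigr => c _.
transitivity (\sum_(w2 <- Fhat f2 (eps e (c3l c))) \sum_(w1 <- Fhat f1 (c3r c))
    P (sins w2 (H _ _ (c3m c)) w1)); first exact: big_allpairs_dep.
rewrite [RHS]big_allpairs_dep sum_Fhat; last first.
  by apply: mlin_sum => w; apply: mlin_sinsl.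
by apply: eq_bigr => w2 _; rewrite sum_Fhat //; apply: mlin_sinsr.
Qed.

Lemma FHFl_pr1 e H A0 A1 (u : hstr A A0 A1) : \sum_(w <- FHFl e H u) pr1 w = H A0 A1 u.
Proof.
rewrite sum_coder sum_cuts_head0 => [|B0 B1 x c d]; last first.
  rewrite [LHS]sum_Fl_scons big1 // => c' _; rewrite big1 // => w2 _.
  by rewrite big1 // => d' _; rewrite big1 // => w1 _; rewrite pr1_sinsl.
rewrite [LHS]big_seq1 sum_cuts_tail0 => [|B0 B1 c x d]; first by rewrite [LHS]big_seq1.
by rewrite [LHS]sum_Fl_scons big1 // => c' _; rewrite big1 // => w2 _; rewrite pr1_sinsr.
Qed.

Lemma FHFl_ifnn e H (V : lmodType K) A0 A1 (P : _ -> V) (u : hstr A A0 A1) :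
  \sum_(w <- FHFl e H u) ifnn P w = \sum_(w <- FHFl e H u) P w.
Proof.
rewrite !sum_coder; apply: eq_bigr => c _; apply: eq_bigr => w2 _.
by apply: eq_bigr => d _; apply: eq_bigr => w1 _; rewrite /ifnn nnil_sins.
Qed.

Lemma FHFl_cuts e H (V : zmodType) A0 A1 (u : hstr A A0 A1) (P : cut _ _ _ -> V) :
  \sum_(w <- FHFl e H u) \sum_(c <- cuts w) P c =
  \sum_(c <- cuts u) (\sum_(v <- FHFl e H (chead c)) \sum_(w <- Fl f1 (ctail c))
     P (Cut v w) + \sum_(v <- Fl f2 (eps e (chead c)))
     \sum_(w <- FHFl e H (ctail c)) P (Cut v w)).
Proof. exact: coder_cuts. Qed.

(** The consequences of being homogeneous of degree e on which the sign computations
    rely. *)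
Definition graded_map e H :=
  (forall A0 A1, mlin (H A0 A1)) /\ (forall n A0 A1 (u : hstr A A0 A1),
     H A0 A1 (eps n u) = (-1) ^ (n * e) *: eps1 _ _ n (H A0 A1 u)).

Lemma in_SHom_graded e H : in_SHom e H -> graded_map e H.
Proof.
case=> [HL Hd _]; have mlH A0 A1 : mlin (H A0 A1) by move=> *; apply: HL.
split=> // n A0 A1 u; exact: (mlin_parity (gV := sgr B _ _) _ _ (mlH _ _) (Hd A0 A1)).
Qed.

Section Rules.
Variables (e : int) (H : func_space f1 f2).
Hypothesis HG : graded_map e H.

Lemma mlin_FHFl (V : lmodType K) A0 A1 (P : _ -> V) : mlin P ->
  mlin (fun u : hstr A A0 A1 => \sum_(w <- FHFl e H u) P w).
Proof. by apply: mlin_coder; case: HG. Qed.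

Lemma FHFl_eps n (V : lmodType K) A0 A1 (u : hstr A A0 A1) (P : _ -> V) : mlin P ->
  \sum_(w <- FHFl e H (eps n u)) P w = (-1) ^ (n * e) *: \sum_(w <- FHFl e H u) P (eps n w).
Proof. by apply: coder_eps; case: HG. Qed.

(** The commutator of a coderivation with the bar differentials is the
    coderivation whose components are the differential of its components. *)
Lemma FHFl_bhat (V : lmodType K) A0 A1 (u : hstr A A0 A1) (P : _ -> V) : mlin P ->
  \sum_(w <- FHFl e H u) \sum_(v <- bhat w) P v
  - (-1) ^ e *: \sum_(v <- bhat u) \sum_(w <- FHFl e H v) P w
  = \sum_(w <- FHFl (e + 1) (func_b1 e H) u) P w.
Proof.
move=> PL; apply/eqP; rewrite -subr_eq0; apply/eqP; move: P PL.
apply: (cofree (F1 := Fco f1) (F2 := Fco f2) (e := e + 1) (E := fun V A0 A1 u P =>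
  \sum_(w <- FHFl e H u) \sum_(v <- bhat w) P v
  - (-1) ^ e *: \sum_(v <- bhat u) \sum_(w <- FHFl e H v) P w
  - \sum_(w <- FHFl (e + 1) (func_b1 e H) u) P w)).
- move=> W B0 B1 v P; rewrite FHFl_ifnn; congr (_ - _ *: _ - _);
    by apply: eq_bigr => w _; rewrite ?bhat_ifnn ?FHFl_ifnn.
- move=> V1 V2 B0 B1 v Q g gL; rewrite !(linD gL) !(linN gL) (linZ gL) !(lin_sum gL).
  by congr (_ - _ *: _ - _); apply: eq_bigr => w _; rewrite (lin_sum gL).
- move=> B0 B1 v; under eq_bigr do rewrite bhat_pr1.
  under [X in _ - _ *: X - _]eq_bigr do rewrite FHFl_pr1.
  rewrite FHFl_pr1 /func_b1 sum_FHF ?subrr //; exact: mlin_bm.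
move=> W B0 B1 v Q Q1 Q2.
under eq_bigr do rewrite bhat_cuts.
under [X in _ - _ *: X - _]eq_bigr do rewrite FHFl_cuts.
rewrite FHFl_cuts bhat_cuts FHFl_cuts scaler_sumr -!sumrB; apply: eq_bigr => c _ /=.
(* The terms in which H and b act on different sides of the cut cancel, since
   F_1^ and F_2^ commute with the bar differentials. *)
have cross12 : \sum_(w <- FHFl e H (chead c)) \sum_(w' <- Fl f1 (ctail c))
    \sum_(z <- bhat w') Q (Cut (eps 1 w) z) = (-1) ^ e *: \sum_(z <- bhat (ctail c))
    \sum_(w <- FHFl e H (eps 1 (chead c))) \sum_(w' <- Fl f1 z) Q (Cut w w').
  rewrite exchange_big [in RHS]exchange_big /= FHFl_eps; last first.
    by apply: mlin_sum => z; apply: mlin_sum => w'; apply: Q1.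
  rewrite scalerA mul1r sg_sqr scale1r exchange_big; apply: eq_bigr => w _.
  by rewrite (bhat_Fl (f := f1)) //; apply: Q2.
have cross21 : \sum_(w <- Fl f2 (eps e (chead c))) \sum_(w' <- FHFl e H (ctail c))
    \sum_(z <- bhat w) Q (Cut z w') = (-1) ^ e *: \sum_(z <- bhat (chead c))
    \sum_(w <- Fl f2 (eps e z)) \sum_(w' <- FHFl e H (ctail c)) Q (Cut w w').
  have RL : mlin (fun w => \sum_(w' <- FHFl e H (ctail c)) Q (Cut w w')).
    by apply: mlin_sum => w'; apply: Q1.
  rewrite -(bhat_eps e _ (mlin_Fl (@mlin_Fm _ _ _ f2) RL)) (bhat_Fl (f := f2)) //.
  by apply: eq_bigr => w _; rewrite exchange_big.
have sum2 I J (r : seq I) (q : seq J) (S T : I -> J -> W) :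
  \sum_(i <- r) \sum_(j <- q) (S i j + T i j) =
  \sum_(i <- r) \sum_(j <- q) S i j + \sum_(i <- r) \sum_(j <- q) T i j.
  by rewrite -big_split; apply: eq_bigr => i _; rewrite big_split.
rewrite !sum2 cross12 cross21 !sumrB !big_split /= -!scaler_sumr !scalerDr.
have -> : \sum_(w <- FHFl e H (chead c)) \sum_(w' <- Fl f1 (ctail c)) \sum_(z <- bhat w)
    Q (Cut z w') = \sum_(w <- FHFl e H (chead c)) \sum_(z <- bhat w)
    \sum_(w' <- Fl f1 (ctail c)) Q (Cut z w').
  by apply: eq_bigr => w _; rewrite exchange_big.
have -> : \sum_(w <- Fl f2 (eps e (chead c))) \sum_(w' <- FHFl e H (ctail c))
    \sum_(z <- bhat w') Q (Cut (eps 1 w) z) = \sum_(w <- Fl f2 (eps (e + 1) (chead c)))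
    \sum_(w' <- FHFl e H (ctail c)) \sum_(z <- bhat w') Q (Cut w z).
  by rewrite addrC -sksignD; symmetry; exact: (co_eps (Fco f2)).
rewrite sksignD; set s := (-1) ^ e.

rewrite !opprD !addrA.
rewrite [LHS](ACl (1*5*9*(4*8*10)*(2*7)*(3*6))) /= !subrr !addr0 !addrA.
by congr (_ - _ *: _ - _); rewrite exchange_big.
Qed.
End Rules.
End Coderivation.

(** * Bicomodule maps *)

Section BipMaps.
Variables (K : fieldType) (A B : su_cat K).
Implicit Types M N L : bdata A B.

Lemma homog_bhat (C : ainf_cat K) (V : lmodType K) (gV : grading V) m n A0 A1
    (u : hstr C A0 A1) (P : _ -> V) :
  str_homog sG u n -> (forall v, str_homog sG v (n + 1) -> homog gV m (P v)) ->
  homog gV m (\sum_(v <- bhat u) P v).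
Proof.
move=> hu h; rewrite sum_bhat; apply: (homog_cuts (g := sG) hu) => B0 c d i j ij hc hd.
apply: (homog_cuts (g := sG) hd) => B1 c1 d1 i1 j1 ij1 hc1 hd1 /=; apply: h.
have -> : n + 1 = i + (i1 + 1) + j1 by rewrite -ij -ij1; ring.
by apply: str_homog_sins => //; [apply: str_homog_sksign | apply: bm_homog].
Qed.

(** G applied to its last three arguments, with the type of the value visible. *)
Definition bip_at M N (G : bip_space M N) A0 A1 B0 B1 (phi : hstr A A0 A1)
  (k : bM M B1 A0) (psi : hstr B B0 B1) : bM N B0 A1 := G _ _ _ _ phi k psi.

Section Bar.
Variables (M N : bdata A B).
Implicit Type G : bip_space M N.

Lemma bip_ext (G G' : bip_space M N) :
  (forall A0 A1 B0 B1 phi k psi, G A0 A1 B0 B1 phi k psi = G' A0 A1 B0 B1 phi k psi) ->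
  G = G'.
Proof. by move=> e; do 7!(apply: functional_extensionality_dep => ?); apply: e. Qed.

(** The part of G o b coming from the bar differentials of A and B. *)
Definition bip_bar G : bip_space M N := fun A0 A1 B0 B1 phi k psi =>
  \sum_(v <- bhat phi) G _ _ _ _ v k psi +
  \sum_(v <- bhat psi) G _ _ _ _ (eps 1 phi) (ksign (shift (bgr M _ _)) 1 k) v.

Lemma bip_mlin1 G A0 A1 B0 B1 k psi : bip_linear G ->
  mlin (fun phi => G A0 A1 B0 B1 phi k psi).
Proof. by case=> h _ _ A2 A3 u v a x y; apply: h. Qed.

Lemma bip_lin2 G A0 A1 B0 B1 phi psi : bip_linear G ->
  lin (fun k => G A0 A1 B0 B1 phi k psi).
Proof. by case=> _ h _ a x y; apply: h. Qed.

Lemma bip_mlin3 G A0 A1 B0 B1 phi k : bip_linear G ->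
  mlin (fun psi => G A0 A1 B0 B1 phi k psi).
Proof. by case=> _ _ h A2 A3 u v a x y; apply: h. Qed.

Lemma bip_linearI G :
  (forall A0 A1 B0 B1 k psi, mlin (fun phi => G A0 A1 B0 B1 phi k psi)) ->
  (forall A0 A1 B0 B1 phi psi, lin (fun k => G A0 A1 B0 B1 phi k psi)) ->
  (forall A0 A1 B0 B1 phi k, mlin (fun psi => G A0 A1 B0 B1 phi k psi)) ->
  bip_linear G.
Proof.
by move=> h1 h2 h3; split=> [A0 A1 A2 A3 B0 B1 u v k psi a x y|
  A0 A1 B0 B1 phi psi a x y|A0 A1 B0 B1 B2 B3 phi k u v a x y];
  [apply: (h1 _ _ _ _ k psi)|apply: h2|apply: h3].
Qed.

Lemma bipE a G G' A0 A1 B0 B1 phi k psi :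
  (a *: G + G') A0 A1 B0 B1 phi k psi =
  a *: G A0 A1 B0 B1 phi k psi + G' A0 A1 B0 B1 phi k psi.
Proof. by []. Qed.

Lemma bip_linearP (a : K) G G' : bip_linear G -> bip_linear G' -> bip_linear (a *: G + G').
Proof.
move=> h h'; apply: bip_linearI => A0 A1 B0 B1 k psi.
- exact: (mlin_add (mlin_scale a (bip_mlin1 _ _ h)) (bip_mlin1 _ _ h')).
- move=> b x y; rewrite !bipE !(bip_lin2 _ _ h) !(bip_lin2 _ _ h') !scalerDr.
  by rewrite addrACA !scalerA mulrC.
- exact: (mlin_add (mlin_scale a (bip_mlin3 _ _ h)) (bip_mlin3 _ _ h')).
Qed.

Definition bip_parity n G := forall m A0 A1 B0 B1 phi k psi,
  G A0 A1 B0 B1 (eps m phi) (ksign (shift (bgr M _ _)) m k) (eps m psi) =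
  (-1) ^ (m * n) *: ksign (shift (bgr N _ _)) m (G _ _ _ _ phi k psi).

(** As [mlin_parity], one argument at a time. *)
Lemma bip_deg_parity n G : bip_linear G -> bip_deg n G -> bip_parity n G.
Proof.
move=> GL Gd m A0 A1 B0 B1 phi k psi; apply/eqP; rewrite -subr_eq0; apply/eqP.
pose D phi k psi := G A0 A1 B0 B1 (eps m phi) (ksign (shift (bgr M _ _)) m k) (eps m psi)
  - (-1) ^ (m * n) *: ksign (shift (bgr N _ _)) m (G _ _ _ _ phi k psi).
have D1 k' psi' : mlin (fun phi => D phi k' psi').
  apply: mlin_add; first exact: (mlin_sksign _ _ (bip_mlin1 _ _ GL)).
  by apply/mlin_opp/mlin_scale; apply: (mlin_lin (@ksign_lin _ _ _ _) (bip_mlin1 _ _ GL)).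
have D3 phi' k' : mlin (fun psi => D phi' k' psi).
  apply: mlin_add; first exact: (mlin_sksign _ _ (bip_mlin3 _ _ GL)).
  by apply/mlin_opp/mlin_scale; apply: (mlin_lin (@ksign_lin _ _ _ _) (bip_mlin3 _ _ GL)).
have D2 phi' psi' : lin (fun k => D phi' k psi').
  move=> a x y; rewrite /D !ksign_lin !(bip_lin2 _ _ GL) !ksign_lin.
  by rewrite [X in _ - X = _]scalerDr opprD addrACA scalerBr !scalerA mulrC.
apply: (mlin_homog0 (g := sG) (D1 k psi)) => phi' p hp.
apply: (mlin_homog0 (g := sG) (D3 phi' k)) => psi' q hq.
have hD r k' : homog (shift (bgr M _ _)) r k' -> D phi' k' psi' = 0.
  move=> hr; rewrite /D (ksign_homog m hr) (linZ (bip_lin2 _ _ GL)).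
  rewrite (mlin_sksign_homog m (bip_mlin1 _ _ GL) hp) (mlin_sksign_homog m (bip_mlin3 _ _ GL) hq).
  rewrite (ksign_homog m (Gd _ _ _ _ _ _ _ _ _ _ hp hr hq)) !scalerA -!sgD.

  have -> : m * n + m * (p + r + q + n) = (m * r + (m * p + m * q)) + (m * n + m * n) by ring.
  by rewrite [in X in _ - X]sgD [(-1) ^ (m * n + m * n)]sgD sg_sqr mulr1 subrr.
apply: (lin_homog (g := shift (bgr M _ _)) (D2 phi' psi') (q := fun=> 0) _ hD).
by move=> a x y; rewrite scaler0 addr0.
Qed.

Lemma bip_bar_linear G : bip_linear G -> bip_linear (bip_bar G).
Proof.
move=> GL; apply: bip_linearI => A0 A1 B0 B1.
- move=> k psi; apply: mlin_add; first exact: (mlin_bhat (bip_mlin1 _ _ GL)).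
  by apply: mlin_sum => v; apply: (mlin_sksign _ _ (bip_mlin1 _ _ GL)).
- move=> phi psi a x y; rewrite /bip_bar scalerDr addrACA !scaler_sumr -!big_split.
  congr (_ + _); apply: eq_bigr => v _; last rewrite ksign_lin;
  exact: (bip_lin2 _ _ GL).
- move=> phi k; apply: mlin_add; last exact: (mlin_bhat (bip_mlin3 _ _ GL)).
  by apply: mlin_sum => v; apply: (bip_mlin3 _ _ GL).
Qed.

Lemma bip_bar_deg n G : bip_deg n G -> bip_deg (n + 1) (bip_bar G).
Proof.
move=> Gd A0 A1 B0 B1 phi k psi p r q hp hr hq; apply: homogD.
  apply: (homog_bhat hp) => v hv.
  by have := Gd _ _ _ _ _ _ _ _ _ _ hv hr hq; congr homog; ring.
apply: (homog_bhat hq) => v hv.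
have := Gd _ _ _ _ _ _ _ _ _ _ (str_homog_sksign 1 hp) (homog_ksign 1 hr) hv.
by congr homog; ring.
Qed.

(** Both bar differentials square to zero; the signs in the second make the two
    anticommute. *)
Lemma bip_bar_sqr G : bip_linear G -> bip_bar (bip_bar G) = 0.
Proof.
move=> GL; apply: bip_ext => A0 A1 B0 B1 phi k psi.
rewrite /bip_bar !big_split /= bhat_sqr ?add0r; last exact: bip_mlin1.
rewrite [X in _ + (_ + X)](_ : _ = 0) ?addr0; last first.
  rewrite -[RHS](bhat_sqr psi (bip_mlin3 phi k GL)).
  by do 2!(apply: eq_bigr => ? _); rewrite sksignK ksignK.
rewrite exchange_big -big_split big1 // => v _ /=.
by rewrite (bhat_eps 1 _ (bip_mlin1 _ _ GL)) scaleN1r subrr.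
Qed.

End Bar.

Section BipComposite.
Variables (M N L : bdata A B).

(** The components of the composite of the bicomodule maps with components R and
    S, S of degree n. *)
Definition bip_comp n (R : bip_space N L) (S : bip_space M N) : bip_space M L :=
  fun A0 A1 B0 B1 phi k psi => \sum_(c <- cuts phi) \sum_(d <- cuts psi)
    R _ _ _ _ (eps n (chead c)) (S _ _ _ _ (ctail c) k (chead d)) (ctail d).

Lemma bip_compDl n R R' S : bip_comp n (R + R') S = bip_comp n R S + bip_comp n R' S.
Proof.
apply: bip_ext => A0 A1 B0 B1 phi k psi; rewrite -[RHS]big_split.
by apply: eq_bigr => c _; rewrite -big_split.
Qed.

Lemma bip_compZl n a R S : bip_comp n (a *: R) S = a *: bip_comp n R S.
Proof.
apply: bip_ext => A0 A1 B0 B1 phi k psi; rewrite [RHS]scaler_sumr.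
by apply: eq_bigr => c _; rewrite scaler_sumr.
Qed.

Lemma bip_compNl n R S : bip_comp n (- R) S = - bip_comp n R S.
Proof. by rewrite -scaleN1r bip_compZl scaleN1r. Qed.

Lemma bip_comp_linear n R S : bip_linear R -> bip_linear S -> bip_linear (bip_comp n R S).
Proof.
move=> RL SL; apply: bip_linearI => A0 A1 B0 B1.
- move=> k psi; apply: mlin_cuts => C v /=; apply: mlin_sum => d.
    exact: (mlin_sksign _ _ (bip_mlin1 _ _ RL)).
  exact: (mlin_lin (bip_lin2 _ _ RL) (bip_mlin1 _ _ SL)).
- move=> phi psi a x y; rewrite /bip_comp scaler_sumr -big_split.
  apply: eq_bigr => c _ /=; rewrite scaler_sumr -big_split.
  by apply: eq_bigr => d _ /=; rewrite (bip_lin2 _ _ SL) (bip_lin2 _ _ RL).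
- move=> phi k; apply: mlin_sum => c; apply: mlin_cuts => C v /=.
    exact: (mlin_lin (bip_lin2 _ _ RL) (bip_mlin3 _ _ SL)).
  exact: (bip_mlin3 _ _ RL).
Qed.

Lemma bip_comp_deg r n R S : bip_deg r R -> bip_deg n S -> bip_deg (r + n) (bip_comp n R S).
Proof.
move=> Rd Sd A0 A1 B0 B1 phi k psi p s q hp hs hq.
apply: (homog_cuts (g := sG) hp) => C c d i j ij hc hd.
apply: (homog_cuts (g := sG) hq) => C' c' d' i' j' ij' hc' hd' /=.
have := Rd _ _ _ _ _ _ _ _ _ _ (str_homog_sksign n hc) (Sd _ _ _ _ _ _ _ _ _ _ hd hs hc') hd'.
by congr homog; rewrite -ij -ij'; ring.
Qed.

Section Linear.
Variables (n : int) (R : bip_space N L).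
Hypothesis RL : bip_linear R.

Lemma bip_compDr S S' : bip_comp n R (S + S') = bip_comp n R S + bip_comp n R S'.
Proof.
apply: bip_ext => A0 A1 B0 B1 phi k psi; rewrite -[RHS]big_split.
apply: eq_bigr => c _; rewrite -big_split; apply: eq_bigr => d _ /=.
exact: (linD (bip_lin2 _ _ RL)).
Qed.

Lemma bip_compZr a S : bip_comp n R (a *: S) = a *: bip_comp n R S.
Proof.
apply: bip_ext => A0 A1 B0 B1 phi k psi; rewrite [RHS]scaler_sumr.
apply: eq_bigr => c _; rewrite scaler_sumr; apply: eq_bigr => d _ /=.
exact: (linZ (bip_lin2 _ _ RL)).
Qed.

Lemma bip_compNr S : bip_comp n R (- S) = - bip_comp n R S.
Proof. by rewrite -scaleN1r bip_compZr scaleN1r. Qed.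

(** The bar differentials are graded derivations for the composition. *)
Lemma bip_bar_comp S : bip_linear S -> bip_parity n S ->
  bip_bar (bip_comp n R S) = (-1) ^ n *: bip_comp n (bip_bar R) S + bip_comp (n + 1) R (bip_bar S).
Proof.
move=> SL Sp; apply: bip_ext => A0 A1 B0 B1 phi k psi.
transitivity (\sum_(c <- cuts phi) \sum_(d <- cuts psi)
  ((\sum_(v <- bhat (chead c)) bip_at R (eps n v) (bip_at S (ctail c) k (chead d)) (ctail d)
  + \sum_(v <- bhat (ctail c)) bip_at R (eps n (eps 1 (chead c)))
      (bip_at S v k (chead d)) (ctail d))
  + (\sum_(v <- bhat (chead d)) bip_at R (eps n (eps 1 (chead c)))
      (bip_at S (eps 1 (ctail c)) (ksign (shift (bgr M _ _)) 1 k) v) (ctail d)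
  + \sum_(v <- bhat (ctail d)) bip_at R (eps n (eps 1 (chead c)))
      (bip_at S (eps 1 (ctail c)) (ksign (shift (bgr M _ _)) 1 k) (eps 1 (chead d))) v)) : bM L B0 A1).
  rewrite /bip_bar /bip_comp bhat_cuts.
  under [X in _ + X]eq_bigr do rewrite sum_cuts_sksign.
  rewrite [X in _ + X]exchange_big -big_split; apply: eq_bigr => c _ /=.
  rewrite bhat_cuts [in RHS]big_split; congr (_ + _).
  by rewrite [RHS]big_split; congr (_ + _); rewrite exchange_big.
rewrite [RHS]bipE [X in X + _]scaler_sumr -[RHS]big_split; apply: eq_bigr => c _ /=.
rewrite scaler_sumr -big_split; apply: eq_bigr => d _ /=.
rewrite {1}/bip_bar (bhat_eps n _ (bip_mlin1 _ _ RL)) scalerDr scalerA sg_sqr scale1r.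
rewrite -addrA -[RHS]addrA; congr (_ + _).
rewrite (linD (bip_lin2 _ _ RL)) !(lin_sum (bip_lin2 _ _ RL)) -sksignD.
rewrite [RHS]addrC -[RHS]addrA; congr (_ + (_ + _)).
rewrite scaler_sumr; apply: eq_bigr => v _.
by rewrite /bip_at Sp mul1r (linZ (bip_lin2 _ _ RL)) sksignC.
Qed.
End Linear.
End BipComposite.

(** Coassociativity for A and for B. *)
Lemma bip_compA M N L O m n (R : bip_space L O) (S : bip_space N L) (T : bip_space M N) :
  bip_linear R -> bip_comp n (bip_comp m R S) T = bip_comp (m + n) R (bip_comp n S T).
Proof.
move=> RL; apply: bip_ext => A0 A1 B0 B1 phi k psi.
transitivity (\sum_(c <- cuts phi) \sum_(e <- cuts (chead c)) \sum_(d <- cuts psi)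
  \sum_(g <- cuts (ctail d)) bip_at R (eps (m + n) (chead e))
    (bip_at S (eps n (ctail e)) (bip_at T (ctail c) k (chead d)) (chead g)) (ctail g) : bM O B0 A1).
  apply: eq_bigr => c _; rewrite [RHS]exchange_big; apply: eq_bigr => d _.
  by rewrite {1}/bip_comp sum_cuts_sksign; do 2!(apply: eq_bigr => ? _); rewrite sksignD.
rewrite -(coassoc phi (fun c e => \sum_(d <- cuts psi) \sum_(g <- cuts (ctail d))
  bip_at R (eps (m + n) (chead c)) (bip_at S (eps n (chead e))
    (bip_at T (ctail e) k (chead d)) (chead g)) (ctail g) : bM O B0 A1)).
apply: eq_bigr => c _.
under eq_bigr do rewrite coassoc.
rewrite exchange_big; apply: eq_bigr => d _ /=.
rewrite (lin_sum (bip_lin2 _ _ RL)); apply: eq_bigr => e _.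
by rewrite (lin_sum (bip_lin2 _ _ RL)).
Qed.

End BipMaps.

(** The differential of a word with a marked letter k acts before k, on a factor
    containing k, or after k. *)
Lemma bhat_sins (K : fieldType) (C : ainf_cat K) (V : zmodType) A0 A1 A2 A3
    (w : hstr C A2 A3) (k : hom A1 A2) (psi : hstr C A0 A1) (P : _ -> V) :
  \sum_(v <- bhat (sins w k psi)) P v =
  \sum_(v <- bhat w) P (sins v k psi)
  + \sum_(c <- cuts w) \sum_(d <- cuts psi)
      P (sins (eps 1 (chead c)) (bm (sins (ctail c) k (chead d))) (ctail d))
  + \sum_(v <- bhat psi) P (sins (eps 1 w) (eps1 _ _ 1 k) v).
Proof.
rewrite !sum_bhat cuts_sins; congr (_ + _); last first.
  by do 2!(apply: eq_bigr => ? _); rewrite /= sksign_sins sins_sinsl.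
rewrite -big_split; apply: eq_bigr => c _; rewrite /= cuts_sins; congr (_ + _).
by apply: eq_bigr => d _; rewrite sins_sinsl.
Qed.

(** * Strict units *)

Section Units.
Variables (K : fieldType) (A : su_cat K).

Lemma eps1_id n (A0 : ob A) : eps1 A0 A0 n (idm A0) = (-1) ^ n *: idm A0.
Proof.
rewrite (@ksign_homog _ _ _ n (-1)) ?mulrN1 ?sgN //.
by rewrite homog_shift addNr; apply: idm_deg.
Qed.

Lemma bm_idl A0 A1 (x : hom (q := A) A0 A1) : bm (scons (idm A1) (scons x (snil A0))) = x.
Proof.
rewrite /bm /= addn0 ksign0 eps1_id expr1z scaleN1r.
have L : mlin (@am K A A0 A1) by move=> *; apply: am_lin.
by rewrite (linN (lin_mlin_scons _ L)) idm_l opprK.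
Qed.

Lemma bm_idr A0 A1 (x : hom (q := A) A0 A1) :
  bm (scons x (scons (idm A0) (snil A0))) = - eps1 _ _ 1 x.
Proof. by rewrite /bm /= addn0 ksign0 idm_r. Qed.

Lemma bm_van (A0 A1 A2 : ob A) (u : hstr A A1 A2) (v : hstr A A0 A1) :
  (ssize u + ssize v)%N != 1%N -> bm (sins u (idm A1) v) = 0.
Proof.
have L : mlin (@am K A A0 A2) by move=> *; apply: am_lin.
move=> uv; rewrite /bm omega_sins eps1_id (linZ (lin_mlin _ _ L)) idm_van ?scaler0 ?oppr0 //.
by rewrite !ssize_omega eqSS.
Qed.

Definition unital (V : lmodType K) A0 A1 (P : hstr A A0 A1 -> V) :=
  forall A2 (u : hstr A A2 A1) (v : hstr A A0 A2), P (sins u (idm A2) v) = 0.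

(** Only the product of the identity with the first letter of v survives. *)
Lemma bm_id_prefixes (V : lmodType K) (A0 A1 : ob A) (v : hstr A A0 A1)
    (P : hstr A A0 A1 -> V) : mlin P ->
  \sum_(d <- cuts v) P (scons (bm (scons (idm A1) (chead d))) (ctail d)) =
  if nnil v then P v else 0.
Proof.
have bm_id (C : ob A) : bm (scons (idm C) (snil C)) = 0 by rewrite -[scons _ _]/(sins (snil C) _ _) bm_van.
case: v P => [C|C0 C1 C2 y v] P PL.
  by rewrite sum_cuts_nil /= bm_id (lin0 (lin_mlin_scons _ PL)).
rewrite sum_cuts_cons /= bm_id (lin0 (lin_mlin_scons _ PL)) add0r.
rewrite sum_cuts_head0 /= ?bm_idl // => B0 B1 x c d.
by rewrite -[scons (idm _) _]/(sins (snil _) _ _) bm_van // (lin0 (lin_mlin_scons _ PL)).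
Qed.

(** The two products of an inner identity with its neighbours cancel, so only
    an identity at an end of a word contributes to the bar differential. *)
Lemma bhat_id (V : lmodType K) A0 A1 A2 (u : hstr A A1 A2) (v : hstr A A0 A1)
    (P : _ -> V) : mlin P -> unital P ->
  \sum_(w <- bhat (sins u (idm A1) v)) P w =
  (if nnil u then 0 else P (scat (eps 1 u) v))
  - (if nnil v then 0 else P (scat (eps 1 u) v)).
Proof.
move=> PL P0; rewrite bhat_sins [X in X + _ + _]big1 ?add0r => [|w _]; last exact: P0.
rewrite [X in _ + X]big1 ?addr0 => [|w _]; last first.
  by rewrite eps1_id (linZ (lin_mlin _ _ PL)) P0 scaler0.
elim: u V P PL {P0} v => [C|C0 C1 C2 x u IH] V P PL v.
  by rewrite sum_cuts_nil [LHS](bm_id_prefixes v PL); case: (nnil v); rewrite ?subr0 ?subrr.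
rewrite sum_cuts_cons sum_cuts_head0 => [|B0 B1 y c d] /=; last first.
  by rewrite bm_van ?(lin0 (lin_mlin_scons _ PL)) //= addnS.
rewrite (IH V (fun w => P (scons (eps1 _ _ 1 x) w))); last exact: mlin_scons.
case: u {IH} x v => [C|D0 D1 D2 y u] x v /=.
  by rewrite [bm _]bm_idr (linN (lin_mlin _ _ PL)) addrA addNr.
rewrite bm_van // (lin0 (lin_mlin_scons _ PL)) add0r.
by case: (nnil v); rewrite ?subrr ?sub0r.
Qed.
End Units.

(** * The complex of maps between two bipolydules *)

Section Bipolydules.
Variables (K : fieldType) (A B : su_cat K).

(** The axioms of strictly unital bipolydules, for the suspended operations. *)
Record bip_axioms (M : bdata A B) : Prop := BipAxioms {
  bb_lin : bip_linear (@bb _ _ _ M : bip_space M M);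
  bb_deg : bip_deg 1 (@bb _ _ _ M : bip_space M M);
  bb_rel : bip_pre (@bb _ _ _ M : bip_space M M) = 0;
  bb_idl : forall A0 B0 (k : bM M B0 A0),
    bb (scons (idm A0) (snil A0)) k (snil B0) = k;
  bb_idr : forall A0 B0 (k : bM M B0 A0),
    bb (snil A0) k (scons (idm B0) (snil B0)) = - ksign (shift (bgr M _ _)) 1 k;
  bb_vanl : forall A0 A1 A2 B0 B1 (u : hstr A A1 A2) (v : hstr A A0 A1)
      (k : bM M B1 A0) (psi : hstr B B0 B1),
    (ssize u + ssize v + ssize psi != 0)%N -> bb (sins u (idm A1) v) k psi = 0;
  bb_vanr : forall A0 A1 B0 B1 B2 (phi : hstr A A0 A1) (k : bM M B2 A0)
      (u : hstr B B1 B2) (v : hstr B B0 B1),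
    (ssize phi + ssize u + ssize v != 0)%N -> bb phi k (sins u (idm B1) v) = 0 }.

Variables (M N : bdata A B).
Implicit Type G : bip_space M N.
Local Notation bbM := (@bb _ _ _ M : bip_space M M).
Local Notation bbN := (@bb _ _ _ N : bip_space N N).

Lemma bip_preE (L L' : bdata A B) (G : bip_space L L') :
  bip_pre G = bip_bar G + bip_comp 1 G (@bb _ _ _ L : bip_space L L).
Proof. by apply: bip_ext => *; rewrite /bip_pre addrAC. Qed.

Lemma bip_barD G G' : bip_bar (G + G') = bip_bar G + bip_bar G'.
Proof. by apply: bip_ext => *; rewrite /bip_bar !big_split addrACA. Qed.

Lemma bip_barZ a G : bip_bar (a *: G) = a *: bip_bar G.
Proof. by apply: bip_ext => *; rewrite /bip_bar -!scaler_sumr -scalerDr. Qed.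

Definition bip_unital G :=
  (forall A0 A1 B0 B1 k psi, unital (fun phi => G A0 A1 B0 B1 phi k psi)) /\
  (forall A0 A1 B0 B1 phi k, unital (fun psi => G A0 A1 B0 B1 phi k psi)).

Lemma in_bip_HomE n G :
  in_bip_Hom n G <-> [/\ bip_linear G, bip_deg n G & bip_unital G].
Proof.
split=> [[GL Gd G1 G2]|[GL Gd [G1 G2]]]; split=> //; first split.
- by move=> A0 A1 B0 B1 k psi A2 u v; apply: G1.
- by move=> A0 A1 B0 B1 phi k B2 u v; apply: G2.
- by move=> A0 A1 A2 B0 B1 u v k psi; apply: (G1 _ _ _ _ k psi).
- by move=> A0 A1 B0 B1 B2 phi k u v; apply: (G2 _ _ _ _ phi k).
Qed.

Hypotheses (MA : bip_axioms M) (NA : bip_axioms N).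

Lemma bip_postE n G : bip_post n G = bip_comp n bbN G.
Proof. by []. Qed.

Definition bip_d n G : bip_space M N := bip_post n G - ((-1) ^ n : K) *: bip_pre G.

Lemma bip_dE n G : bip_d n G = bip_comp n bbN G - (-1) ^ n *: (bip_bar G + bip_comp 1 G bbM).
Proof. by rewrite -bip_preE. Qed.

Lemma bip_d_linear n G : bip_linear G -> bip_linear (bip_d n G).
Proof.
move=> GL; rewrite bip_dE addrC -scaleNr; apply: bip_linearP; last exact: bip_comp_linear (bb_lin NA) GL.
rewrite -[bip_bar G]scale1r; apply: bip_linearP; first exact: bip_bar_linear.
exact: bip_comp_linear (bb_lin MA).
Qed.

Lemma bip_d_deg n G : bip_deg n G -> bip_deg (n + 1) (bip_d n G).
Proof.
move=> Gd A0 A1 B0 B1 phi k psi p r q hp hr hq; rewrite bip_dE.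
apply: homogD; last apply/homogN/homogZ/homogD.
- by rewrite [n + 1]addrC; apply: (bip_comp_deg (bb_deg NA) Gd).
- exact: (bip_bar_deg Gd).
- exact: (bip_comp_deg Gd (bb_deg MA)).
Qed.

Lemma bip_rel (L : bdata A B) : bip_axioms L ->
  bip_bar (@bb _ _ _ L : bip_space L L) =
  - bip_comp 1 (@bb _ _ _ L : bip_space L L) (@bb _ _ _ L : bip_space L L).
Proof. by move=> LA; apply/eqP; rewrite -addr_eq0 -bip_preE (bb_rel LA). Qed.

(** Formal from the bipolydule relation of M: the cross terms cancel by the
    derivation rule. *)
Lemma bip_pre_sqr G : bip_linear G -> bip_pre (bip_pre G) = 0.
Proof.
move=> GL; have bp := bip_deg_parity (bb_lin MA) (bb_deg MA).
rewrite !bip_preE bip_compDl bip_barD (bip_bar_sqr GL) add0r bip_compA //.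
rewrite (bip_bar_comp GL (bb_lin MA) bp) expr1z scaleN1r (bip_rel MA).
by rewrite (bip_compNr _ GL) addrACA addNr add0r addNr.
Qed.

(** The bar differentials of the outer action of N are exchanged for a second
    action of N, by the bipolydule relation of N. *)
Lemma bip_pre_post n G : bip_linear G -> bip_parity n G ->
  bip_pre (bip_post n G) =
  bip_post (n + 1) (bip_pre G) - (-1) ^ n *: bip_post (n + 1) (bip_post n G).
Proof.
move=> GL Gp; rewrite !bip_preE -[bip_post n G]/(bip_comp n bbN G).
rewrite (bip_bar_comp (bb_lin NA) GL Gp) (bip_rel NA) (bip_compA _ _ _ _ (bb_lin NA)).
rewrite bip_compNl scalerN (bip_compA _ _ _ _ (bb_lin NA)) -addrA -(bip_compDr _ (bb_lin NA)).
by rewrite addrC [1 + n]addrC.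
Qed.

Lemma bip_preP a G G' : bip_pre (a *: G + G') = a *: bip_pre G + bip_pre G'.
Proof. by rewrite !bip_preE bip_barD bip_barZ bip_compDl bip_compZl addrACA -scalerDr. Qed.

Lemma bip_postP n a G G' :
  bip_post n (a *: G + G') = a *: bip_post n G + bip_post n G'.
Proof. by rewrite !bip_postE (bip_compDr _ (bb_lin NA)) (bip_compZr _ (bb_lin NA)). Qed.

Lemma bip_dP n a G G' : bip_d n (a *: G + G') = a *: bip_d n G + bip_d n G'.
Proof.
rewrite /bip_d bip_postP bip_preP scalerDr opprD addrACA scalerBr.
by rewrite !scalerA [(-1) ^ n * a]mulrC.
Qed.

Lemma bip_d_sqr n G : bip_linear G -> bip_parity n G -> bip_d (n + 1) (bip_d n G) = 0.
Proof.
move=> GL Gp; rewrite [bip_d n G]/bip_d [bip_post n G - _]addrC -scaleNr bip_dP /bip_d.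
rewrite (bip_pre_sqr GL) scaler0 subr0 (bip_pre_post GL Gp).
rewrite sgD expr1z mulrN1 !scaleNr opprK scalerBr scalerA sg_sqr scale1r.
by rewrite [X in _ + X]addrCA subrr addr0 addNr.
Qed.

(** An identity at the outer end of a word acts as a unit through the target, one next
    to the module argument through the source; both cancel against the unit terms
    of the bar differential. *)
Lemma bip_d_unital n G : bip_linear G -> bip_parity n G -> bip_unital G ->
  bip_unital (bip_d n G).
Proof.
move=> GL Gp [G1 G2]; rewrite bip_dE; split.
- move=> A0 A2 B0 B1 k psi A1 u v.
  have E0 : bip_bar G (sins u (idm A1) v) k psi =
     (if nnil u then 0 else G _ _ _ _ (scat (eps 1 u) v) k psi)
     - (if nnil v then 0 else G _ _ _ _ (scat (eps 1 u) v) k psi).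
    rewrite /bip_bar (bhat_id _ _ (bip_mlin1 _ _ GL) (G1 _ _ _ _ _ _)).
    rewrite [X in _ + X]big1 ?addr0 // => w _.
    rewrite sksign_sins eps1_id (linZ (lin_mlin _ _ (bip_mlin1 _ _ GL))).
    by rewrite (G1 _ _ _ _ _ _) scaler0.
  have E1 : bip_comp n bbN G (sins u (idm A1) v) k psi = (-1) ^ n *:
     (if nnil u then 0 else G _ _ _ _ (scat (eps 1 u) v) k psi).
    rewrite /bip_comp cuts_sins [X in X + _]big1 ?add0r => [|c _]; last first.
      by rewrite big1 // => d _; rewrite (G1 _ _ _ _ _ _) (lin0 (bip_lin2 _ _ (bb_lin NA))).
    rewrite sum_cuts_head0 /= => [|C0 C1 x c d]; last first.
      rewrite big1 // => e _; rewrite sksign_sins eps1_id.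
      rewrite (linZ (lin_mlin _ _ (bip_mlin1 _ _ (bb_lin NA)))) (bb_vanl NA) ?scaler0 //.
      by rewrite /= addnS.
    rewrite sum_cuts_tail0 => [|C0 C1 c x d] /=; last first.
      rewrite sksign_sins eps1_id.
      rewrite (linZ (lin_mlin _ _ (bip_mlin1 _ _ (bb_lin NA)))) (bb_vanl NA) ?scaler0 //.
      by rewrite /= addnS.
    rewrite sksign_sins eps1_id (linZ (lin_mlin _ _ (bip_mlin1 _ _ (bb_lin NA)))).
    congr (_ *: _); case: u v {E0} => [C|C0 C1 C2 x u] v /=; first exact: (bb_idl NA).
    exact: (bb_vanl NA).
  have E2 : bip_comp 1 G bbM (sins u (idm A1) v) k psi =
     (if nnil v then 0 else G _ _ _ _ (scat (eps 1 u) v) k psi).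
    rewrite /bip_comp cuts_sins [X in _ + X]big1 ?addr0 => [|c _]; last first.
      rewrite big1 // => d _; rewrite sksign_sins eps1_id.
      by rewrite (linZ (lin_mlin _ _ (bip_mlin1 _ _ GL))) (G1 _ _ _ _ _ _) scaler0.
    rewrite sum_cuts_tail0 => [|C0 C1 c x d] /=; last first.
      rewrite big1 // => e _; rewrite (bb_vanl MA) ?(lin0 (bip_lin2 _ _ GL)) //.
    rewrite sum_cuts_head0 => [|C0 C1 x c d] /=; last first.
      by rewrite (bb_vanl MA) ?(lin0 (bip_lin2 _ _ GL)) //= addnS.
    case: v u k {E0 E1} => [C|C0 C1 C2 x v] u k /=.
      by rewrite [bb _ _ _](bb_idl MA) scat_snil.
    by rewrite (bb_vanl MA) ?(lin0 (bip_lin2 _ _ GL)).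
  rewrite -[LHS]/(bip_comp n bbN G (sins u (idm A1) v) k psi -
    (-1) ^ n *: (bip_bar G (sins u (idm A1) v) k psi +
       bip_comp 1 G bbM (sins u (idm A1) v) k psi)).
  by rewrite E0 E1 E2 subrK subrr.
- move=> A0 A1 B0 B2 phi k B1 u v.
  pose Y := G A0 A1 B0 B2 (eps 1 phi) (ksign (shift (bgr M _ _)) 1 k) (scat (eps 1 u) v).
  have E0 : bip_bar G phi k (sins u (idm B1) v) =
     (if nnil u then 0 else Y) - (if nnil v then 0 else Y).
    rewrite /bip_bar (bhat_id _ _ (bip_mlin3 _ _ GL) (G2 _ _ _ _ _ _)).
    by rewrite big1 ?add0r // => w _; rewrite (G2 _ _ _ _ _ _).
  have E1 : bip_comp n bbN G phi k (sins u (idm B1) v) = - ((-1) ^ n *: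
     (if nnil v then 0 else Y)).
    rewrite /bip_comp exchange_big cuts_sins [X in _ + X]big1 ?addr0 => [|d _]; last first.
      by rewrite big1 // => c _; rewrite (G2 _ _ _ _ _ _) (lin0 (bip_lin2 _ _ (bb_lin NA))).
    rewrite sum_cuts_tail0 => [|C0 C1 c x d] /=; last first.
      by rewrite big1 // => e _; rewrite (bb_vanr NA) //= addnS.
    rewrite sum_cuts_head0 => [|C0 C1 x c d] /=; last first.
      by rewrite (bb_vanr NA).
    case: v u @Y {E0} => [C|C0 C1 C2 x v] u Y /=; last first.
      by rewrite (bb_vanr NA) ?scaler0 ?oppr0 // addnS.
    rewrite [bb _ _ _](bb_idr NA) /Y scat_snil Gp mul1r scalerA sg_sqr scale1r.
    by [].
  have E2 : bip_comp 1 G bbM phi k (sins u (idm B1) v) =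
     - (if nnil u then 0 else Y).
    rewrite /bip_comp exchange_big cuts_sins [X in X + _]big1 ?add0r => [|d _]; last first.
      by rewrite big1 // => c _; rewrite (G2 _ _ _ _ _ _).
    rewrite sum_cuts_head0 => [|C0 C1 x c d] /=; last first.
      by rewrite big1 // => e _; rewrite (bb_vanr MA) ?(lin0 (bip_lin2 _ _ GL)) //= addnS.
    rewrite sum_cuts_tail0 => [|C0 C1 c x d] /=; last first.
      by rewrite (bb_vanr MA) ?(lin0 (bip_lin2 _ _ GL)).
    case: u v k @Y {E0 E1} => [C|C0 C1 C2 x u] v k Y /=; last first.
      by rewrite (bb_vanr MA) ?(lin0 (bip_lin2 _ _ GL)) ?oppr0.
    by rewrite [bb _ _ _](bb_idr MA) (linN (bip_lin2 _ _ GL)).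
  rewrite -[LHS]/(bip_comp n bbN G phi k (sins u (idm B1) v) -
    (-1) ^ n *: (bip_bar G phi k (sins u (idm B1) v) +
       bip_comp 1 G bbM phi k (sins u (idm B1) v))).
  by rewrite E0 E1 E2 addrAC subrr add0r scalerN subrr.
Qed.

End Bipolydules.

(** * The bipolydule of a functor *)

Arguments bb : simpl never.

Section FunctorUnits.
Variables (K : fieldType) (A B : su_cat K) (f : su_fun A B).

Lemma Fm_id A0 : Fm f (scons (idm A0) (snil A0)) = idm (fo f A0).
Proof. by rewrite /Fm /= addn0 ksign0 sf_id. Qed.

Lemma Fm_van (A0 A1 A2 : ob A) (u : hstr A A1 A2) (v : hstr A A0 A1) :
  (ssize u + ssize v != 0)%N -> Fm f (sins u (idm A1) v) = 0.
Proof.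
move=> uv; rewrite /Fm ssize_sins /= omega_sins eps1_id.
have L : mlin (fun u => @fm _ _ _ f A0 A2 u) by move=> *; apply: sf_lin.
rewrite (linZ (lin_mlin _ _ L)) sf_van ?scaler0 //.
by rewrite !ssize_omega ltnS lt0n.
Qed.

(** F vanishes on longer blocks that contain an identity, so an identity forms a
    block of its own. *)
Lemma Fl_id (V : lmodType K) A0 A1 A2 (u : hstr A A1 A2) (v : hstr A A0 A1)
    (P : hstr B (fo f A0) (fo f A2) -> V) : mlin P ->
  \sum_(w <- Fl f (sins u (idm A1) v)) P w =
  \sum_(w1 <- Fl f u) \sum_(w2 <- Fl f v) P (sins w1 (idm (fo f A1)) w2).
Proof.
move: (ltnSn (ssize u)); move: {2}(ssize u).+1 => n.
elim: n A1 A2 u v P => // n IH A1 A2 [C|C0 C1 C2 x u] v P un PL.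
  rewrite [LHS]sum_Fl_scons sum_cuts_head0 /= => [|B0 B1 x c d].
    by rewrite Fm_id big_seq1.
  rewrite -[scons (idm C) _]/(sins (snil C) _ _) Fm_van // big1 // => w _.
  exact: (lin0 (lin_mlin_scons _ PL)).
rewrite sins_scons !sum_Fl_scons cuts_sins [X in _ + X]big1 ?addr0 => [|c _]; last first.
  rewrite /= -sins_scons Fm_van // big1 // => w _; exact: (lin0 (lin_mlin_scons _ PL)).
apply: eq_cuts => c cu /=; apply: (IH _ _ _ _ (fun w => P (scons _ w))).
  by apply: (@leq_ltn_trans (ssize u)); rewrite // -cu leq_addl.
exact: mlin_scons.
Qed.

Lemma Fl_nnil (V : lmodType K) A0 A1 (u : hstr A A0 A1) (P : _ -> V) : nnil u ->
  \sum_(w <- Fl f u) P w = \sum_(w <- Fl f u) ifnn P w.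
Proof. by case: u P => // C0 C1 C2 x u P _; rewrite !sum_Fl_scons. Qed.

Lemma homog_Fl (V : lmodType K) (gV : grading V) m n A0 A1 (u : hstr A A0 A1)
    (P : _ -> V) :
  str_homog sG u n -> (forall w, str_homog sG w n -> homog gV m (P w)) ->
  homog gV m (\sum_(w <- Fl f u) P w).
Proof.
move: (ltnSn (ssize u)); move: {2}(ssize u).+1 => N.
elim: N A0 A1 u n P => // N IH A0 A1 [C|C0 C1 C2 x u] n P uN hu h.
  by rewrite big_seq1; apply: h.
case: hu => i [hx hu]; rewrite sum_Fl_scons.
apply: (homog_cuts_size hu) => C c d a b ab cd hc hd /=.
apply: (IH _ _ _ b) => //; first by apply: (@leq_ltn_trans (ssize u)); rewrite // -cd leq_addl.
move=> w hw; apply: h; exists (i + a); split.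
  by apply: Fm_homog; exists i; split=> //; rewrite addrAC subrr add0r.
by have -> : n - (i + a) = b by rewrite opprD addrA -ab addrAC subrr add0r.
Qed.
End FunctorUnits.

Section Zfun.
Variables (K : fieldType) (A B : su_cat K) (f : su_fun A B).
Notation zbb := (@bb _ _ _ (zfun f)).

Lemma zbbE A0 A1 B0 B1 (phi : hstr A A0 A1) (k : hom B1 (fo f A0)) (psi : hstr B B0 B1) :
  zbb phi k psi = \sum_(w <- Fl f phi) bm (sins w k psi).
Proof. by apply: sum_Fhat; apply: mlin_sinsl; apply: mlin_bm. Qed.

Lemma zbb_linear : bip_linear (zbb : bip_space (zfun f) (zfun f)).
Proof.
apply: bip_linearI => A0 A1 B0 B1.
- move=> k psi A2 A3 u v a x y; rewrite !zbbE; move: a x y.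
  apply: (mlin_Fl (@mlin_Fm _ _ _ f)); exact: (mlin_sinsl _ _ (@mlin_bm _ _ _ _)).
- move=> phi psi a x y; rewrite !zbbE scaler_sumr -big_split; apply: eq_bigr => w _.
  exact: (lin_mlin _ _ (@mlin_bm _ _ _ _)).
- move=> phi k; have h : mlin (fun psi : hstr B B0 B1 => \sum_(w <- Fl f phi) bm (sins w k psi)).
    by apply: mlin_sum => w; apply: (mlin_sinsr _ _ (@mlin_bm _ _ _ _)).
  by move=> A2 A3 u v a x y; rewrite !zbbE; apply: h.
Qed.

(** The bipolydule relation is the A-infinity relation of B at the words w k psi with
    w in F^ phi. *)
Lemma zbb_axioms : bip_axioms (zfun f).
Proof.
split; first exact: zbb_linear.
- move=> A0 A1 B0 B1 phi k psi p r q hp hr hq; rewrite zbbE.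
  apply: (homog_Fl hp) => w hw; apply: bm_homog.
  exact: str_homog_sins.
- apply: bip_ext => A0 A1 B0 B1 phi k psi.
  transitivity (\sum_(w <- Fl f phi) \sum_(v <- bhat (sins w k psi)) bm v); last first.
    by rewrite big1 // => w _; apply: bhat_bm.
  under [RHS]eq_bigr do rewrite bhat_sins.
  rewrite 2!big_split /=; congr (_ + _ + _).
  + rewrite -bhat_Fl; last exact: (mlin_sinsl _ _ (@mlin_bm _ _ _ _)).
    by apply: eq_bigr => v _; rewrite zbbE.
  + rewrite Fl_cuts; apply: eq_bigr => c _ /=.
    under [RHS]eq_bigr do rewrite exchange_big.
    rewrite [RHS]exchange_big; apply: eq_bigr => d _. rewrite !zbbE.
    rewrite (co_eps (Fco f)); apply: eq_bigr => w _.
    exact: (lin_sum (lin_mlin _ _ (@mlin_bm _ _ _ _))).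
  + rewrite [RHS]exchange_big; apply: eq_bigr => v _.
    by rewrite zbbE (co_eps (Fco f)).
- by move=> A0 B0 k; rewrite zbbE sum_Fl_scons sum_cuts_nil big_seq1 /= Fm_id [LHS]bm_idl.
- by move=> A0 B0 k; rewrite zbbE big_seq1 [LHS]bm_idr.
- move=> A0 A1 A2 B0 B1 u v k psi uvp; rewrite zbbE.
  rewrite Fl_id; last exact: (mlin_sinsl _ _ (@mlin_bm _ _ _ _)).
  have E w1 w2 : (ssize w1 + ssize w2 + ssize psi != 0)%N ->
      bm (sins (sins w1 (idm (fo f A1)) w2) k psi) = 0.
    by move=> n0; rewrite sins_sinsl bm_van // ssize_sins addnS eqSS addnA.
  case: (boolP (nnil u)) => nu.
    rewrite Fl_nnil // big1 // => w1 _; rewrite /ifnn; case: ifP => // nw.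
    by rewrite big1 // => w2 _; rewrite E // -lt0n !addn_gt0 -nnilE nw.
  rewrite big1 // => w1 _; case: (boolP (nnil v)) => nv.
    rewrite Fl_nnil // big1 // => w2 _; rewrite /ifnn; case: ifP => // nw.
    by rewrite E // -lt0n !addn_gt0 -(nnilE w2) nw orbT.
  rewrite big1 // => w2 _; rewrite E // -lt0n addn_gt0 orbC.
  by move: uvp; rewrite -lt0n !addn_gt0 -!nnilE (negPf nu) (negPf nv) /= nnilE => ->.
- move=> A0 A1 B0 B1 B2 phi k u v uvp; rewrite zbbE.
  have E w : (ssize w + ssize u + ssize v != 0)%N -> bm (sins w k (sins u (idm B1) v)) = 0.
    by move=> n0; rewrite -sins_sinsl bm_van // ssize_sins.
  case: (boolP (nnil phi)) => np.
    rewrite Fl_nnil // big1 // => w _; rewrite /ifnn; case: ifP => // nw.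
    by rewrite E // -lt0n !addn_gt0 -(nnilE w) nw.
  rewrite big1 // => w _; apply: E; move: uvp.
  rewrite -!lt0n !addn_gt0 -!nnilE (negPf np) /= => uv.
  by rewrite -orbA uv orbT.
Qed.
End Zfun.

Section SuBipolydule.
Variables (K : fieldType) (A B : su_cat K) (M : bdata A B).

(** The signs of omega on the identities turn the unit conditions for m into those
    for b. *)
Lemma bip_axioms_su : bip_axioms M -> su_bipolydule M.
Proof.
case=> L d rel idl idr vanl vanr; split; split=> //; rewrite /bip_m.
- move=> A0 B0 x; rewrite /= eps1_id expr1z scaleN1r ksign0.
  by rewrite (linN (lin_mlin_scons _ (bip_mlin1 _ _ L))) idl opprK.
- move=> A0 B0 x; rewrite /= addn0 ksign0.
  by rewrite [bb _ _ _]idr ksignK opprK.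
- move=> A0 A1 A2 B0 B1 u v x psi uv; rewrite omega_sins eps1_id.
  rewrite (linZ (lin_mlin _ _ (bip_mlin1 _ _ L))) vanl ?scaler0 ?oppr0 //.
  by rewrite !ssize_omega.
- move=> A0 A1 B0 B1 B2 phi x u v uv; rewrite omega_sins eps1_id.
  rewrite (linZ (lin_mlin _ _ (bip_mlin3 _ _ L))) vanr ?scaler0 ?oppr0 //.
  by rewrite !ssize_omega.
Qed.
End SuBipolydule.

(** * The map z_1 and its retraction *)

Section Yoneda.
Variables (K : fieldType) (A B : su_cat K) (f1 f2 : su_fun A B).
Implicit Types (H : func_space f1 f2) (G : bip_space (zfun f1) (zfun f2)).
Local Notation Z n H := (@z1 K A B f1 f2 n H : bip_space (zfun f1) (zfun f2)).

Lemma z1E n H A0 A1 B0 B1 phi k psi :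
  Z n H A0 A1 B0 B1 phi k psi =
  (-1) ^ (n - 1) *: \sum_(w <- FHFl (n - 1) H phi) bm (sins w k psi).
Proof. by rewrite -sum_FHF //; apply: mlin_sinsl; apply: mlin_bm. Qed.

Lemma homog_FHFl (V : lmodType K) (gV : grading V) e H m n A0 A1 (u : hstr A A0 A1)
    (P : _ -> V) : in_SHom e H ->
  str_homog sG u n -> (forall w, str_homog sG w (n + e) -> homog gV m (P w)) ->
  homog gV m (\sum_(w <- FHFl e H u) P w).
Proof.
move=> [_ Hd _] hu h; rewrite sum_coder.
apply: (homog_cuts (g := sG) hu) => C c d i j ij hc hd /=.
apply: (homog_Fl (str_homog_sksign e hc)) => w2 hw2.
apply: (homog_cuts (g := sG) hd) => D c1 d1 i1 j1 ij1 hc1 hd1 /=.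
apply: (homog_Fl hd1) => w1 hw1; apply: h.
have -> : n + e = i + (i1 + e) + j1 by rewrite -ij -ij1; ring.
by apply: str_homog_sins => //; apply: Hd.
Qed.

(** A unit condition for P that may fail on the word consisting of one identity is
    enough, because the words of FHF also contain a value of H. *)
Lemma FHFl_id e H (V : lmodType K) A0 A1 A2 (u : hstr A A1 A2) (v : hstr A A0 A1)
    (P : hstr B (fo f1 A0) (fo f2 A2) -> V) : in_SHom e H -> mlin P ->
  (forall C (a : hstr B C _) b, (ssize a + ssize b != 0)%N -> P (sins a (idm C) b) = 0) ->
  \sum_(w <- FHFl e H (sins u (idm A1) v)) P w = 0.
Proof.
move=> [_ _ Hv] PL P0; rewrite sum_coder cuts_sins.
rewrite [X in X + _]big1 ?add0r => [|c _]; last first.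
  rewrite big1 // => w2 _; rewrite /= cuts_sins.
  rewrite [X in _ + X]big1 ?addr0 => [|d _]; last first.
    by rewrite big1 // => w1 _; rewrite /= Hv (lin0 (lin_mlin _ _ PL)).
  rewrite big1 // => d _; rewrite /= [LHS]Fl_id; last exact: mlin_sinsr.
  rewrite big1 // => w1 _; rewrite big1 // => w1' _.
  by rewrite -sins_sinsl P0 // ssize_sins.
rewrite big1 // => c _ /=; rewrite sksign_sins eps1_id.
have Q1 : mlin (fun w => \sum_(w2 <- Fl f2 w) \sum_(d <- cuts (ctail c))
    \sum_(w1 <- Fl f1 (ctail d)) P (sins w2 (H _ _ (chead d)) w1)).
  apply: (mlin_Fl (@mlin_Fm _ _ _ f2)); apply: mlin_sum => d; apply: mlin_sum => w1.
  exact: mlin_sinsl.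
rewrite (linZ (lin_mlin _ _ Q1)) [X in _ *: X](_ : _ = 0) ?scaler0 //.
rewrite Fl_id; last first.
  by apply: mlin_sum => d; apply: mlin_sum => w1; exact: mlin_sinsl.
rewrite big1 // => w2 _; rewrite big1 // => w2' _; rewrite big1 // => d _.
by rewrite big1 // => w1 _; rewrite sins_sinsl P0 // ssize_sins addnS.
Qed.

Lemma z1_in n H : in_SHom (n - 1) H -> in_bip_Hom n (Z n H).
Proof.
move=> Hin; have HG := in_SHom_graded Hin.
rewrite in_bip_HomE; split.
- apply: bip_linearI => A0 A1 B0 B1.
  + have h k psi : mlin (fun phi => (-1) ^ (n - 1) *: \sum_(w <- FHFl (n - 1) H phi) bm (sins w k psi)).
      by apply: mlin_scale; apply: (mlin_FHFl HG); exact: (mlin_sinsl _ _ (@mlin_bm _ _ _ _)).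
    by move=> k psi A2 A3 u v a x y; rewrite !z1E; apply: h.
  + move=> phi psi a x y; rewrite !z1E !scalerA [a * _]mulrC -scalerA -scalerDr.
    congr (_ *: _); rewrite scaler_sumr -big_split; apply: eq_bigr => w _.
    exact: (lin_mlin _ _ (@mlin_bm _ _ _ _)).
  + have h phi k : mlin (fun psi => (-1) ^ (n - 1) *: \sum_(w <- FHFl (n - 1) H phi) bm (sins w k psi)).
      by apply/mlin_scale/mlin_sum => w; exact: (mlin_sinsr _ _ (@mlin_bm _ _ _ _)).
    by move=> phi k A2 A3 u v a x y; rewrite !z1E; apply: h.
- move=> A0 A1 B0 B1 phi k psi p r q hp hr hq; rewrite z1E; apply: homogZ.
  apply: (homog_FHFl Hin hp) => w hw.
  have -> : p + r + q + n = (p + (n - 1)) + r + q + 1 by ring.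
  by apply: bm_homog; apply: str_homog_sins.
split=> [A0 A2 B0 B1 k psi A1 u v|A0 A1 B0 B2 phi k B1 u v]; rewrite z1E.
  rewrite (FHFl_id _ _ Hin) ?scaler0 //; first exact: (mlin_sinsl _ _ (@mlin_bm _ _ _ _)).
  by move=> C a b ab; rewrite sins_sinsl bm_van // ssize_sins addnS eqSS addnA; case: (ssize a + _)%N ab.
rewrite sum_coder !big1 ?scaler0 // => c _; rewrite big1 // => w2 _.
rewrite big1 // => d _; rewrite big1 // => w1 _.
by rewrite -[sins _ k _]sins_sinsl bm_van // !ssize_sins addSn.
Qed.

(** The retraction of z_1. *)
Definition eval_id G : func_space f1 f2 := fun A0 A1 phi =>
  - \sum_(c <- cuts phi) \sum_(w <- Fl f1 (ctail c))
      G _ _ _ _ (eps 1 (chead c)) (idm (fo f1 (cmid c))) w.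

Lemma homog_id (C : su_cat K) (A0 : ob C) : homog (sgr C A0 A0) (-1) (idm A0).
Proof. by rewrite homog_shift addNr; apply: idm_deg. Qed.

Lemma eval_id_in n G : in_bip_Hom n G -> in_SHom (n - 1) (eval_id G).
Proof.
rewrite in_bip_HomE => -[GL Gd [G1 G2]]; split.
- move=> A0 A1 A2 A3 u v a x y.
  have h : mlin (fun phi : hstr A A0 A3 => eval_id G phi).
    apply: mlin_opp; apply: mlin_cuts => C w /=.
      by apply: mlin_sum => z; apply: (mlin_sksign _ _ (bip_mlin1 _ _ GL)).
    exact: (mlin_Fl (@mlin_Fm _ _ _ f1) (bip_mlin3 _ _ GL)).
  exact: h.
- move=> A0 A1 u m hu; apply: homogN.
  apply: (homog_cuts (g := sG) hu) => C c d i j ij hc hd /=.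
  apply: (homog_Fl hd) => w hw.
  have := Gd _ _ _ _ _ _ _ _ _ _ (str_homog_sksign 1 hc) (homog_id (fo f1 C)) hw.
  by congr homog; rewrite -ij; ring.
- move=> A0 A1 A2 u v; rewrite /eval_id cuts_sins !big1 ?addr0 ?oppr0 // => c _ /=.
    rewrite big1 // => w _; rewrite sksign_sins eps1_id.
    by rewrite (linZ (lin_mlin _ _ (bip_mlin1 _ _ GL))) (G1 _ _ _ _ _ _) scaler0.
  rewrite Fl_id; last exact: (bip_mlin3 _ _ GL).
  by rewrite big1 // => w1 _; rewrite big1 // => w2 _; apply: (G2 _ _ _ _ _ _).
Qed.

Lemma bm_id_end (C0 C1 : ob B) (w : hstr B C0 C1) :
  bm (sins w (idm C0) (snil C0)) = - eps1 _ _ 1 (pr1 w).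
Proof.
case: w => [C|D0 D1 D2 x w].
  by rewrite bm_van // (lin0 (@ksign_lin _ _ _ _)) oppr0.
case: w x => [C|E0 E1 E2 y w] x; first exact: bm_idr.
by rewrite bm_van // (lin0 (@ksign_lin _ _ _ _)) oppr0.
Qed.

(** The words of FHF are nonempty, so strict units leave only the word of length one,
    with nothing after the identity. The operators eps 1 remain, since H is
    arbitrary here. *)
Lemma eval_id_z1 n H A0 A1 (phi : hstr A A0 A1) :
  eval_id (Z n H) phi = (-1) ^ (n - 1) *: eps1 _ _ 1 (H _ _ (eps 1 phi)).
Proof.
rewrite /eval_id sum_cuts_tail0 => [|C0 C1 c x d] /=; last first.
  rewrite Fl_nnil // big1 // => w _; rewrite /ifnn; case: ifP => // nw.
  rewrite z1E sum_coder !big1 ?scaler0 // => c' _; rewrite big1 // => w2 _.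
  rewrite big1 // => d' _; rewrite big1 // => w1 _.
  rewrite bm_van // ssize_sins; move: nw; rewrite nnilE.
  by case: (ssize w) => // m _; rewrite addnS.
rewrite big_seq1 z1E -scalerN -sumrN; congr (_ *: _).
rewrite -(FHFl_pr1 (n - 1) H) (lin_sum (@ksign_lin _ _ _ _)).
by apply: eq_bigr => w _; rewrite bm_id_end opprK.
Qed.

Lemma eval_id_z1K n H : in_SHom (n - 1) H -> eval_id (Z n H) = H.
Proof.
move=> /in_SHom_graded[_ Hp]; do 3!(apply: functional_extensionality_dep => ?).
by rewrite eval_id_z1 Hp mul1r (linZ (@ksign_lin _ _ _ _)) scalerA sg_sqr scale1r ksignK.
Qed.

(** The A-infinity relation of B at the words w k psi, w in FHF: cutting w to the
    right or to the left of the value of H gives the actions on the source and on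
    the target. *)
Lemma z1_chain n H : graded_map (n - 1) H ->
  Z (n + 1) (func_b1 (n - 1) H) = bip_d n (Z n H).
Proof.
move=> HG; apply: bip_ext => A0 A1 B0 B1 phi k psi.
set e := n - 1 in HG *; have ne : n + 1 - 1 = e + 1 by rewrite /e; ring.
have bmL C0 C1 : mlin (@bm K B C0 C1) by exact: mlin_bm.
rewrite z1E ne -(FHFl_bhat HG); last exact: mlin_sinsl.
have P1 : \sum_(v <- bhat phi) Z n H _ _ _ _ v k psi =
    (-1) ^ e *: \sum_(v <- bhat phi) \sum_(w <- FHFl e H v) bm (sins w k psi).
  by rewrite scaler_sumr; apply: eq_bigr => v _; rewrite z1E.
have P3 : \sum_(v <- bhat psi) Z n H _ _ _ _ (eps 1 phi) (eps1 _ _ 1 k) v =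
    \sum_(w <- FHFl e H phi) \sum_(v <- bhat psi) bm (sins (eps 1 w) (eps1 _ _ 1 k) v).
  rewrite exchange_big; apply: eq_bigr => v _; rewrite z1E (FHFl_eps HG); last exact: mlin_sinsl.
  by rewrite mul1r scalerA sg_sqr scale1r.
have P2 : \sum_(c <- cuts phi) \sum_(d <- cuts psi)
    Z n H _ _ _ _ (eps 1 (chead c)) (@bb _ _ _ (zfun f1) _ _ _ _ (ctail c) k (chead d)) (ctail d) =
  \sum_(c <- cuts phi) \sum_(v <- FHFl e H (chead c)) \sum_(w <- Fl f1 (ctail c))
    \sum_(d <- cuts psi) bm (sins (eps 1 v) (bm (sins w k (chead d))) (ctail d)).
  apply: eq_bigr => c _; under [RHS]eq_bigr do rewrite exchange_big.
  rewrite [RHS]exchange_big; apply: eq_bigr => d _.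
  rewrite z1E (FHFl_eps HG); last exact: mlin_sinsl.
  rewrite mul1r scalerA sg_sqr scale1r; apply: eq_bigr => v _.
  by rewrite zbbE; exact: (lin_sum (lin_mlin _ _ (bmL _ _))).
have P4 : bip_post n (Z n H) phi k psi =
  (-1) ^ e *: \sum_(c <- cuts phi) \sum_(v <- Fl f2 (eps e (chead c)))
    \sum_(w <- FHFl e H (ctail c))
    \sum_(d <- cuts psi) bm (sins (eps 1 v) (bm (sins w k (chead d))) (ctail d)).
  rewrite scaler_sumr; apply: eq_bigr => c _; under [in RHS]eq_bigr do rewrite exchange_big.
  rewrite [in RHS]exchange_big scaler_sumr; apply: eq_bigr => d _.
  have -> : eps n (chead c) = eps 1 (eps e (chead c)).
    by rewrite sksignD; have -> : 1 + e = n by rewrite /e; ring.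
  rewrite zbbE (co_eps (Fco f2)) scaler_sumr; apply: eq_bigr => v _.
  rewrite z1E (linZ (lin_mlin _ _ (bmL _ _))); congr (_ *: _).
  exact: (lin_sum (lin_mlin _ _ (bmL _ _))).
have R0 : \sum_(w <- FHFl e H phi) \sum_(v <- bhat (sins w k psi)) bm v = 0.
  by rewrite big1 // => w _; apply: bhat_bm.
move: R0; under eq_bigr do rewrite bhat_sins.
rewrite 2!big_split /= FHFl_cuts big_split -P2 -P3 => R0.
rewrite -[RHS]/(bip_post n (Z n H) phi k psi -
  (-1) ^ n *: bip_pre (Z n H) phi k psi) /bip_pre P1.
have sn : (-1) ^ n = - (-1) ^ e :> K.
  by have {1}-> : n = e + 1 by [rewrite /e; ring]; rewrite sgD expr1z mulrN1.
rewrite sgD expr1z mulrN1 sn !scaleNr opprK P4.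
move: R0 => /= R0.
set S := \sum_(w <- FHFl e H phi) _ in R0 *; set Q2 := \sum_(c <- cuts phi) _ in R0 *.
set Q3 := \sum_(v <- bhat psi) _ in R0 *; set X := \sum_(c <- cuts phi) _ in R0 *.
rewrite -scalerN -scalerDr; congr (_ *: _); rewrite opprB -!addrA [RHS]addrCA; congr (_ + _).
have -> : S = - (Q2 + X + Q3) by apply/eqP; rewrite -addr_eq0 addrA R0.
by rewrite opprK [Q2 + X]addrC -addrA.
Qed.
End Yoneda.

(** * The contracting homotopy *)

Section FirstLetter.
Variables (K : fieldType) (X : quiver K) (V : lmodType K).

Definition first_letter A0 A1 (g : forall A2, hom A2 A1 -> hstr X A0 A2 -> V)
    (w : hstr X A0 A1) : V :=
  match w in str _ B0 B1 return (forall A2, hom A2 B1 -> hstr X B0 A2 -> V) -> V with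
  | snil _ => fun=> 0
  | scons _ _ _ y w' => fun g => g _ y w'
  end g.

Lemma mlin_first_letter A0 A1 (g : forall A2, hom A2 A1 -> hstr X A0 A2 -> V) :
  (forall A2 w, lin (fun y => g A2 y w)) -> (forall A2 y, mlin (g A2 y)) ->
  mlin (first_letter g).
Proof.
move=> g1 g2 A2 A3 u v a x y.
by case: u g g1 g2 x y => [C|C0 C1 C2 z u] g g1 g2 x y; [apply: g1 | apply: g2].
Qed.

Lemma first_letter_nn A0 A1 (g : forall A2, hom A2 A1 -> hstr X A0 A2 -> V) w :
  (if nnil w then first_letter g w else 0) = first_letter g w.
Proof. by case: w g. Qed.
End FirstLetter.

Section Homotopy.
Variables (K : fieldType) (A B : su_cat K) (f1 f2 : su_fun A B).
Implicit Types (G : bip_space (zfun f1) (zfun f2)).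
Local Notation Z n H := (@z1 K A B f1 f2 n H : bip_space (zfun f1) (zfun f2)).

(** The extra degeneracy of the bar construction. *)
Definition degen G : bip_space (zfun f1) (zfun f2) := fun A0 A1 B0 B1 phi k psi =>
  \sum_(c <- cuts phi) \sum_(w <- Fl f1 (ctail c))
    G _ _ _ _ (eps 1 (chead c)) (idm (fo f1 (cmid c))) (sins w k psi).

Lemma degen_in n G : in_bip_Hom n G -> in_bip_Hom (n - 1) (degen G).
Proof.
rewrite !in_bip_HomE => -[GL Gd [G1 G2]]; split.
- apply: bip_linearI => A0 A1 B0 B1.
  + move=> k psi; apply: mlin_cuts => C z /=.
      by apply: mlin_sum => w; apply: (mlin_sksign _ _ (bip_mlin1 _ _ GL)).
    exact: (mlin_Fl (@mlin_Fm _ _ _ f1) (mlin_sinsl _ _ (bip_mlin3 _ _ GL))).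
  + move=> phi psi a x y; rewrite /degen scaler_sumr -big_split.
    apply: eq_bigr => c _; rewrite scaler_sumr -big_split.
    by apply: eq_bigr => w _; apply: (lin_mlin _ _ (bip_mlin3 _ _ GL)).
  + move=> phi k; apply: mlin_sum => c; apply: mlin_sum => w.
    exact: (mlin_sinsr _ _ (bip_mlin3 _ _ GL)).
- move=> A0 A1 B0 B1 phi k psi p r q hp hr hq.
  apply: (homog_cuts (g := sG) hp) => C c d i j ij hc hd /=.
  apply: (homog_Fl hd) => w hw.
  have := Gd _ _ _ _ _ _ _ _ _ _ (str_homog_sksign 1 hc) (homog_id (fo f1 C))
    (str_homog_sins hw hr hq).
  by congr homog; rewrite -ij; ring.
split=> [A0 A2 B0 B1 k psi A1 u v|A0 A1 B0 B2 phi k B1 u v].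
  rewrite /degen cuts_sins !big1 ?addr0 // => c _ /=.
    rewrite big1 // => w _; rewrite sksign_sins eps1_id.
    by rewrite (linZ (lin_mlin _ _ (bip_mlin1 _ _ GL))) (G1 _ _ _ _ _ _) scaler0.
  rewrite Fl_id; last exact: (mlin_sinsl _ _ (bip_mlin3 _ _ GL)).
  rewrite big1 // => w1 _; rewrite big1 // => w2 _.
  by rewrite sins_sinsl (G2 _ _ _ _ _ _).
rewrite /degen big1 // => c _; rewrite big1 // => w _.
by rewrite -sins_sinsl (G2 _ _ _ _ _ _).
Qed.

(** The factor on which the target acts either contains the module argument, or
    ends before it; the latter terms are the words of FHF for H = r G. *)
Lemma degen_post n G : bip_linear G ->
  degen (bip_post n G) =
  bip_post (n - 1) (degen G) - (-1) ^ (n - 1) *: Z n (eval_id G).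
Proof.
move=> GL; apply: bip_ext => A0 A1 B0 B1 phi k psi.
have bbL := zbb_linear f2.
have en C0 C1 (u : hstr A C0 C1) : eps n (eps 1 u) = eps (n - 1) u.
  have -> : eps n (eps 1 u) = eps (n - 1 + (1 + 1)) u by rewrite sksignD; have -> : n - 1 + (1 + 1) = n + 1 by ring.
  by rewrite -sksignD sksign_even.
rewrite -[RHS]/(bip_post (n - 1) (degen G) phi k psi -
   (-1) ^ (n - 1) *: Z n (eval_id G) _ _ _ _ phi k psi).
rewrite z1E scalerA sg_sqr scale1r -sumrN.
rewrite /degen.
under eq_bigr do under eq_bigr do rewrite /bip_post sum_cuts_sksign.
under eq_bigr do under eq_bigr do under eq_bigr do rewrite cuts_sins.
under eq_bigr do under eq_bigr do rewrite big_split.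
under eq_bigr do rewrite big_split.
rewrite big_split /= addrC; congr (_ + _).
- under eq_bigr do rewrite exchange_big.
  rewrite -(coassoc phi (fun c e => \sum_(w <- Fl f1 (ctail e)) \sum_(d <- cuts psi)
    @bb _ _ _ (zfun f2) _ _ _ _ (eps n (eps 1 (chead c)))
      (G _ _ _ _ (eps 1 (chead e)) (idm (fo f1 (cmid e))) (sins w k (chead d))) (ctail d))).
  apply: eq_bigr => c _; under eq_bigr do rewrite exchange_big.
  rewrite exchange_big; apply: eq_bigr => d _.
  rewrite [RHS](lin_sum (bip_lin2 _ _ bbL)); apply: eq_bigr => e _.
  by rewrite [RHS](lin_sum (bip_lin2 _ _ bbL)); apply: eq_bigr => w _; rewrite en.
- under eq_bigr do rewrite exchange_big.
  rewrite -(coassoc phi (fun c e => \sum_(w <- Fl f1 (ctail e)) \sum_(d <- cuts w)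
    @bb _ _ _ (zfun f2) _ _ _ _ (eps n (eps 1 (chead c)))
      (G _ _ _ _ (eps 1 (chead e)) (idm (fo f1 (cmid e))) (chead d)) (sins (ctail d) k psi))).
  rewrite [RHS]sum_coder; apply: eq_bigr => c _.
  under eq_bigr do rewrite Fl_cuts.
  rewrite (coassoc (ctail c) (fun d x => \sum_(v <- Fl f1 (chead x)) \sum_(w <- Fl f1 (ctail x))
    @bb _ _ _ (zfun f2) _ _ _ _ (eps n (eps 1 (chead c)))
      (G _ _ _ _ (eps 1 (chead d)) (idm (fo f1 (cmid d))) v) (sins w k psi))).
  rewrite [RHS]exchange_big; apply: eq_bigr => d _ /=.
  rewrite [RHS]exchange_big.
  under eq_bigr do rewrite exchange_big.
  rewrite [LHS]exchange_big; apply: eq_bigr => w _.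
  under eq_bigr do under eq_bigr do rewrite zbbE en.
  under eq_bigr do rewrite exchange_big.
  rewrite [LHS]exchange_big; apply: eq_bigr => w2 _.
  rewrite sins_sinsl /eval_id (linN (lin_mlin _ _ (@mlin_bm _ _ _ _))) opprK.
  rewrite (lin_sum (lin_mlin _ _ (@mlin_bm _ _ _ _))); apply: eq_bigr => x _.
  by rewrite (lin_sum (lin_mlin _ _ (@mlin_bm _ _ _ _))).
Qed.

Local Notation bb1 := (@bb _ _ _ (zfun f1) _ _ _ _).

(** G at the word w, whose first letter is taken as the module argument. *)
Definition at_head G A0 A1 (phi : hstr A A0 A1) B0 (w : hstr B B0 (fo f1 A0)) :
    hom B0 (fo f2 A1) :=
  first_letter (fun B2 y w' => G _ _ _ _ phi y w') w.

Lemma mlin_at_head G A0 A1 (phi : hstr A A0 A1) B0 : bip_linear G ->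
  mlin (fun w : hstr B B0 _ => at_head G phi w).
Proof.
move=> GL; apply: mlin_first_letter => [B2 w|B2 y]; first exact: (bip_lin2 _ _ GL).
exact: (bip_mlin3 _ _ GL).
Qed.

(** Of the actions of b on an inserted identity only its products with the two
    neighbours survive. *)
Lemma bb_id_prefixes G C A0 A1 (a : hstr A C A1) (u : hstr A A0 C) B0
    (w : hstr B B0 (fo f1 A0)) : bip_linear G ->
  \sum_(d <- cuts w) G _ _ _ _ a (bb1 u (idm (fo f1 A0)) (chead d)) (ctail d) =
  (if nnil u then 0 else at_head G (scat a u) w) - G _ _ _ _ a (eps1 _ _ 1 (Fm f1 u)) w.
Proof.
move=> GL; case: (boolP (nnil u)) => nu.
  rewrite sum_cuts_head0 => [|B1 B2 y c d] /=; last first.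
    rewrite zbbE Fl_nnil // big1 ?(lin0 (bip_lin2 _ _ GL)) // => z _.
    rewrite /ifnn nnilE; case: ifP => // z0; rewrite bm_van //=.
    by rewrite addnS; case: (ssize z) z0.
  rewrite zbbE -Fl_pr1 (lin_sum (@ksign_lin _ _ _ _)) sub0r.
  rewrite -(linN (bip_lin2 _ _ GL)) -sumrN.
  congr (G _ _ _ _ _ _ _); apply: eq_bigr => z _; exact: bm_id_end.
case: u a w nu => [D|//] a w _.
rewrite Fm_nil !(lin0 (@ksign_lin _ _ _ _)) (lin0 (bip_lin2 _ _ GL)) subr0 scat_snil.
transitivity (\sum_(d <- cuts w) at_head G a (scons (bm (scons (idm (fo f1 D)) (chead d))) (ctail d))).
  by apply: eq_bigr => d _; rewrite zbbE big_seq1.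
rewrite (bm_id_prefixes w (mlin_at_head a GL)).
exact: first_letter_nn.
Qed.

(** The product of the inserted identity with its right neighbour cancels the one
    with its left neighbour at the next cut, except at the cut where the right
    neighbour is k. The differentials elsewhere anticommute with the insertion. *)
Lemma degen_pre G : bip_linear G -> degen (bip_pre G) + bip_pre (degen G) = G.
Proof.
move=> GL; apply: bip_ext => A0 A1 B0 B1 phi k psi.
(* X1, X2, X3, X4: the differential before the identity, between the identity
   and k, on a factor containing k, after k. *)
pose X1 : hom B0 (fo f2 A1) := \sum_(c <- cuts phi) \sum_(v <- bhat (chead c)) \sum_(w <- Fl f1 (ctail c))
  bip_at G (eps 1 v) (idm (fo f1 (cmid c))) (sins w k psi).
pose X2 : hom B0 (fo f2 A1) := \sum_(c <- cuts phi) \sum_(w <- Fl f1 (ctail c)) \sum_(v <- bhat w)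
  bip_at G (chead c) (idm (fo f1 (cmid c))) (sins v k psi).
pose X3 : hom B0 (fo f2 A1) := \sum_(c <- cuts phi) \sum_(w <- Fl f1 (ctail c))
  \sum_(e <- cuts w) \sum_(d <- cuts psi)
  bip_at G (chead c) (idm (fo f1 (cmid c)))
    (sins (eps 1 (chead e)) (bm (sins (ctail e) k (chead d))) (ctail d)).
pose X4 : hom B0 (fo f2 A1) := \sum_(c <- cuts phi) \sum_(w <- Fl f1 (ctail c)) \sum_(v <- bhat psi)
  bip_at G (chead c) (idm (fo f1 (cmid c))) (sins (eps 1 w) (eps1 _ _ 1 k) v).
have e1 : \sum_(c <- cuts phi) \sum_(w <- Fl f1 (ctail c)) \sum_(v <- bhat (eps 1 (chead c)))
  bip_at G v (idm (fo f1 (cmid c))) (sins w k psi) = - X1.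
  rewrite -sumrN; apply: eq_bigr => c _.
  under eq_bigr do rewrite (bhat_eps 1 _ (bip_mlin1 _ _ GL)) scaleN1r.
  by rewrite sumrN exchange_big.
have e2 : \sum_(c <- cuts phi) \sum_(w <- Fl f1 (ctail c))
   \sum_(e <- cuts (eps 1 (chead c))) \sum_(d <- cuts (sins w k psi))
   bip_at G (eps 1 (chead e)) (bb1 (ctail e) (idm (fo f1 (cmid c))) (chead d)) (ctail d) =
   bip_at G phi k psi.
  have E C (a : hstr A C A1) D (W : hstr B D (fo f1 C)) :
      \sum_(e <- cuts (eps 1 a)) \sum_(d <- cuts W)
        bip_at G (eps 1 (chead e)) (bb1 (ctail e) (idm (fo f1 C)) (chead d)) (ctail d) =
      at_head G a W - \sum_(e <- cuts a) bip_at G (chead e) (Fm f1 (ctail e)) W.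
    transitivity (\sum_(e <- cuts (eps 1 a))
      ((if nnil (ctail e) then 0 else at_head G (scat (eps 1 (chead e)) (ctail e)) W)
       - bip_at G (eps 1 (chead e)) (eps1 _ _ 1 (Fm f1 (ctail e))) W)).
      by apply: eq_bigr => e _; apply: bb_id_prefixes.
    rewrite sum_cuts_sksign sumrB; congr (_ - _).
      rewrite sum_cuts_tail0 => [|C0 C1 c x d] //=.
      by rewrite sksignK scat_snil.
    by apply: eq_bigr => e _; rewrite /= sksignK Fm_eps ksignK.
  under eq_bigr do under eq_bigr do rewrite E.
  under eq_bigr do rewrite sumrB exchange_big.
  rewrite sumrB -(coassoc phi (fun c e => \sum_(w <- Fl f1 (ctail e))
    bip_at G (chead c) (Fm f1 (chead e)) (sins w k psi))) -sumrB.
  have E2 C (a : hstr A C A1) (u : hstr A A0 C) :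
    \sum_(w <- Fl f1 u) at_head G a (sins w k psi) - \sum_(e <- cuts u)
      \sum_(w <- Fl f1 (ctail e)) bip_at G a (Fm f1 (chead e)) (sins w k psi) =
    if nnil u then 0 else bip_at G (scat a u) k psi.
    case: u k a {X1 X2 X3 X4 e1} => [D|C0 C1 C2 x u] k' a.
      rewrite big_seq1 sum_cuts_nil big_seq1 Fm_nil scat_snil.
      by rewrite /bip_at (lin0 (bip_lin2 _ _ GL)) subr0.
    rewrite sum_Fl_scons sum_cuts_cons [X in _ - (X + _)]big1 ?add0r ?subrr // => w _.
    by rewrite Fm_nil /bip_at (lin0 (bip_lin2 _ _ GL)).
  under eq_bigr do rewrite E2.
  by rewrite sum_cuts_tail0 //= scat_snil.
have e3 : \sum_(c <- cuts phi) \sum_(w <- Fl f1 (ctail c)) \sum_(v <- bhat (sins w k psi))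
  bip_at G (eps 1 (eps 1 (chead c))) (eps1 _ _ 1 (idm (fo f1 (cmid c)))) v = - (X2 + X3 + X4).
  rewrite -2!big_split -sumrN; apply: eq_bigr => c _ /=; rewrite -2!big_split -sumrN.
  apply: eq_bigr => w _; rewrite bhat_sins /= !opprD -!sumrN.
  have E v : bip_at G (eps 1 (eps 1 (chead c))) (eps1 _ _ 1 (idm (fo f1 (cmid c)))) v =
      - bip_at G (chead c) (idm (fo f1 (cmid c))) v.
    by rewrite sksignK eps1_id expr1z scaleN1r; apply: (linN (bip_lin2 _ _ GL)).
  congr (_ + _ + _); apply: eq_bigr => v _; rewrite ?E // -sumrN.
  by apply: eq_bigr => d _; rewrite E.
have e4 : \sum_(v <- bhat phi) bip_at (degen G) v k psi = X1 + X2.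
  rewrite bhat_cuts -big_split; apply: eq_bigr => c _ /=; congr (_ + _).
  rewrite -(bhat_Fl (f := f1)); last exact: (mlin_sinsl _ _ (bip_mlin3 _ _ GL)).
  by do 2!(apply: eq_bigr => ? _); rewrite /bip_at sksignK.
have e5 : \sum_(c <- cuts phi) \sum_(d <- cuts psi)
  bip_at (degen G) (eps 1 (chead c)) (bb1 (ctail c) k (chead d)) (ctail d) = X3.
  rewrite /X3; under [RHS]eq_bigr do rewrite Fl_cuts.
  rewrite [RHS](coassoc phi (fun c e => \sum_(v <- Fl f1 (chead e)) \sum_(w <- Fl f1 (ctail e))
    \sum_(d <- cuts psi) bip_at G (chead c) (idm (fo f1 (cmid c)))
    (sins (eps 1 v) (bm (sins w k (chead d))) (ctail d)))).
  apply: eq_bigr => c _ /=.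
  under [RHS]eq_bigr do under eq_bigr do rewrite exchange_big.
  under [RHS]eq_bigr do rewrite exchange_big.
  rewrite [RHS]exchange_big; apply: eq_bigr => d _.
  rewrite /bip_at /degen sum_cuts_sksign; apply: eq_bigr => e _ /=.
  rewrite (co_eps (Fco f1)) sksignK; apply: eq_bigr => v _.
  by rewrite zbbE (lin_sum (lin_mlin _ _ (bip_mlin3 _ _ GL))).
have e6 : \sum_(v <- bhat psi) bip_at (degen G) (eps 1 phi) (eps1 _ _ 1 k) v = X4.
  rewrite /X4; under [RHS]eq_bigr do rewrite exchange_big.
  rewrite [RHS]exchange_big; apply: eq_bigr => v _.
  rewrite /bip_at /degen sum_cuts_sksign; apply: eq_bigr => c _ /=.
  by rewrite (co_eps (Fco f1)) sksignK.
transitivity (- X1 + bip_at G phi k psi - (X2 + X3 + X4) + (X1 + X2 + X3 + X4)).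
  rewrite -e1 -e2 -e3 -e4 -{1}e5 -e6; congr (_ + _).
  rewrite -2!big_split; apply: eq_bigr => c _; rewrite -2!big_split.
  by [].
have -> : X1 + X2 + X3 + X4 = X2 + X3 + X4 + X1 by rewrite -!addrA addrC !addrA.
by rewrite addrA subrK addrC addNKr.
Qed.

Lemma homotopy n G : bip_linear G ->
  degen (bip_d n G) - bip_d (n - 1) (degen G) =
  (-1) ^ (n - 1) *: (G - Z n (eval_id G)).
Proof.
move=> GL; rewrite /bip_d.
have degenB X Y s : degen (X - s *: Y) = degen X - s *: degen Y.
  apply: bip_ext => A0 A1 B0 B1 phi k psi.
  rewrite -[RHS]/(degen X phi k psi - s *: degen Y phi k psi) scaler_sumr -sumrB.
  by apply: eq_bigr => c _; rewrite scaler_sumr -sumrB.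
rewrite degenB (degen_post n GL).
have -> : (-1) ^ n = - (-1) ^ (n - 1) :> K.
  by have := @sgD K (n - 1) 1; rewrite subrK expr1z mulrN1.
rewrite scaleNr opprK opprB.
have := degen_pre GL.
move: (degen (bip_pre G)) (bip_pre (degen G)) (bip_post _ _) => R Q P E.
rewrite scalerBr -{2}E scalerDr [LHS]addrC -[P - _ + _]addrA subrKA.
by rewrite [- _ + _]addrC addrCA addrA.
Qed.

End Homotopy.

(** * The quasi-isomorphism *)

Section BipComplex.
Variables (K : fieldType) (A B : su_cat K) (M N : bdata A B).
Hypotheses (MA : bip_axioms M) (NA : bip_axioms N).
Implicit Type G : bip_space M N.

Lemma in_bip_Hom_parity n G : in_bip_Hom n G -> bip_parity n G.
Proof. by case=> GL Gd _ _; apply: bip_deg_parity. Qed.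

Lemma in_bip_Hom0 n : in_bip_Hom n (0 : bip_space M N).
Proof.
rewrite in_bip_HomE; split=> //.
- by apply: bip_linearI => A0 A1 B0 B1 k psi a b c *; rewrite ?scaler0 ?addr0.
- by move=> *; apply: homog0.
Qed.

Lemma in_bip_HomP n a G G' : in_bip_Hom n G -> in_bip_Hom n G' ->
  in_bip_Hom n (a *: G + G').
Proof.
rewrite !in_bip_HomE => -[GL Gd [G1 G2]] [GL' Gd' [G1' G2']]; split.
- exact: bip_linearP.
- by move=> *; apply: homogD; [apply/homogZ/Gd | apply: Gd'].
split=> A0 A1 B0 B1 k psi C u v; rewrite bipE.
  by rewrite (G1 _ _ _ _ _ _) (G1' _ _ _ _ _ _) scaler0 addr0.
by rewrite (G2 _ _ _ _ _ _) (G2' _ _ _ _ _ _) scaler0 addr0.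
Qed.

Lemma bip_d_in n G : in_bip_Hom n G -> in_bip_Hom (n + 1) (bip_d n G).
Proof.
move=> hG; have Gp := in_bip_Hom_parity hG.
move: hG; rewrite !in_bip_HomE => -[GL Gd Gu]; split.
- exact: bip_d_linear.
- exact: bip_d_deg.
exact: bip_d_unital.
Qed.

Lemma bip_dK n G : in_bip_Hom n G -> bip_d (n + 1) (bip_d n G) = 0.
Proof. by move=> hG; apply: bip_d_sqr (in_bip_Hom_parity hG) => //; case: hG. Qed.

Lemma bip_dB n G G' : bip_d n (G - G') = bip_d n G - bip_d n G'.
Proof. by rewrite addrC -scaleN1r (bip_dP NA) scaleN1r addrC. Qed.

Lemma bip_dZ n a G : bip_d n (a *: G) = a *: bip_d n G.
Proof.
have d0 : bip_d n (0 : bip_space M N) = 0.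
  by have := bip_dP NA n (-1) (0 : bip_space M N) 0; rewrite scaler0 addr0 scaleN1r addNr.
by rewrite -[a *: G]addr0 (bip_dP NA) d0 addr0.
Qed.

Lemma Hom_bip_complex : is_complex (Hom_bip M N).
Proof.
move=> n; split.
- exact: in_bip_Hom0.
- by move=> a x y; apply: in_bip_HomP.
- by move=> a x y _ _; apply: bip_dP.
- exact: bip_d_in.
- exact: bip_dK.
Qed.
End BipComplex.

Section Main.
Variables (K : fieldType) (A B : su_cat K) (f1 f2 : su_fun A B).
Implicit Types (H : func_space f1 f2) (G : bip_space (zfun f1) (zfun f2)).
Local Notation Z n H := (@z1 K A B f1 f2 n H : bip_space (zfun f1) (zfun f2)).
Let Z1 := zbb_axioms f1.
Let Z2 := zbb_axioms f2.

Lemma func_ext H H' : (forall A0 A1 u, H A0 A1 u = H' A0 A1 u) -> H = H'.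
Proof. by move=> e; do 3!(apply: functional_extensionality_dep => ?); apply: e. Qed.

Lemma z1P n a H H' : Z n (a *: H + H') = a *: Z n H + Z n H'.
Proof.
apply: bip_ext => A0 A1 B0 B1 phi k psi.
rewrite bipE !z1E scalerA [a * _]mulrC -scalerA -scalerDr; congr (_ *: _).
rewrite !sum_coder scaler_sumr -big_split; apply: eq_bigr => c _.
rewrite scaler_sumr -big_split; apply: eq_bigr => w2 _.
rewrite scaler_sumr -big_split; apply: eq_bigr => d _.
rewrite scaler_sumr -big_split; apply: eq_bigr => w1 _.
by rewrite !sins_sinsl; apply: (lin_mlin _ _ (@mlin_bm _ _ _ _)).
Qed.

Lemma eval_idP a G G' : eval_id (a *: G + G') = a *: eval_id G + eval_id G'.
Proof.
apply: func_ext => A0 A1 phi.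
rewrite -[RHS]/(a *: eval_id G phi + eval_id G' phi) scalerN -opprD; congr (- _).
rewrite scaler_sumr -big_split; apply: eq_bigr => c _.
by rewrite scaler_sumr -big_split.
Qed.

Lemma eval_id0 : eval_id (0 : bip_space (zfun f1) (zfun f2)) = 0.
Proof. by have := eval_idP (-1) 0 0; rewrite scaler0 addr0 scaleN1r addNr. Qed.

Lemma eval_idB G G' : eval_id (G - G') = eval_id G - eval_id G'.
Proof. by rewrite addrC -scaleN1r eval_idP scaleN1r addrC. Qed.

(** H itself need not be known to be graded: it is recovered from z_1 H up to
    operators eps 1, which cancel once z_1 H is graded. *)
Lemma z1_inj n H : in_bip_Hom n (Z n H) -> H = eval_id (Z n H).
Proof.
move=> /eval_id_in/in_SHom_graded[_ Hp]; apply: func_ext => A0 A1 phi.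
have := Hp 1 _ _ phi; rewrite eval_id_z1 sksignK mul1r.
move=> /(congr1 (fun x => (-1) ^ (n - 1) *: eps1 _ _ 1 x)).
by rewrite !(linZ (@ksign_lin _ _ _ _)) !scalerA sg_sqr !scale1r !ksignK.
Qed.

(** Through this formula the differential on Hom(f1, f2) inherits its properties from
    the one on bicomodule maps. *)
Lemma func_b1E n H : in_SHom (n - 1) H ->
  func_b1 (n - 1) H = eval_id (bip_d n (Z n H)).
Proof.
move=> hH; rewrite -z1_chain; last exact: in_SHom_graded.
apply: z1_inj; rewrite z1_chain; last exact: in_SHom_graded.
by apply: (bip_d_in Z1 Z2); apply: z1_in.
Qed.

Lemma func_b1_in n H : in_SHom (n - 1) H -> in_SHom (n + 1 - 1) (func_b1 (n - 1) H).
Proof.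
move=> hH; rewrite func_b1E //; apply: eval_id_in.
by apply: (bip_d_in Z1 Z2); apply: z1_in.
Qed.

Lemma in_SHom0 e : in_SHom e (0 : func_space f1 f2).
Proof.
split=> //; last by move=> *; apply: homog0.
by move=> A0 A1 A2 A3 u v a x y; rewrite scaler0 addr0.
Qed.

Lemma in_SHomP e a H H' : in_SHom e H -> in_SHom e H' -> in_SHom e (a *: H + H').
Proof.
have E A0 A1 u : (a *: H + H') A0 A1 u = a *: H A0 A1 u + H' A0 A1 u by [].
move=> [HL Hd Hu] [HL' Hd' Hu']; split.
- move=> A0 A1 A2 A3 u v b x y; rewrite !E HL HL' !scalerDr addrACA.
  by rewrite !scalerA mulrC.
- by move=> *; apply: homogD; [apply/homogZ/Hd | apply: Hd'].
- by move=> *; rewrite E Hu Hu' scaler0 addr0.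
Qed.

Lemma Hom_func_complex : is_complex (Hom_func f1 f2).
Proof.
move=> n; split.
- exact: in_SHom0.
- by move=> a x y; apply: in_SHomP.
- move=> a x y hx hy; rewrite /= !func_b1E //; last exact: in_SHomP.
  by rewrite z1P (bip_dP Z2) eval_idP.
- exact: func_b1_in.
- move=> x hx; rewrite /= func_b1E; last exact: func_b1_in.
  rewrite z1_chain; last exact: in_SHom_graded.
  by rewrite (bip_dK Z1 Z2) ?eval_id0 //; apply: z1_in.
Qed.

Lemma z1_chain_map : is_chain_map (z1 (f1 := f1) (f2 := f2)).
Proof.
move=> n; split.
- exact: z1_in.
- by move=> a x y _ _; apply: z1P.
- by move=> x hx; apply: z1_chain; apply: in_SHom_graded.
Qed.

Lemma degen0 : degen (0 : bip_space (zfun f1) (zfun f2)) = 0.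
Proof.
by apply: bip_ext => *; rewrite /degen big1 // => c _; rewrite big1.
Qed.

(** The homotopy makes z_1 r a chain map; since z_1 is a chain map with left inverse
    r, so is r. *)
Lemma eval_id_d n G : in_bip_Hom n G ->
  eval_id (bip_d n G) = func_b1 (n - 1) (eval_id G).
Proof.
move=> hG; have hdG := bip_d_in Z1 Z2 hG; have he := eval_id_in hG.
have GL : bip_linear G by case: hG.
rewrite func_b1E //; suff -> : bip_d n (Z n (eval_id G)) = Z (n + 1) (eval_id (bip_d n G)).
  by rewrite (eval_id_z1K (eval_id_in hdG)).
set s := (-1) ^ (n - 1) : K.
have h1 : degen (bip_d n G) - bip_d (n - 1) (degen G) = s *: (G - Z n (eval_id G)).
  exact: homotopy.
have h2 : bip_d n (degen (bip_d n G)) = s *: (bip_d n G - Z (n + 1) (eval_id (bip_d n G))).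
  have := homotopy (n + 1) (bip_d_linear Z1 Z2 n GL).
  rewrite (bip_dK Z1 Z2 hG) degen0 addrK sub0r.
  move/(congr1 -%R); rewrite opprK => ->.
  by have := @sgD K (n - 1) 1; rewrite subrK expr1z mulrN1 -/s => ->; rewrite scaleNr opprK.
have := congr1 (bip_d n) h1; rewrite (bip_dB Z2) (bip_dZ Z2) (bip_dB Z2) h2.
have -> : bip_d n (bip_d (n - 1) (degen G)) = 0.
  by have := bip_dK Z1 Z2 (degen_in hG); rewrite subrK.
rewrite subr0 => /(congr1 (fun x => s *: x)).
rewrite !scalerA sg_sqr !scale1r => /addrI/oppr_inj E; exact: esym E.
Qed.

Lemma z1_quasi_iso : quasi_isomorphism (z1 (f1 := f1) (f2 := f2)).
Proof.
split; [exact: Hom_func_complex|exact: Hom_bip_complex|exact: z1_chain_map|].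
move=> n; split=> [x y [hx _] [hy _] [w [hw xyw]]|y [hy dy]].
  exists (eval_id w); split; first exact: eval_id_in.
  rewrite -[RHS](eval_id_d hw) -[bip_d _ w]xyw -{1}(eval_id_z1K hx) -{1}(eval_id_z1K hy).
  by rewrite -eval_idB.
exists (eval_id y); split.
  split; first exact: eval_id_in.
  by rewrite -[LHS]eval_id_d // [bip_d n y]dy eval_id0.
exists ((-1) ^ (n - 1) *: degen y); split.
  rewrite -[_ *: _]addr0; apply: in_bip_HomP; first exact: degen_in.
  exact: in_bip_Hom0.
have yL : bip_linear y by case: hy.
have := homotopy n yL; rewrite [bip_d n y]dy degen0 sub0r => E.
rewrite -[RHS]/(bip_d (n - 1) ((-1) ^ (n - 1) *: degen y)) (bip_dZ Z2).
by rewrite -[bip_d _ (degen y)]opprK E scalerN scalerA sg_sqr scale1r opprB.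
Qed.
End Main.

Theorem mainTheorem18 (K : fieldType) (A B : su_cat K) (f1 f2 : su_fun A B) :
  su_bipolydule (zfun f1) /\ su_bipolydule (zfun f2) /\
  quasi_isomorphism (C := Hom_func f1 f2) (D := Hom_bip (zfun f1) (zfun f2))
    (z1 (f1 := f1) (f2 := f2)).
Proof.
split; first exact: bip_axioms_su (zbb_axioms f1).
split; first exact: bip_axioms_su (zbb_axioms f2).
exact: z1_quasi_iso.
Qed.
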